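(* Let $d\ge 2$ be a fixed integer. For each $n$, consider the $d$-process on a vertex set of size $n$, and for each $\ell\in\{0,1,\dots,d-2\}$ let $T_\ell=T_\ell(n)$ be the step at which the number of vertices of degree at most $\ell$ becomes $0$. Define $$V_n^{(\ell)}=\frac{(d-1)!\,(dn-2T_\ell)}{\ell!\,(\ln n)^{d-1-\ell}},\qquad \ell\in\{0,1,\dots,d-2\}.$$ Then, as $n\to\infty$, the random $(d-1)$-tuple $\big(V_n^{(0)},V_n^{(1)},\dots,V_n^{(d-2)}\big)$ converges in distribution to a $(d-1)$-tuple of independent exponential random variables, each of mean $1$.
   Context: The $d$-process on $n$ vertices ($d$ fixed, not depending on $n$) is the random sequence of graphs $G_0,G_1,\dots,G_{\lfloor dn/2\rfloor}$ on a fixed set of $n$ vertices where $G_0$ has no edges and, for $1\le i\le\lfloor dn/2\rfloor$, $G_i$ is obtained from $G_{i-1}$ by adding one edge $\{u,v\}$ chosen uniformly at random among all pairs of distinct vertices that are non-adjacent in $G_{i-1}$ and both have degree at most $d-1$ in $G_{i-1}$; if no such pair exists, $G_i=G_{i-1}$. Thus $T_\ell=\min\{i: G_i \text{ has no vertex of degree at most } \ell\}$. If no such $i$ exists, $T_\ell$ is assigned the value $\lfloor dn/2\rfloor$. *)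

(* Defs.v *)
From HB Require Import structures.
From mathcomp Require Import all_boot all_order all_algebra.
From mathcomp Require Import all_classical all_reals all_analysis.
Import Order.TTheory GRing.Theory Num.Theory.
Import numFieldNormedType.Exports.

Set Implicit Arguments.
Unset Strict Implicit.
Unset Printing Implicit Defensive.

Local Open Scope ring_scope.
Local Open Scope set_scope.

(* A graph on V is given by its edge set; the d-process starts from the empty
   edge set and only ever adds 2-element subsets of V. *)
Definition graph (V : finType) : Type := {set {set V}}.

Definition degree (V : finType) (E : graph V) (v : V) : nat :=
  #|[set e in E | v \in e]|.

Definition free_pairs (d : nat) (V : finType) (E : graph V) : {set {set V}} :=
  [set e : {set V} |
    [&& #|e| == 2, e \notin E & [forall v in e, degree E v <= d.-1]]]%N.

(* Distinct free pairs e give distinct graphs e |: E, so the sum below is the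
   law of e |: E for a uniform random free pair e. *)
Definition step_prob (R : realType) (d : nat) (V : finType) (E F : graph V) :
    R :=
  if free_pairs d E == finset.set0 then (F == E)%:R
  else \sum_(e in free_pairs d E) (F == e |: E)%:R / #|free_pairs d E|%:R.

Definition last_step (d n : nat) : nat := (d * n)./2.

Local Open Scope classical_set_scope.

(* dproc_step says that P[G_(i+1) = g_(i+1) | G_0 = g_0, ..., G_i = g_i]
   equals step_prob (g_i) (g_(i+1)), multiplied out so that conditioning
   events of probability zero need no convention. Only the indices
   0, ..., last_step d n of the sequence G matter. *)
Record is_d_process (R : realType) (d n : nat) (disp : measure_display)
    (T : measurableType disp) (P : probability T R)
    (G : nat -> T -> graph 'I_n) : Prop := IsDProcess {
  dproc_measurable : forall (i : nat) (g : graph 'I_n),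
    (i <= last_step d n)%N -> measurable [set w | G i w = g] ;
  dproc_start : P [set w | G 0%N w = finset.set0] = 1%E ;
  dproc_step : forall (i : nat) (g : nat -> graph 'I_n),
    (i < last_step d n)%N ->
    P [set w | forall j, (j <= i.+1)%N -> G j w = g j] =
    (P [set w | forall j, (j <= i)%N -> G j w = g j] *
     (step_prob R d (g i) (g i.+1))%:E)%E
}.

Definition no_vertex_deg_le (l : nat) (V : finType) (E : graph V) : bool :=
  [forall v, ~~ (degree E v <= l)%N].

(* find returns the size (last_step d n).+1 of the list when no index
   qualifies; minn then yields the default value last_step d n. *)
Definition hitting_step (d n l : nat) (g : nat -> graph 'I_n) : nat :=
  minn (last_step d n)
    (find (fun i => no_vertex_deg_le l (g i)) (iota 0 (last_step d n).+1)).

Definition Vstat (R : realType) (d n l : nat) (g : nat -> graph 'I_n) : R :=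
  (d.-1`!%:R * ((d * n)%:R - 2 * (hitting_step d l g)%:R)) /
  (l`!%:R * ln n%:R ^+ (d.-1 - l)).

Definition joint_cdf (R : realType) (disp : measure_display)
    (T : measurableType disp) (P : probability T R) (k : nat)
    (X : 'I_k -> T -> R) (x : 'rV[R]_k) : R :=
  fine (P [set w | forall l : 'I_k, X l w <= x ord0 l]).

(* Convergence in distribution of random vectors, possibly defined on
   different probability spaces: the joint distribution functions converge at
   every continuity point of the limiting one. *)
Definition cvg_in_distribution (R : realType) (k : nat)
    (disp : nat -> measure_display) (T : forall n, measurableType (disp n))
    (P : forall n, probability (T n) R) (X : forall n, 'I_k -> T n -> R)
    (disp' : measure_display) (T' : measurableType disp')
    (P' : probability T' R) (Z : 'I_k -> T' -> R) : Prop :=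
  forall x : 'rV[R]_k, {for x, continuous (joint_cdf P' Z)} ->
    (fun n => joint_cdf (P n) (X n) x) @ \oo --> joint_cdf P' Z x.

Definition mutually_independent (R : realType) (disp : measure_display)
    (T : measurableType disp) (P : probability T R) (I : finType)
    (Z : I -> {RV P >-> R}) : Prop :=
  forall (J : {set I}) (A : I -> set R), (forall i, measurable (A i)) ->
    P [set w | forall i, i \in J -> A i (Z i w)] =
    (\prod_(i in J) P (Z i @^-1` A i))%E.

(* The parameter of exponential_prob is the rate, so that rate 1 is mean 1. *)
Definition exponential_mean1 (R : realType) (disp : measure_display)
    (T : measurableType disp) (P : probability T R) (Z : {RV P >-> R}) : Prop :=
  forall A : set R, measurable A ->
    distribution P Z A = exponential_prob (1 : R) A.

(* Main.v *)
Require Import Defs.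
From HB Require Import structures.
From mathcomp Require Import all_boot all_order all_algebra.
From mathcomp Require Import all_classical all_reals all_analysis.
From mathcomp Require Import ring lra zify.

(** The proof splits the process where its slack, the total number [d * n - 2 * i]
of degrees still missing, falls to about [L ^ (d + 1)] with [L = ln n].

Before that point, two facts pin down the degree counts. At every step each
unsaturated vertex is hit with probability close to [2 / U], where [U] is the
number of unsaturated vertices; so on a clock that advances by [2 / U] per step
the vertices behave like independent rate-one Poisson counters stopped at [d],
and the number of vertices of degree [k < d] should be near
[n e^(-s) s^k / k!] at clock time [s]. The clock is random, but on it the
expected changes are linear in the counts, and the sum of the squared scaled
deviations is almost a supermartingale ([discrepancy_step]), hence small
([discrepancy_large_prob]). And the slack, which is known exactly, is a
combination of the same counts, which forces [s] to be [L] up to a multiple of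
[ln L]. So with high probability the number of vertices of degree [k] is then
close to [A L^k / k!] for some [A], simultaneously for all [k < d]
([stopped_profile]).

After that point, all but a proportion of order [1 / L] of the unsaturated
vertices have degree [d - 1] and disappear when they are hit. A step at slack
[S] hits a given vertex with probability about [2 / S] and reduces the slack by
two, so a vertex remains unhit from slack [S] to slack [S'] with probability
about [S' / S], and distinct vertices do so almost independently. Vertices of
degree at most [l] are in proportion [(d-1)! / (l! L^(d-1-l))] to the slack and,
up to a proportion of order [1 / L], have degree exactly [l], so that one hit
removes them from their class. At slack [x l! L^(d-1-l) / (d-1)!] their number is
therefore nearly Poisson of mean [x], and none is left with probability nearly
[e^(-x)]. For different [l] the events concern different vertices, whence the
product in the limit. This is made precise by a forecast of the final
probability from the present graph which is a martingale up to summable errors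
([emptiness_step], [forecast_window]); the errors are controlled by weighted
counts of low-degree vertices that decay like the slack
([low_weight_supermartingale]). [emptiness_limit] combines the two stages.

Finally [V^(l) <= x] holds exactly if some vertex of degree at most [l] is left
when the slack is [x l! L^(d-1-l) / (d-1)!] ([Vstat_le]), so inclusion and
exclusion over the sets of indices gives the convergence of the joint
distribution functions to the products of the [1 - e^(-x)] ([cdf_cvg]). *)

Import Order.TTheory GRing.Theory Num.Theory.
Import numFieldNormedType.Exports.

Set Implicit Arguments.
Unset Strict Implicit.
Unset Printing Implicit Defensive.

Local Open Scope ring_scope.
Local Open Scope set_scope.

(** * Free pairs and hits *)

Section GraphCounts.
Variables (d : nat) (V : finType).
Implicit Types (E : graph V) (e : {set V}) (u v : V).

Definition unsat E : {set V} := [set v | (degree E v < d)%N].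

(** While the process is not stuck, [slack] after [i] steps is [d * n - 2 * i].
*)
Definition slack E : nat := (\sum_v (d - degree E v))%N.

Definition hits E v : nat := #|[set e in free_pairs d E | v \in e]|.

Lemma free_pairsP E e : (0 < d)%N -> e \in free_pairs d E ->
  [/\ #|e| = 2, e \notin E & e \subset unsat E]%N.
Proof.
move=> d0; rewrite inE => /and3P[/eqP-> -> /forallP h]; split => //.
apply/fintype.subsetP => v ve; rewrite inE; have /implyP := h v.
by move=> /(_ ve); lia.
Qed.

Lemma degreeU E e v : e \notin E ->
  degree (e |: E) v = (degree E v + (v \in e))%N.
Proof.
move=> eE; rewrite /degree; case: (boolP (v \in e)) => ve.
  have -> : [set e0 in e |: E | v \in e0] = e |: [set e0 in E | v \in e0].
    apply/setP => f; rewrite !inE; case: eqP => [->|] //=; by rewrite ve.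
  by rewrite cardsU1 inE (negbTE eE) addnC.
rewrite addn0; congr #|pred_of_set _|; apply/setP => f; rewrite !inE.
by case: eqP => [->|] //=; rewrite (negbTE ve) (negbTE eE).
Qed.

Lemma slack_step E e : (0 < d)%N -> e \in free_pairs d E ->
  slack E = (slack (e |: E) + 2)%N.
Proof.
move=> d0 /(free_pairsP d0)[e2 eE /fintype.subsetP eU]; rewrite /slack.
rewrite -{}e2 -sum1_card (big_mkcond (fun v => v \in e)) -big_split /=.
apply: eq_bigr => v _; rewrite degreeU//.
case: (boolP (v \in e)) => ve; last by rewrite !addn0.
by have := eU _ ve; rewrite inE; lia.
Qed.

Lemma slack_le_unsat E : (slack E <= d * #|unsat E|)%N.
Proof.
rewrite /slack mulnC -sum_nat_const (bigID (mem (unsat E))) /= [X in (_ + X)%N]big1.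
  by rewrite addn0; apply: leq_sum => v _; rewrite leq_subr.
by move=> v; rewrite inE -leqNgt => h; apply/eqP; rewrite subn_eq0.
Qed.

(** The only unsaturated partners that [v] cannot be paired with are [v] itself
and its neighbours, and an unsaturated [v] has at most [d - 1] of these. *)
Lemma hits_bounds E v : v \in unsat E ->
  (#|unsat E| - d <= hits E v <= #|unsat E| - 1)%N.
Proof.
move=> vU; have d0 : (0 < d)%N by move: vU; rewrite inE; lia.
have pair_inj : {in [set u | u != v] &, injective (fun u => [set v; u])}.
  move=> u1 u2; rewrite !inE => u1v u2v /= h.
  have : u1 \in [set v; u2] by rewrite -h !inE eqxx orbT.
  by rewrite !inE (negbTE u1v) => /eqP.
pose N := [set u in unsat E :\ v | [set v; u] \in E].
have cN : (#|N| <= d.-1)%N.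
  have h1 : (degree E v <= d.-1)%N by move: vU; rewrite inE; lia.
  apply: leq_trans h1; rewrite /degree.
  rewrite -(card_in_imset (f := fun u => [set v; u]) (D := mem N)); last first.
    move=> u1 u2; rewrite inE !in_setD1 => /andP[/andP[h1 _] _].
    rewrite inE !in_setD1 => /andP[/andP[h2 _] _].
    by apply: pair_inj; rewrite inE.
  apply: subset_leq_card; apply/fintype.subsetP => f /imsetP[u]; rewrite !inE.
  by move=> /andP[_ h] ->; rewrite h !inE eqxx.
have -> : hits E v = #|(unsat E :\ v) :\: N|.
  rewrite /hits -(card_in_imset (f := fun u => [set v; u])
     (D := mem ((unsat E :\ v) :\: N))); last first.
    move=> u1 u2; rewrite finset.in_setD in_setD1 => /andP[_ /andP[h1 _]].
    rewrite finset.in_setD in_setD1 => /andP[_ /andP[h2 _]].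
    by apply: pair_inj; rewrite inE.
  congr #|pred_of_set _|; apply/setP => f; apply/idP/imsetP.
    rewrite inE => /andP[fF vf].
    have [f2 fE fU] := free_pairsP d0 fF.
    have /cards1P[u fu] : #|f :\ v| == 1%N.
      by have := cardsD1 v f; rewrite vf f2; lia.
    have fE' : f = [set v; u] by rewrite -fu finset.setD1K.
    have uf : u \in f :\ v by rewrite fu inE.
    exists u => //; move: uf; rewrite in_setD1 => /andP[uv uf].
    rewrite finset.in_setD in_setD1 uv (fintype.subsetP fU _ uf) /= andbT inE in_setD1 uv.
    by rewrite (fintype.subsetP fU _ uf) /= -fE'.
  move=> [u]; rewrite finset.in_setD !inE => /andP[h /andP[uv uU]] ->.
  rewrite !inE eqxx /= andbT cards2 (eq_sym v u) uv /=; apply/andP; split.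
    by apply/negP => h2; move: h; rewrite uv uU h2.
  apply/forallP => w; apply/implyP; rewrite !inE => /orP[]/eqP->.
    by move: vU; rewrite inE; lia.
  by lia.
have := cardsD1 v (unsat E); rewrite vU => cU.
have NU : N \subset unsat E :\ v.
  by apply/fintype.subsetP => u; rewrite inE => /andP[].
rewrite cardsD (finset.setIidPr NU); have := subset_leq_card NU.
move: cU cN; set a := #|_|; set b := #|_|; set c := #|_|; lia.
Qed.

Lemma hits_sat E v : (0 < d)%N -> v \notin unsat E -> hits E v = 0%N.
Proof.
move=> d0 vU; apply/eqP; rewrite cards_eq0; apply/eqP/setP => e.
rewrite finset.in_set0 finset.in_set; apply/negP => /andP[/(free_pairsP d0)[_ _ /fintype.subsetP eU] ve].
by move/negP: vU; apply; apply: eU.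
Qed.

(** Each free pair is counted at both of its ends. *)
Lemma sum_hits E : (0 < d)%N -> (\sum_v hits E v = 2 * #|free_pairs d E|)%N.
Proof.
move=> d0; transitivity (\sum_(e in free_pairs d E) #|e|)%N.
  transitivity (\sum_v \sum_(e in free_pairs d E) (v \in e))%N.
    apply: eq_bigr => v _; rewrite /hits -sum1_card big_mkcond /=.
    rewrite [RHS]big_mkcond /=; apply: eq_bigr => e _.
    by rewrite finset.in_set; case: (e \in _); case: (v \in e).
  rewrite exchange_big /=; apply: eq_bigr => e _.
  by rewrite -sum1_card [RHS]big_mkcond.
rewrite mulnC -sum_nat_const; apply: eq_bigr => e.
by move=> /(free_pairsP d0)[].
Qed.

Lemma card_free_pairs_bounds E : (0 < d)%N ->
  (#|unsat E| * (#|unsat E| - d) <= 2 * #|free_pairs d E|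
   <= #|unsat E| * (#|unsat E| - 1))%N.
Proof.
move=> d0; rewrite -sum_hits// (bigID (mem (unsat E))) /=.
rewrite [X in (_ + X)%N]big1 ?addn0; last by move=> v; exact: hits_sat.
rewrite -!sum_nat_const; apply/andP; split; apply: leq_sum => v /hits_bounds;
by move=> /andP[].
Qed.

(** More than [d] unsaturated vertices cannot all be adjacent, so the process is
not stuck. *)
Lemma free_pairs_neq0 E : (0 < d)%N -> (d * d < slack E)%N ->
  (0 < #|free_pairs d E|)%N.
Proof.
move=> d0 hS; have h1 := slack_le_unsat E.
have /andP[h2 _] := card_free_pairs_bounds E d0.
have h3 : (d < #|unsat E|)%N.
  by rewrite -(ltn_pmul2l d0); apply: leq_trans h1.
have : (0 < #|unsat E| * (#|unsat E| - d))%N.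
  by rewrite muln_gt0 subn_gt0 h3 andbT; apply: leq_ltn_trans h3.
by move=> h4; have := leq_trans h4 h2; rewrite muln_gt0.
Qed.

End GraphCounts.

(** * Expectations over histories *)

Section HistoryExpectation.
Variables (R : realType) (d : nat) (V : finType).
Implicit Types (E F : graph V) (e : {set V}) (v : V) (h : seq (graph V)).
Implicit Types f g : seq (graph V) -> R.

Definition hit_prob E v : R := (hits d E v)%:R / #|free_pairs d E|%:R.

Definition avg E (f : {set V} -> R) : R :=
  (\sum_(e in free_pairs d E) f e) / #|free_pairs d E|%:R.

Lemma hit_prob_ge0 E v : 0 <= hit_prob E v.
Proof. by rewrite divr_ge0. Qed.

(** Both the number of free pairs at [v] and twice the total number per
unsaturated vertex are [#|unsat d E|] up to an additive [d]. *)
Lemma hit_prob_approx E v (u := #|unsat d E|%:R : R) :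
  (0 < d)%N -> (4 * d <= #|unsat d E|)%N -> v \in unsat d E ->
  `|hit_prob E v - 2 / u| <= 4 * d%:R / u ^+ 2.
Proof.
move=> d0 du vU.
have /andP[f1 f2] := hits_bounds vU.
have /andP[F1 F2] := card_free_pairs_bounds E d0.
rewrite /hit_prob; set f := hits d E v in f1 f2 *.
set F := #|free_pairs d E| in F1 F2 *.
have hd : 1 <= d%:R :> R by rewrite ler1n.
have hu : 4 * d%:R <= u by rewrite /u -natrM ler_nat.
have f1' : u - d%:R <= f%:R.
  by move: f1; rewrite leq_subLR -(ler_nat R) natrD lerBlDl.
have f2' : f%:R <= u - 1.
  have : (f + 1 <= #|unsat d E|)%N by move: f2 du d0; clear; lia.
  by rewrite -(ler_nat R) natrD lerBrDr.
have F1' : u * (u - d%:R) <= 2 * F%:R.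
  by move: F1; rewrite -(ler_nat R) !natrM natrB//; move: du; clear; lia.
have F2' : 2 * F%:R <= u * (u - 1).
  by move: F2; rewrite -(ler_nat R) !natrM natrB//; move: du d0; clear; lia.
have u0 : 0 < u by lra.
have F0 : 0 < F%:R :> R.
  have : 0 < u * (u - d%:R) by apply: mulr_gt0; lra.
  lra.
have u2 : 0 < u ^+ 2 by rewrite exprn_gt0.
have e1 : 2 / u = 2 * u / u ^+ 2 by field; lra.
rewrite ler_norml; apply/andP; split.
  rewrite lerBrDl e1 -mulNr -mulrDl ler_pdivlMr// mulrC mulrA ler_pdivrMr//.
  have h1 : (2 * u - 4 * d%:R) * (2 * F%:R) <= (2 * u - 4 * d%:R) * (u * (u - 1)).
    by apply: ler_wpM2l => //; lra.
  have h2 : u ^+ 2 * (u - d%:R) <= u ^+ 2 * f%:R by rewrite ler_pM2l.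
  have h3 : 0 <= u * (2 * u + 2 * d%:R * u - 4 * d%:R).
    apply: mulr_ge0; first lra.
    have : 0 <= d%:R * (u - 2) by apply: mulr_ge0; lra.
    lra.
  lra.
rewrite lerBlDl e1 -mulrDl ler_pdivlMr// mulrC mulrA ler_pdivrMr//.
have h1 : (2 * u + 4 * d%:R) * (u * (u - d%:R)) <= (2 * u + 4 * d%:R) * (2 * F%:R).
  by apply: ler_wpM2l => //; lra.
have h2 : u ^+ 2 * f%:R <= u ^+ 2 * (u - 1) by rewrite ler_pM2l.
have h3 : 0 <= u * (2 * d%:R * u + 2 * u - 4 * d%:R * d%:R).
  apply: mulr_ge0; first lra.
  have : 0 <= d%:R * (u - 2 * d%:R) by apply: mulr_ge0; lra.
  lra.
lra.
Qed.

Lemma avgD E (f g : {set V} -> R) :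
  avg E (fun e => f e + g e) = avg E f + avg E g.
Proof. by rewrite /avg big_split mulrDl. Qed.

Lemma avgZ E c (f : {set V} -> R) : avg E (fun e => c * f e) = c * avg E f.
Proof. by rewrite /avg -mulr_sumr mulrA. Qed.

Lemma avg_cst E c : (0 < #|free_pairs d E|)%N -> avg E (fun=> c) = c.
Proof.
move=> F0; rewrite /avg sumr_const -[c *+ _]mulr_natr mulfK// pnatr_eq0; lia.
Qed.

Lemma avg_le E (f g : {set V} -> R) :
  (forall e, e \in free_pairs d E -> f e <= g e) -> avg E f <= avg E g.
Proof. by move=> fg; rewrite ler_wpM2r ?invr_ge0//; apply: ler_sum. Qed.

Lemma eq_avg E (f g : {set V} -> R) :
  (forall e, e \in free_pairs d E -> f e = g e) -> avg E f = avg E g.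
Proof. by move=> fg; congr (_ / _); apply: eq_bigr. Qed.

Lemma avg_hits E (g : V -> R) :
  avg E (fun e => \sum_(v in e) g v) = \sum_v hit_prob E v * g v.
Proof.
rewrite /avg mulr_suml.
transitivity (\sum_(e in free_pairs d E)
   \sum_v (v \in e)%:R * g v / #|free_pairs d E|%:R).
  apply: eq_bigr => e _; rewrite big_mkcond mulr_suml; apply: eq_bigr => v _.
  by case: (v \in e); rewrite ?mul1r ?mul0r.
rewrite exchange_big /=; apply: eq_bigr => v _.
rewrite /hit_prob -mulr_suml -mulr_suml mulrAC; congr (_ / _ * _).
rewrite /hits -sum1_card natr_sum big_mkcond [RHS]big_mkcond /=.
apply: eq_bigr => e _; rewrite [X in _ = if X then _ else _]finset.in_set.
by case: (e \in free_pairs d E); case: (v \in e).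
Qed.

Definition cur h : graph V := head finset.set0 h.

(** Histories list the graphs seen so far, most recent first; [cond_exp f h] is
the expectation of [f] one step after [h], given [h]. Iterating it gives every
expectation that the argument needs as a finite sum, free of measure theory. *)
Definition cond_exp f h : R :=
  \sum_F step_prob R d (cur h) F * f (F :: h).

(** Steps at which no free pair exists are left out: the estimates stop well
before the process can be stuck. *)
Fixpoint reachable h : bool :=
  if h is F :: h' then
    if h' is E :: _ then
      (F \in [set e |: E | e in free_pairs d E]) && reachable h'
    else F == finset.set0
  else false.

Lemma reachable_cons h e : (0 < d)%N -> reachable h -> e \in free_pairs d (cur h) ->
  reachable ((e |: cur h) :: h).
Proof.
move=> d0; case: h => [//|E h] rh eF.
by apply/andP; split => //; apply/imsetP; exists e.
Qed.

Lemma reachable_ind (P : seq (graph V) -> Prop) :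
  P [:: finset.set0] ->
  (forall h e, reachable h -> e \in free_pairs d (cur h) -> P h ->
    P ((e |: cur h) :: h)) ->
  forall h, reachable h -> P h.
Proof.
move=> P0 PS; elim=> [//|F [|E h] IH]; first by move=> /= /eqP->.
by rewrite [reachable _]/= => /andP[/imsetP[e eF ->] rh]; apply: (PS (E :: h) e) => //; apply: IH.
Qed.

Lemma cond_exp_avg f h : (0 < #|free_pairs d (cur h)|)%N ->
  cond_exp f h = avg (cur h) (fun e => f ((e |: cur h) :: h)).
Proof.
move=> F0; rewrite /cond_exp /step_prob.
have /negbTE -> : free_pairs d (cur h) != finset.set0 by rewrite -card_gt0.
rewrite /avg mulr_suml.
under eq_bigr do rewrite mulr_suml.
rewrite exchange_big /=; apply: eq_bigr => e _.
rewrite (bigD1 (e |: cur h))//= eqxx big1 ?addr0; first by rewrite mulrAC mul1r mulrC.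
by move=> F /negbTE ->; rewrite !mul0r.
Qed.

Lemma degree_set0 v : degree finset.set0 v = 0%N.
Proof. by apply: eq_card0 => e; rewrite !inE. Qed.

Lemma reachable_slack h : (0 < d)%N -> reachable h ->
  (slack d (cur h) + 2 * (size h).-1 = d * #|V|)%N.
Proof.
move=> d0; elim/reachable_ind => [|h' e rh eF IH].
  rewrite addn0 mulnC -sum_nat_const; apply: eq_bigr => v _.
  by rewrite degree_set0 subn0.
rewrite -{}IH (slack_step d0 eF) /=; case: h' rh eF => //= E h' _ _; lia.
Qed.

Lemma cond_exp_le f g h : (0 < d)%N -> reachable h -> (d * d < slack d (cur h))%N ->
  (forall F, reachable (F :: h) -> f (F :: h) <= g (F :: h)) ->
  cond_exp f h <= cond_exp g h.
Proof.
move=> d0 rh hS fg; have F0 := free_pairs_neq0 d0 hS.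
rewrite !cond_exp_avg//; apply: avg_le => e eF; apply: fg.
exact: reachable_cons.
Qed.

Lemma cond_expD f g h : cond_exp (fun h => f h + g h) h = cond_exp f h + cond_exp g h.
Proof. by rewrite /cond_exp -big_split; apply: eq_bigr => F _; rewrite /= mulrDr. Qed.

Lemma cond_expZ c f h : cond_exp (fun h => c * f h) h = c * cond_exp f h.
Proof. by rewrite /cond_exp mulr_sumr; apply: eq_bigr => F _; rewrite mulrCA. Qed.

Lemma cond_exp_cst c h : (0 < d)%N -> (d * d < slack d (cur h))%N ->
  cond_exp (fun=> c) h = c.
Proof.
by move=> d0 hS; rewrite cond_exp_avg ?avg_cst//; exact: free_pairs_neq0.
Qed.

Definition exp_after m f : seq (graph V) -> R := iter m cond_exp f.

Lemma eq_exp_after m f g : f =1 g -> exp_after m f =1 exp_after m g.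
Proof.
move=> fg; elim: m => //= m IH h.
by apply: eq_bigr => F _; rewrite /= -/(exp_after m f) -/(exp_after m g) IH.
Qed.

Lemma exp_afterD m f g h :
  exp_after m (fun h => f h + g h) h = exp_after m f h + exp_after m g h.
Proof.
elim: m h => //= m IH h; rewrite -cond_expD.
by apply: eq_bigr => F _; congr (_ * _); apply: IH.
Qed.

Lemma exp_afterZ m c f h :
  exp_after m (fun h => c * f h) h = c * exp_after m f h.
Proof.
elim: m h => //= m IH h; rewrite -cond_expZ.
by apply: eq_bigr => F _; congr (_ * _); apply: IH.
Qed.

Lemma exp_after_sum m (I : Type) (r : seq I) (P : pred I)
    (F : I -> seq (graph V) -> R) h :
  exp_after m (fun h => \sum_(i <- r | P i) F i h) h =
  \sum_(i <- r | P i) exp_after m (F i) h.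
Proof.
elim: r => [|i r IH].
  rewrite big_nil (eq_exp_after _ (g := fun h => 0 * 0)).
    by rewrite exp_afterZ mul0r.
  by move=> h'; rewrite big_nil mul0r.
rewrite big_cons -IH; case: (boolP (P i)) => Pi.
  by rewrite -exp_afterD; apply: eq_exp_after => h'; rewrite big_cons Pi.
by apply: eq_exp_after => h'; rewrite big_cons (negbTE Pi).
Qed.

Lemma exp_after_addn m1 m2 f h :
  exp_after (m1 + m2) f h = exp_after m1 (exp_after m2 f) h.
Proof. by rewrite /exp_after iterD. Qed.

Lemma exp_afterS m f h : exp_after m.+1 f h = exp_after m (cond_exp f) h.
Proof. by rewrite /exp_after iterSr. Qed.

Lemma slack_cons h F : (0 < d)%N -> reachable (F :: h) -> h != [::] ->
  (slack d (cur h) = slack d F + 2)%N.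
Proof.
move=> d0 /= rF; case: h rF => // E h /andP[/imsetP[e eF ->] _] _.
exact: slack_step.
Qed.

Lemma exp_after_le m f g h : (0 < d)%N -> reachable h ->
  (d * d + 2 * m < slack d (cur h) + 2)%N ->
  (forall h', reachable h' -> size h' = (size h + m)%N -> f h' <= g h') ->
  exp_after m f h <= exp_after m g h.
Proof.
move=> d0; elim: m h => [|m IH] h rh hS fg; first by apply: fg => //; rewrite addn0.
apply: cond_exp_le => //; first lia.
move=> F rF; apply: IH => //=.
  have := slack_cons d0 rF; case: h rh {fg rF} hS => // E h _ hS /(_ isT).
  rewrite /cur /= in hS *; lia.
by move=> h' rh' sh'; apply: fg => //; rewrite sh'; lia.
Qed.

Lemma exp_after_cst m c h : (0 < d)%N -> reachable h ->
  (d * d + 2 * m < slack d (cur h) + 2)%N -> exp_after m (fun=> c) h = c.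
Proof.
move=> d0; elim: m h => [//|m IH] h rh hS.
rewrite -[RHS](@cond_exp_cst c h)//; last lia.
apply/eqP; rewrite eq_le; apply/andP; split; apply: cond_exp_le => //; try lia.
  move=> F rF; rewrite [leLHS]IH// /cur /=.
  by have := slack_cons d0 rF; case: h rh {rF} hS => // E h _ hS /(_ isT); rewrite /cur /= in hS *; lia.
move=> F rF; rewrite [leRHS]IH// /cur /=.
by have := slack_cons d0 rF; case: h rh {rF} hS => // E h _ hS /(_ isT); rewrite /cur /= in hS *; lia.
Qed.

(** Errors made in one step add up: iterating the tower property, the error of
the step at time [j] enters through its expectation. *)
Lemma exp_after_drift m f err h : (0 < d)%N -> reachable h ->
  (d * d + 2 * m < slack d (cur h) + 2)%N ->
  (forall h', reachable h' -> (size h <= size h' < size h + m)%N ->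
     cond_exp f h' <= f h' + err h') ->
  exp_after m f h <= f h + \sum_(j < m) exp_after j err h.
Proof.
move=> d0 rh; elim: m => [|m IH] hS hf; first by rewrite big_ord0 addr0.
rewrite exp_afterS big_ord_recr /= addrA.
apply: (@le_trans _ _ (exp_after m (fun h => f h + err h) h)).
  apply: exp_after_le => //; first lia.
  by move=> h' rh' sh'; apply: hf => //; lia.
rewrite exp_afterD lerD2r; apply: IH; first lia.
by move=> h' rh' sh'; apply: hf => //; lia.
Qed.

End HistoryExpectation.

(** * The law of the process *)

Section TupleSum.
Variables (R : nmodType) (I : finType).

Lemma sum_tuple_cons m (f : seq I -> R) :
  \sum_(t : m.+1.-tuple I) f t = \sum_(t : m.-tuple I) \sum_(x : I) f (x :: t).
Proof.
rewrite pair_big_dep /=.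
rewrite (reindex (fun p : m.-tuple I * I => cons_tuple p.2 p.1)) //=.
exists (fun t => (behead_tuple t, thead t)) => [[t x] _|t _] /=.
  by congr (_, _); apply: val_inj.
by rewrite [RHS]tuple_eta; apply: val_inj.
Qed.

Lemma sum_tuple1 (f : seq I -> R) :
  \sum_(t : 1.-tuple I) f t = \sum_(x : I) f [:: x].
Proof.
rewrite sum_tuple_cons exchange_big; apply: eq_bigr => x _ /=.
rewrite (big_pred1 [tuple])//= => t; apply/esym/eqP; exact: tuple0.
Qed.

End TupleSum.

Section ProcessLaw.
Local Open Scope classical_set_scope.
Variables (R : realType) (d n : nat) (disp : measure_display).
Variables (T : measurableType disp) (P : probability T R).
Variable G : nat -> T -> graph 'I_n.
Hypothesis hG : is_d_process d P G.

Definition history i w : seq (graph 'I_n) := rev [seq G j w | j <- iota 0 i.+1].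

Definition graph_at (h : seq (graph 'I_n)) j : graph 'I_n :=
  nth finset.set0 (rev h) j.

Lemma size_history i w : size (history i w) = i.+1.
Proof. by rewrite size_rev size_map size_iota. Qed.

Lemma graph_at_history i j w : (j <= i)%N -> graph_at (history i w) j = G j w.
Proof.
by move=> ji; rewrite /graph_at revK (nth_map 0%N) ?size_iota// nth_iota.
Qed.

Lemma history_eqP i w h : size h = i.+1 ->
  history i w = h <-> forall j, (j <= i)%N -> G j w = graph_at h j.
Proof.
move=> sh; split=> [<- j ji|hh]; first by rewrite graph_at_history.
apply: (can_inj revK); apply: (@eq_from_nth _ finset.set0).
  by rewrite !size_rev size_map size_iota sh.
by move=> j; rewrite size_rev size_history ltnS => ji; rewrite -[RHS]hh// -(graph_at_history w ji).
Qed.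

Lemma history_event i (h : seq (graph 'I_n)) : size h = i.+1 ->
  [set w | history i w = h] = [set w | forall j, (j <= i)%N -> G j w = graph_at h j].
Proof. by move=> sh; apply/seteqP; split => w /= /history_eqP; exact. Qed.

Lemma measurable_history i (h : seq (graph 'I_n)) : (i <= last_step d n)%N ->
  size h = i.+1 -> measurable [set w | history i w = h].
Proof.
move=> il sh; rewrite history_event//.
have -> : [set w | forall j, (j <= i)%N -> G j w = graph_at h j] =
    \bigcap_(j in [set j | (j <= i)%N]) [set w | G j w = graph_at h j] by [].
apply: bigcap_measurableType => j /= ji; apply: (dproc_measurable hG).
exact: leq_trans il.
Qed.

Lemma graph_at_cons F (h : seq (graph 'I_n)) j : (j < size h)%N ->
  graph_at (F :: h) j = graph_at h j.
Proof. by move=> jh; rewrite /graph_at rev_cons nth_rcons size_rev jh. Qed.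

Lemma graph_at_last (h : seq (graph 'I_n)) : graph_at h (size h).-1 = cur h.
Proof.
case: h => [//|E h]; rewrite /graph_at rev_cons nth_rcons size_rev /=.
by rewrite ltnn eqxx.
Qed.

Fixpoint history_prob (h : seq (graph 'I_n)) : R :=
  if h is F :: h' then
    if h' is _ :: _ then step_prob R d (cur h') F * history_prob h'
    else (F == finset.set0)%:R
  else 0.

(** The chain rule: the one-step conditional laws of the process multiply along
the history. *)
Lemma prob_history i (h : seq (graph 'I_n)) : (i <= last_step d n)%N ->
  size h = i.+1 -> P [set w | history i w = h] = (history_prob h)%:E.
Proof.
elim: i h => [|i IH] [//|F h] il /= [sh].
  case: h sh => //= _.
  have h1 g : P [set w | history 0 w = [:: g]] = P [set w | G 0%N w = g].
    by congr (P _); apply/seteqP; split => w /=; rewrite /history /= /rev /=; [case|move=> ->].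
  rewrite h1; case: eqP => [->|/eqP F0]; first exact: (dproc_start hG).
  have m0 := dproc_measurable hG (i := 0%N) finset.set0 (leq0n _).
  have mF := dproc_measurable hG (i := 0%N) F (leq0n _).
  transitivity (0%E : \bar R); last by [].
  apply/eqP; rewrite eq_le measure_ge0 andbT.
  have <- : P (~` [set w | G 0%N w = finset.set0]) = 0%E.
    by rewrite probability_setC// (dproc_start hG) subee.
  apply: le_measure; rewrite ?inE//; first exact: measurableC.
  by move=> w /= ->; apply/eqP.
rewrite history_event /= ?sh//.
have il' : (i < last_step d n)%N by [].
rewrite (dproc_step hG _ il').
case: h sh => [//|E h] sh.
rewrite EFinM muleC; congr (_ * _)%E; last first.
  rewrite -(IH (E :: h) (ltnW il') sh) history_event//; congr (P _).
  apply/seteqP; split => w /= hw j ji.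
    by rewrite hw// graph_at_cons// sh ltnS.
  by rewrite hw// [RHS]graph_at_cons// sh ltnS.
congr (step_prob _ _ _ _)%:E.
  by rewrite graph_at_cons ?sh// -graph_at_last sh.
have -> : i.+1 = (size (F :: E :: h)).-1 by rewrite /= -sh.
by rewrite graph_at_last.
Qed.

Lemma sum_history_prob i (f : seq (graph 'I_n) -> R) :
  \sum_(t : i.+1.-tuple (graph 'I_n)) f t * history_prob t =
  exp_after d i f [:: finset.set0].
Proof.
elim: i f => [|i IH] f.
  rewrite (sum_tuple1 (fun t => f t * history_prob t)) (bigD1 finset.set0)//=.
  rewrite eqxx mulr1 big1 ?addr0//.
  by move=> F /negbTE ->; rewrite mulr0.
rewrite exp_afterS -IH (sum_tuple_cons _ (fun t => f t * history_prob t)).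
apply: eq_bigr => t _; rewrite /cond_exp mulr_suml; apply: eq_bigr => F _.
case: t => -[//|E h] /= _; rewrite mulrA; congr (_ * _); exact: mulrC.
Qed.

(** The bridge from the abstract probability space to the finite sums
[exp_after]. *)
Lemma prob_of_history i (Q : pred (seq (graph 'I_n))) : (i <= last_step d n)%N ->
  fine (P [set w | Q (history i w)]) =
  exp_after d i (fun h => (Q h)%:R) [:: finset.set0].
Proof.
move=> il; rewrite -sum_history_prob.
pose A (t : i.+1.-tuple (graph 'I_n)) : set T :=
  if Q t then [set w | history i w = t] else set0.
have mA t : measurable (A t).
  by rewrite /A; case: ifP => // _; apply: measurable_history => //; exact: size_tuple.
have -> : [set w | Q (history i w)] = \bigcup_(t in setT) A t.
  apply/seteqP; split => [w /= Qw|w [t _]]; last by rewrite /A; case: ifP => //= Qt ->.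
  have hs : size (history i w) == i.+1 by rewrite size_history.
  by exists (Tuple hs) => //; rewrite /A /= Qw.
rewrite measure_fin_bigcup//; first last.
  move=> t1 t2 _ _ [w []]; rewrite /A; case: ifP => // _; case: ifP => // _ /= h1 h2.
  by apply: val_inj; rewrite /= -h1 -h2.
  exact: finite_finset.
have -> : (\sum_(t \in [set: i.+1.-tuple (graph 'I_n)]) P (A t))%R =
   (\sum_(t : i.+1.-tuple (graph 'I_n)) ((Q t)%:R * history_prob t)%:E)%E.
  transitivity (\sum_(t <- index_enum (i.+1.-tuple (graph 'I_n)) |
      t \in [set: i.+1.-tuple (graph 'I_n)]) P (A t))%R.
    apply: fsbigE; rewrite ?index_enum_uniq//.
    by move=> t _; rewrite mem_index_enum.
  apply: eq_big => [t|t _]; first by rewrite in_setT.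
  rewrite /A; case: ifP => Qt; last by rewrite measure0 mul0r.
  by rewrite prob_history// ?mul1r// size_tuple.
by rewrite sumEFin.
Qed.

End ProcessLaw.

(** * Independent marks *)

Section MarkedVertices.
Variables (R : realType) (V : finType).
Implicit Types (z a : V -> R) (e : {set V}).

(** The bounds on products over vertices below would be messy to obtain by
expanding the products; read as probabilities about independent marks they
become sums over disjoint events. *)
Definition mark_weight a z e : R := \prod_v (if v \in e then a v else z v).

Lemma sum_mark_weight a z : \sum_(e : {set V}) mark_weight a z e = \prod_v (a v + z v).
Proof. by rewrite bigA_distr. Qed.

Lemma prod_le1 (I : finType) (P : pred I) (f : I -> R) :
  (forall i, P i -> 0 <= f i <= 1) -> 0 <= \prod_(i | P i) f i <= 1.
Proof.
move=> h; elim/big_ind: _; [by rewrite ler01 lexx | | exact: h].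
by move=> x y /andP[x0 x1] /andP[y0 y1]; rewrite mulr_ge0//= mulr_ile1.
Qed.

Lemma normr_prodB (I : finType) (P : pred I) (f g : I -> R) :
  (forall i, P i -> 0 <= f i <= 1) -> (forall i, P i -> 0 <= g i <= 1) ->
  `|\prod_(i | P i) f i - \prod_(i | P i) g i| <= \sum_(i | P i) `|f i - g i|.
Proof.
move=> hf hg.
suff : [/\ 0 <= \prod_(i | P i) f i <= 1, 0 <= \prod_(i | P i) g i <= 1 &
  `|\prod_(i | P i) f i - \prod_(i | P i) g i| <= \sum_(i | P i) `|f i - g i|] by case.
elim/big_rec3: _ => [|i x y w Pi [/andP[w0 w1] /andP[y0 y1] h]].
  by rewrite subrr normr0 ler01 lexx.
have /andP[f0 f1] := hf _ Pi; have /andP[g0 g1] := hg _ Pi.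
split; rewrite ?mulr_ge0 ?mulr_ile1//.
have -> : f i * w - g i * y = (f i - g i) * w + g i * (w - y) by ring.
apply: (le_trans (ler_normD _ _)); rewrite !normrM (ger0_norm w0) (ger0_norm g0).
by apply: lerD; [rewrite ler_piMr | apply: le_trans h; rewrite ler_piMl].
Qed.

Variables (z a : V -> R).
Hypotheses (z0 : forall v, 0 <= z v) (a0 : forall v, 0 <= a v).
Hypothesis (za : forall v, z v + a v <= 1).

Lemma mark_weight_ge0 e : 0 <= mark_weight a z e.
Proof. by apply: prodr_ge0 => v _; case: ifP. Qed.

(** If [v] is marked with probability [1 - z v] independently of the others, then
[mark_weight a z e] is at most the probability that [e] is the set of marked
vertices; these events are disjoint. *)
Lemma sum_mark_weight_le1 (A : {set {set V}}) : \sum_(e in A) mark_weight a z e <= 1.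
Proof.
apply: (@le_trans _ _ (\sum_(e : {set V}) mark_weight a z e)).
  rewrite [leRHS](bigID (mem A)) /= lerDl sumr_ge0// => e _.
  exact: mark_weight_ge0.
rewrite sum_mark_weight.
suff /andP[_ //] : 0 <= \prod_v (a v + z v) <= 1.
by apply: prod_le1 => v _; rewrite addr_ge0//= addrC za.
Qed.

Lemma sum_mark_weight1_le1 : \sum_v mark_weight a z [set v] <= 1.
Proof.
have := sum_mark_weight_le1 [set [set v] | v in V].
by rewrite big_imset //= => u v _ _ /set1_inj.
Qed.

Lemma prod_hit_pair e : #|e| = 2%N ->
  \prod_v (if v \in e then z v + a v else z v) =
  \prod_v z v + \sum_(v in e) mark_weight a z [set v] + mark_weight a z e.
Proof.
move=> /eqP/cards2P[u [v [uv ->]]].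
have vu : v != u by rewrite eq_sym.
rewrite big_setU1 ?inE//= big_set1 /mark_weight.
rewrite ![\prod_w _](bigD1 u)//= ![\prod_(w | w != u) _](bigD1 v) ?vu//=.
rewrite !inE !eqxx (negbTE uv) (negbTE vu) /=.
set Z := \prod_(_ | _) _; set Z1 := \prod_(_ | _) _; set Z2 := \prod_(_ | _) _.
set Z3 := \prod_(_ | _) _; set Z4 := \prod_(_ | _) _.
have e1 : Z2 = Z1.
  by apply: eq_bigr => w /andP[/negbTE wu /negbTE wv]; rewrite ?inE ?wu ?wv.
have e0 : Z = Z1.
  by apply: eq_bigr => w /andP[/negbTE wu /negbTE wv]; rewrite ?inE ?wu ?wv.
have e3 : Z3 = Z1.
  by apply: eq_bigr => w /andP[/negbTE wu /negbTE wv]; rewrite ?inE ?wu ?wv.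
have e4 : Z4 = Z1.
  by apply: eq_bigr => w /andP[/negbTE wu /negbTE wv]; rewrite ?inE ?wu ?wv.
by rewrite e0 e1 e3 e4; ring.
Qed.

Section Step.
Variables (d : nat) (E : graph V).
Hypotheses (d0 : (0 < d)%N) (F0 : (0 < #|free_pairs d E|)%N).

(** Hitting [v] replaces its factor [z v] by [z v + a v]. A free pair hits two
vertices: the terms of first order are weighted by the hit probabilities, and
the terms in which both ends matter have total weight at most one, so that their
average is at most the inverse of the number of free pairs. *)
Lemma avg_hit_pair (delta t : R) :
  (forall v, v \notin unsat d E -> a v = 0) ->
  (forall v, v \in unsat d E -> `|hit_prob R d E v - t| <= delta) ->
  `|avg d E (fun e => \prod_v (if v \in e then z v + a v else z v))
    - \prod_v z v - t * \sum_v mark_weight a z [set v]|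
  <= #|free_pairs d E|%:R^-1 + delta.
Proof.
move=> asat hp.
have -> : avg d E (fun e => \prod_v (if v \in e then z v + a v else z v)) =
    \prod_v z v + \sum_v hit_prob R d E v * mark_weight a z [set v]
    + avg d E (mark_weight a z).
  rewrite -avg_hits -[X in _ = X + _ + _](avg_cst (d := d) (E := E))// -!avgD.
  by apply: eq_avg => e /(free_pairsP d0)[e2 _ _]; rewrite prod_hit_pair.
set r := avg d E _; set y := \sum_v hit_prob R d E v * _.
rewrite [X in `|X|](_ : _ = r + (y - t * \sum_v mark_weight a z [set v])); last by ring.
apply: (le_trans (ler_normD _ _)); apply: lerD.
  rewrite ger0_norm /r; last first.
    by rewrite /avg divr_ge0// sumr_ge0// => e _; exact: mark_weight_ge0.
  by rewrite /avg ler_piMl ?invr_ge0// sum_mark_weight_le1.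
have m0 v : v \notin unsat d E -> mark_weight a z [set v] = 0.
  by move=> vU; rewrite /mark_weight (bigD1 v)//= inE eqxx asat// mul0r.
have dt v : v \in unsat d E -> 0 <= delta by move=> /hp; apply: le_trans.
rewrite /y mulr_sumr -sumrB.
apply: (le_trans (ler_norm_sum _ _ _)).
apply: (@le_trans _ _ (\sum_v `|delta| * mark_weight a z [set v])).
  apply: ler_sum => v _; rewrite -mulrBl normrM (ger0_norm (mark_weight_ge0 _))//.
  have [vU|vU] := boolP (v \in unsat d E); last by rewrite m0// !mulr0.
  by rewrite ler_wpM2r ?mark_weight_ge0// (ger0_norm (dt v vU)) hp.
have [v vU] : exists v, v \in unsat d E.
  have : (0 < #|unsat d E|)%N.
    have /andP[_] := card_free_pairs_bounds E d0; rewrite lt0n; apply: contraTneq => ->.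
    by rewrite mul0n -ltnNge muln_gt0.
  by rewrite card_gt0 => /set0Pn.
rewrite -mulr_sumr (ger0_norm (dt _ vU)) ler_piMr ?(dt v)//.
exact: sum_mark_weight1_le1.
Qed.

End Step.

Lemma mark_weight_scale t e :
  mark_weight (fun v => t * a v) z e = t ^+ #|e| * mark_weight a z e.
Proof.
rewrite /mark_weight -prodr_const [X in X * _]big_mkcond -big_split /=.
by apply: eq_bigr => v _; case: ifP => _; rewrite ?mul1r.
Qed.

(** Scaling every [a v] by [t] scales the weight of [e] by [t ^+ #|e|], so the
weight of the sets with at least two elements is at most [t ^+ 2]. *)
Lemma prod_first_order t : 0 <= t <= 1 ->
  `|\prod_v (z v + t * a v) - \prod_v z v - t * \sum_v mark_weight a z [set v]|
  <= t ^+ 2.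
Proof.
move=> /andP[t0 t1].
have -> : \prod_v (z v + t * a v) = \sum_(e : {set V}) t ^+ #|e| * mark_weight a z e.
  transitivity (\prod_v (t * a v + z v)); first by apply: eq_bigr => v _; rewrite addrC.
  rewrite -(sum_mark_weight (fun v => t * a v)).
  by apply: eq_bigr => e _; rewrite mark_weight_scale.
have -> : \prod_v z v = mark_weight a z finset.set0.
  by apply: eq_bigr => v _; rewrite inE.
pose A := [set e : {set V} | (2 <= #|e|)%N].
have -> : \sum_(e : {set V}) t ^+ #|e| * mark_weight a z e =
    mark_weight a z finset.set0 + t * \sum_v mark_weight a z [set v] +
    \sum_(e in A) t ^+ #|e| * mark_weight a z e.
  rewrite (bigD1 finset.set0)//= cards0 mul1r -addrA; congr (_ + _).
  rewrite (bigID (fun e : {set V} => #|e| == 1%N)) /=; congr (_ + _).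
    rewrite mulr_sumr.
    transitivity (\sum_(e in [set [set v] | v in V]) t * mark_weight a z e).
      apply: eq_big => [e|e /andP[_ /eqP ->]]; last by rewrite expr1.
      apply/andP/imsetP => [[_ /cards1P[v ->]]|[v _ ->]]; first by exists v.
      by rewrite cards1 -card_gt0 cards1.
    by rewrite big_imset //= => u v _ _ /set1_inj.
  apply: eq_bigl => e; rewrite inE -card_gt0; lia.
set r := \sum_(e in A) _; rewrite [X in `|X|](_ : _ = r); last by ring.
rewrite ger0_norm /r; last first.
  by apply: sumr_ge0 => e _; rewrite mulr_ge0 ?exprn_ge0// mark_weight_ge0.
apply: (@le_trans _ _ (\sum_(e in A) t ^+ 2 * mark_weight a z e)).
  apply: ler_sum => e; rewrite inE => e2; rewrite ler_wpM2r ?mark_weight_ge0//.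
  by rewrite ler_wiXn2l.
by rewrite -mulr_sumr ler_piMr ?exprn_ge0// sum_mark_weight_le1.
Qed.

End MarkedVertices.

(** * One step for the emptiness of degree classes *)

Section EmptinessProduct.
Variables (R : realType) (d : nat) (V : finType).
Implicit Types (E : graph V) (A : {set 'I_d.-1}) (q : 'I_d.-1 -> R).

Definition count_le E l : nat := #|[set v | (degree E v <= l)%N]|.

(** [emptiness A q E] is the probability that, for no [l] in [A], a vertex of
degree at most [l] survives when it does so with probability [q l],
independently over vertices and [l]. *)
Definition emptiness A q E : R := \prod_(l in A) (1 - q l) ^+ count_le E l.

(** The factor of a vertex of degree [j] in [emptiness A q]; hitting the vertex
turns it into the factor of [j.+1]. *)
Definition tail_prod A q j : R := \prod_(l in A | (j <= l)%N) (1 - q l).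

Lemma emptiness_prod A q E : emptiness A q E = \prod_v tail_prod A q (degree E v).
Proof.
rewrite /emptiness /tail_prod.
transitivity (\prod_(l in A) \prod_v (if (degree E v <= l)%N then 1 - q l else 1)).
  apply: eq_bigr => l _; rewrite -prodr_const -big_mkcond.
  by apply: eq_bigl => v; rewrite inE.
rewrite exchange_big /=; apply: eq_bigr => v _.
by rewrite big_mkcondr.
Qed.

Lemma tail_prod_in A q (j : 'I_d.-1) : j \in A ->
  tail_prod A q j = (1 - q j) * tail_prod A q j.+1.
Proof.
move=> jA; rewrite /tail_prod (bigD1 j) ?jA ?leqnn//=; congr (_ * _).
apply: eq_bigl => l; rewrite -andbA; congr (_ && _).
by rewrite ltn_neqAle andbC eq_sym.
Qed.

Lemma tail_prod_notin A q j : (forall l : 'I_d.-1, l = j :> nat -> l \notin A) ->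
  tail_prod A q j = tail_prod A q j.+1.
Proof.
move=> jA; rewrite /tail_prod; apply: eq_bigl => l.
have [lA|//] := boolP (l \in A); rewrite /= [in RHS]ltn_neqAle.
by case: eqP => // /esym/jA; rewrite lA.
Qed.

Variables (E : graph V) (A : {set 'I_d.-1}) (q q' : 'I_d.-1 -> R) (t delta : R).
Hypotheses (d0 : (0 < d)%N) (F0 : (0 < #|free_pairs d E|)%N).
Hypotheses (t01 : 0 <= t <= 1) (q'01 : forall l, l \in A -> 0 <= q' l <= 1).
Hypothesis qq' : forall l, l \in A -> q l = (1 - t) * q' l.

Let q01 l : l \in A -> 0 <= q l <= 1.
Proof.
move=> lA; rewrite qq'//; have := q'01 lA; case/andP: t01 => t0 t1 /andP[h0 h1].
by rewrite mulr_ge0 ?mulr_ile1//=; lra.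
Qed.

Let tail01 (p : 'I_d.-1 -> R) j : (forall l, l \in A -> 0 <= p l <= 1) ->
  0 <= tail_prod A p j <= 1.
Proof. by move=> p01; apply: prod_le1 => l /andP[/p01]; lra. Qed.

Lemma tail_prod_incr j : tail_prod A q' j <= tail_prod A q' j.+1.
Proof.
have [[l lA lj]|h] := pselect (exists2 l : 'I_d.-1, l \in A & l = j :> nat).
  rewrite -lj tail_prod_in// ler_piMl//.
    by have /andP[] := tail01 l.+1 q'01.
  by have := q'01 lA; lra.
by rewrite [leLHS]tail_prod_notin// => l lj; apply/negP => lA; apply: h; exists l.
Qed.

(** To first order in [t], lowering [q' l] to [q l] acts on a vertex of degree [j]
like a hit with probability [t], except for the classes [l > j], which the
vertex does not leave when it is hit. *)
Lemma tail_prod_approx j :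
  `|tail_prod A q j
    - (tail_prod A q' j + t * (tail_prod A q' j.+1 - tail_prod A q' j))|
  <= t * \sum_(l in A | (j < l)%N) q' l.
Proof.
case/andP: (t01) => t0 t1.
have dT : `|tail_prod A q j.+1 - tail_prod A q' j.+1| <=
    t * \sum_(l in A | (j < l)%N) q' l.
  apply: (le_trans (normr_prodB _ _)); try by move=> l /andP[/q01]; lra.
    by move=> l /andP[/q'01]; lra.
  rewrite mulr_sumr; apply: ler_sum => l /andP[lA _]; rewrite qq'//.
  have /andP[h0 h1] := q'01 lA.
  have -> : 1 - (1 - t) * q' l - (1 - q' l) = t * q' l by ring.
  by rewrite ger0_norm// mulr_ge0.
have [[l lA lj]|h] := pselect (exists2 l : 'I_d.-1, l \in A & l = j :> nat).
  move: dT; rewrite -lj !tail_prod_in// qq'//.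
  set T := tail_prod A q _; set T' := tail_prod A q' _ => dT.
  rewrite [X in `|X|](_ : _ = (1 - (1 - t) * q' l) * (T - T')); last by ring.
  rewrite normrM; apply: le_trans dT; rewrite ler_piMl//.
  have := q01 lA; rewrite qq'// => /andP[h0 h1]; rewrite ger0_norm; lra.
have h' (l : 'I_d.-1) : l = j :> nat -> l \notin A.
  by move=> lj; apply/negP => lA; apply: h; exists l.
by rewrite (@tail_prod_notin A q j)// (@tail_prod_notin A q' j)// subrr mulr0 addr0.
Qed.

(** The survival probabilities [q] are chosen to be those of a vertex that is hit
with probability [t] now and survives with probability [q'] later, so
[emptiness] is nearly a martingale. The last error term accounts for the
vertices of degree less than [l], which remain of degree at most [l] after a
hit. *)
Lemma emptiness_step :
  (forall v, v \in unsat d E -> `|hit_prob R d E v - t| <= delta) ->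
  `|avg d E (fun e => emptiness A q' (e |: E)) - emptiness A q E|
  <= #|free_pairs d E|%:R^-1 + delta + t ^+ 2
     + t * \sum_(l in A) q' l * #|[set v | (degree E v < l)%N]|%:R.
Proof.
move=> hp; case/andP: (t01) => t0 t1.
pose z v := tail_prod A q' (degree E v).
pose a v := tail_prod A q' (degree E v).+1 - tail_prod A q' (degree E v).
have z0 v : 0 <= z v by have /andP[] := tail01 (degree E v) q'01.
have a0 v : 0 <= a v by rewrite subr_ge0 tail_prod_incr.
have za v : z v + a v <= 1.
  by rewrite /z /a addrC subrK; have /andP[] := tail01 (degree E v).+1 q'01.
have asat v : v \notin unsat d E -> a v = 0.
  rewrite inE -leqNgt => dv; rewrite /a (@tail_prod_notin A q' (degree E v)) ?subrr//.
  move=> l lv; exfalso; have := ltn_ord l; rewrite lv; lia.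
have -> : avg d E (fun e => emptiness A q' (e |: E)) =
    avg d E (fun e => \prod_v (if v \in e then z v + a v else z v)).
  apply: eq_avg => e /(free_pairsP d0)[_ eE _]; rewrite emptiness_prod.
  apply: eq_bigr => v _; rewrite degreeU//; case: ifP => _; last by rewrite addn0.
  by rewrite addn1 /z /a addrC subrK.
rewrite emptiness_prod.
have h1 := avg_hit_pair z0 a0 za d0 F0 asat hp.
have h2 := prod_first_order z0 a0 za t01.
have h3 : `|\prod_v tail_prod A q (degree E v) - \prod_v (z v + t * a v)| <=
    t * \sum_(l in A) q' l * #|[set v | (degree E v < l)%N]|%:R.
  apply: (le_trans (normr_prodB _ _)).
  - by move=> v _; apply: tail01.
  - move=> v _; have := za v; have := z0 v; have := a0 v => h4 h5 h6.
    have : t * a v <= a v by rewrite ler_piMl.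
    have : 0 <= t * a v by rewrite mulr_ge0.
    lra.
  apply: (@le_trans _ _ (\sum_v t * \sum_(l in A | (degree E v < l)%N) q' l)).
    by apply: ler_sum => v _; apply: tail_prod_approx.
  rewrite -mulr_sumr ler_wpM2l//.
  under eq_bigr do rewrite big_mkcondr.
  rewrite exchange_big /=; apply: ler_sum => l lA.
  rewrite -big_mkcond /= mulr_natr -sumr_const.
  by under [leRHS]eq_bigl do rewrite inE.
move: h1 h2 h3; set x1 := avg _ _ _; set x2 := \prod_v z v; set x3 := t * \sum_v _.
set x4 := \prod_v _; set x5 := \prod_v _; set x6 := t * _.
set y := _^-1; rewrite !ler_norml.
by move=> /andP[? ?] /andP[? ?] /andP[? ?]; apply/andP; split; lra.
Qed.

End EmptinessProduct.

(** * Low-degree vertices when most are almost saturated *)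

Section LateStep.
Variables (R : realType) (d : nat) (V : finType) (E : graph V).
Hypothesis d2 : (2 <= d)%N.
Let D : R := d%:R.
Let S : R := (slack d E)%:R.
Let U : R := #|unsat d E|%:R.
Hypothesis hS : 4 * D ^+ 2 <= S.

Let d0 : (0 < d)%N. Proof. lia. Qed.
Let D2 : 2 <= D. Proof. by rewrite ler_nat. Qed.

Lemma slack_le_unsatR : S <= D * U.
Proof. by rewrite /S /D /U -natrM ler_nat slack_le_unsat. Qed.

Lemma unsat_large : 4 * D <= U.
Proof.
have h : 4 * D ^+ 2 <= D * U := le_trans hS slack_le_unsatR.
have h' : D * (4 * D) <= D * U by rewrite expr2 in h; lra.
by move: h'; rewrite ler_pM2l//; have := D2; lra.
Qed.

Lemma unsat_large_nat : (4 * d <= #|unsat d E|)%N.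
Proof. by have := unsat_large; rewrite /U /D -natrM ler_nat. Qed.

Lemma slack_large : 16 <= S.
Proof.
have D2' := D2; apply: le_trans hS; have : 0 <= (D - 2) * (D + 2) by apply: mulr_ge0; lra.
by rewrite expr2; lra.
Qed.

Lemma unsat_le_slack : U <= S.
Proof.
rewrite /U /S ler_nat /slack -sum1_card big_mkcond; apply: leq_sum => v _.
by case: ifP => //; rewrite inE subn_gt0.
Qed.

(** A vertex of degree [d - 1] contributes one to [slack], so only vertices of
lower degree make [slack] exceed the number of unsaturated vertices. *)
Lemma slack_le_unsat_low : S <= U + D * (count_le E d.-2)%:R.
Proof.
rewrite /S /U /D -natrM -natrD ler_nat /slack -sum1_card /count_le.
rewrite mulnC -sum_nat_const [X in (X + _)%N]big_mkcond [X in (_ + X)%N]big_mkcond.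
rewrite -big_split /=; apply: leq_sum => v _; rewrite !inE.
by have [h1|h1] := ltnP (degree E v) d; have [h2|h2] := leqP (degree E v) d.-2; lia.
Qed.

Lemma card_free_pairs_inv : #|free_pairs d E|%:R^-1 <= 4 * D ^+ 2 / S ^+ 2.
Proof.
have /andP[h _] := card_free_pairs_bounds E d0.
have u1 := unsat_large.
have h' : U * (U - D) <= 2 * #|free_pairs d E|%:R.
  move: h; rewrite -(ler_nat R) !natrM natrB//; have := unsat_large_nat; lia.
have s1 := slack_le_unsatR; have s2 := slack_large; have D2' := D2.
have U0 : 0 < U by lra.
have S0 : 0 < S by lra.
have hF : 3 / 8 * U ^+ 2 <= #|free_pairs d E|%:R.
  have : 0 <= U * (U - 4 * D) by apply: mulr_ge0; lra.
  by rewrite expr2; lra.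
have F0 : 0 < #|free_pairs d E|%:R :> R.
  by apply: lt_le_trans hF; apply: mulr_gt0; rewrite ?exprn_gt0//; lra.
rewrite -[leLHS]mul1r ler_pdivrMr// mulrAC ler_pdivlMr ?exprn_gt0// mul1r.
have : S ^+ 2 <= (D * U) ^+ 2 by rewrite ler_pXn2r ?nnegrE//; lra.
rewrite exprMn => h3; apply: (le_trans h3).
have : 0 < D ^+ 2 by rewrite exprn_gt0//; lra.
move=> D0; rewrite [leRHS]mulrAC [leRHS]mulrC mulrC -mulrA mulrC.
have : D ^+ 2 * (3 / 8 * U ^+ 2) <= D ^+ 2 * #|free_pairs d E|%:R by rewrite ler_pM2l.
have : 0 <= D ^+ 2 * U ^+ 2 by rewrite mulr_ge0// exprn_ge0//; lra.
lra.
Qed.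

Lemma hit_prob_lower v : v \in unsat d E ->
  2 / S * (1 - 2 * D ^+ 2 / S) <= hit_prob R d E v.
Proof.
move=> vU; have := hit_prob_approx R d0 unsat_large_nat vU.
rewrite -/U -/D ler_norml => /andP[h _].
have u1 := unsat_large; have s1 := slack_le_unsatR; have s2 := slack_large.
have U0 : 0 < U by have := D2; lra.
have S0 : 0 < S by lra.
have h1 : 2 / S <= 2 / U by rewrite ler_pM2l ?lef_pV2 ?posrE// unsat_le_slack.
have h2 : 2 * D / U <= 2 * D ^+ 2 / S.
  rewrite ler_pdivrMr// mulrAC ler_pdivlMr// expr2.
  have : D * S <= D * (D * U) by rewrite ler_pM2l//; have := D2; lra.
  lra.
have h3 : 2 * D ^+ 2 / S <= 1 by rewrite ler_pdivrMr// mul1r; have := hS; lra.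
apply: (@le_trans _ _ (2 / U * (1 - 2 * D / U))); last first.
  have -> : 2 / U * (1 - 2 * D / U) = 2 / U - 4 * D / U ^+ 2 by field; lra.
  lra.
apply: ler_pM => //; last lra; first by rewrite divr_ge0//; lra.
by lra.
Qed.

(** Each unsaturated vertex is hit with probability about [2 / #|unsat d E|],
which is [2 / S] when few vertices have degree below [d - 1]. *)
Lemma hit_prob_near v : v \in unsat d E ->
  `|hit_prob R d E v - 2 / S|
  <= 4 * D ^+ 3 / S ^+ 2 + 2 * D ^+ 2 * (count_le E d.-2)%:R / S ^+ 2.
Proof.
move=> vU; have := hit_prob_approx R d0 unsat_large_nat vU; rewrite -/U -/D.
have u1 := unsat_large; have s1 := slack_le_unsatR; have s2 := slack_large.
have D2' := D2.
have U0 : 0 < U by lra.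
have S0 : 0 < S by lra.
have h1 : 4 * D / U ^+ 2 <= 4 * D ^+ 3 / S ^+ 2.
  rewrite ler_pdivrMr ?exprn_gt0// mulrAC ler_pdivlMr ?exprn_gt0//.
  have : S ^+ 2 <= (D * U) ^+ 2 by rewrite ler_pXn2r ?nnegrE//; lra.
  move=> h; have : 4 * D * S ^+ 2 <= 4 * D * (D * U) ^+ 2 by rewrite ler_pM2l//; lra.
  by rewrite exprMn [D ^+ 3]exprS; lra.
have h2 : 0 <= 2 / U - 2 / S.
  by rewrite subr_ge0 ler_pM2l ?lef_pV2 ?posrE// unsat_le_slack.
have h3 : 2 / U - 2 / S <= 2 * D ^+ 2 * (count_le E d.-2)%:R / S ^+ 2.
  have -> : 2 / U - 2 / S = 2 * (S - U) / (S * U) by field; lra.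
  rewrite ler_pdivrMr ?mulr_gt0// mulrAC ler_pdivlMr ?exprn_gt0//.
  have h := slack_le_unsat_low; set M := (count_le _ _)%:R in h *.
  have M0 : 0 <= M by [].
  apply: (@le_trans _ _ (2 * (D * M) * S ^+ 2)).
    by rewrite ler_wpM2r ?exprn_ge0//; lra.
  have : D * M * S * S <= D * M * S * (D * U).
    by rewrite ler_wpM2l// !mulr_ge0//; lra.
  by rewrite !expr2; lra.
have -> : hit_prob R d E v - 2 / S = (hit_prob R d E v - 2 / U) + (2 / U - 2 / S) by ring.
move=> h4; apply: (le_trans (ler_normD _ _)); rewrite (ger0_norm h2); lra.
Qed.

End LateStep.

Section LowWeight.
Variables (R : realType) (d : nat) (V : finType) (L : R).
Hypothesis L1 : 1 <= L.
Implicit Types E : graph V.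

Definition low_term l j : R := if (j <= l)%N then L ^+ (l - j) else 0.

(** Weighting a vertex of degree [j] by [L ^ (l - j)] makes every hit divide
its contribution by at least [L], so the total decays almost as fast as the
number of vertices that are never hit. *)
Definition low_weight l E : R := \sum_v low_term l (degree E v).

Lemma low_term_ge0 l j : 0 <= low_term l j.
Proof. by rewrite /low_term; case: ifP => // _; rewrite exprn_ge0//; move: L1; lra. Qed.

Lemma low_weight_ge0 l E : 0 <= low_weight l E.
Proof. by apply: sumr_ge0 => v _; exact: low_term_ge0. Qed.

Lemma low_term_drop l j : (1 - L^-1) * low_term l j <= low_term l j - low_term l j.+1.
Proof.
have L0 : 0 < L by move: L1; lra.
rewrite mulrBl mul1r lerD2l lerN2 /low_term.
case: ltnP => jl; last by apply: mulr_ge0; rewrite ?invr_ge0 ?low_term_ge0//; lra.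
by rewrite ltnW// -(subnSK jl) exprS mulKf//; lra.
Qed.

Lemma count_le_low_weight l E : (count_le E l)%:R <= low_weight l E.
Proof.
rewrite /count_le -sumr_const big_mkcond; apply: ler_sum => v _; rewrite inE.
rewrite /low_term; case: ifP => // _; exact: exprn_ege1.
Qed.

Lemma count_lt_low_weight l E :
  #|[set v | (degree E v < l)%N]|%:R <= low_weight l E / L.
Proof.
have L0 : 0 < L by move: L1; lra.
rewrite ler_pdivlMr// mulrC mulr_natr -sumr_const big_mkcond.
apply: ler_sum => v _; rewrite inE /low_term; case: ltnP => jl; last first.
  by case: ifP => // _; rewrite exprn_ge0//; lra.
by rewrite ltnW// -(subnSK jl) exprS ler_peMr ?exprn_ege1//; lra.
Qed.

Lemma low_weight_step l E (S := (slack d E)%:R : R) : (2 <= d)%N -> (l < d)%N ->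
  4 * d%:R ^+ 2 <= S ->
  avg d E (fun e => low_weight l (e |: E)) <=
  low_weight l E * (1 - 2 / S * (1 - L^-1 - 2 * d%:R ^+ 2 / S)).
Proof.
move=> d2 ld hS; have d0 : (0 < d)%N by lia.
have s2 := slack_large d2 hS; rewrite -/S in s2.
have hSd : (d * d < slack d E)%N.
  rewrite -(ltr_nat R) -/S; apply: lt_le_trans hS.
  have : 0 < d%:R ^+ 2 :> R by rewrite exprn_gt0// ltr0n.
  by rewrite natrM expr2; lra.
have F0 := free_pairs_neq0 d0 hSd.
have -> : avg d E (fun e => low_weight l (e |: E)) =
    low_weight l E - \sum_v hit_prob R d E v *
      (low_term l (degree E v) - low_term l (degree E v).+1).
  rewrite -avg_hits -mulN1r -avgZ -[X in X + _](avg_cst (d := d) (E := E))// -avgD.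
  apply: eq_avg => e /(free_pairsP d0)[_ eE _].
  rewrite mulN1r big_mkcond -sumrB; apply: eq_bigr => v _.
  rewrite degreeU//; case: ifP => _; last by rewrite addn0 subr0.
  by rewrite addn1; ring.
rewrite mulrBr mulr1 lerD2l lerN2 /low_weight mulr_suml; apply: ler_sum => v _.
have p0 := hit_prob_ge0 R d E v.
have [dv|dv] := leqP (degree E v) l; last first.
  rewrite /low_term leqNgt dv /= mul0r mulr_ge0// leqNgt ltnS ltnW//= subr0 lexx//.
have vU : v \in unsat d E by rewrite inE; lia.
have hp := hit_prob_lower d2 hS vU; rewrite -/S in hp.
apply: (@le_trans _ _ (hit_prob R d E v * ((1 - L^-1) * low_term l (degree E v)))).
  2: by rewrite ler_wpM2l// low_term_drop.
rewrite [leLHS]mulrC [leRHS]mulrA ler_wpM2r ?low_term_ge0//.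
have hL : 0 <= 1 - L^-1 by rewrite subr_ge0 invf_le1//; move: L1; lra.
apply: (@le_trans _ _ (2 / S * (1 - 2 * d%:R ^+ 2 / S) * (1 - L^-1))).
  2: by rewrite ler_wpM2r.
rewrite -[leRHS]mulrA ler_wpM2l ?divr_ge0//.
have : 0 <= 2 * d%:R ^+ 2 / S * L^-1.
  by rewrite !mulr_ge0 ?invr_ge0//; move: L1; lra.
lra.
Qed.

(** A vertex survives a step with probability about [1 - 2 / S], and [S - 2] is
the next slack, so a count of unhit vertices decays like [S]. The exponential
factor, which stays bounded when [a] is small compared with [(ln S)^-1], makes
room for the relative errors of each step. *)
Definition decay (a S : R) : R := S * expR (- a * ln S).

Lemma low_weight_supermartingale l E (a : R) (S := (slack d E)%:R : R) :
  (2 <= d)%N -> (l < d)%N -> 4 * d%:R ^+ 2 <= S ->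
  0 <= a -> L^-1 + 2 * d%:R ^+ 2 / S <= a / 2 ->
  avg d E (fun e => low_weight l (e |: E)) / decay a (S - 2) <=
  low_weight l E / decay a S.
Proof.
move=> d2 ld hS a0 ha; have s2 := slack_large d2 hS; rewrite -/S in s2.
have hW := low_weight_step d2 ld hS; rewrite -/S in hW.
have g0 x : 0 < x -> 0 < decay a x by move=> x0; rewrite mulr_gt0// expR_gt0.
rewrite ler_pdivrMr ?g0//; last lra.
apply: (le_trans hW); rewrite -[leRHS]mulrA ler_wpM2l ?low_weight_ge0//.
rewrite [leRHS]mulrC ler_pdivlMr ?g0//; last lra.
pose x := 2 / S.
have x0 : 0 < x by rewrite divr_gt0//; lra.
have x1 : x <= 1 / 8 by rewrite ler_pdivrMr; lra.
have S2E : S - 2 = S * (1 - x) by rewrite /x; field; lra.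
apply: (@le_trans _ _ ((1 - x) * (1 + a * x) * decay a S)).
  apply: ler_wpM2r; first by apply/ltW/g0; lra.
  rewrite -/x -addrA -opprD; move: (L^-1 + _) ha => k hk.
  have h1 : x * k <= x * (a / 2) by rewrite ler_pM2l.
  have h2 : a * x * x <= a * x * (1 / 8) by rewrite ler_wpM2l// mulr_ge0//; lra.
  have h3 : 0 <= a * x by rewrite mulr_ge0//; lra.
  lra.
have lnE : ln (S * (1 - x)) = ln S + ln (1 - x) by rewrite lnM// posrE; lra.
rewrite S2E /decay lnE.
have -> : - a * (ln S + ln (1 - x)) = - a * ln S + - a * ln (1 - x) by ring.
rewrite expRD.
have h1 : 1 + a * x <= expR (- a * ln (1 - x)).
  apply: le_trans (expR_ge1Dx _) _; rewrite ler_expR mulNr -mulrN ler_wpM2l//.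
  have := @le_ln1Dx R (- x); lra.
have h2 : 0 <= S * (1 - x) * expR (- a * ln S).
  by rewrite !mulr_ge0 ?expR_ge0//; lra.
have := ler_wpM2l h2 h1.
lra.
Qed.

End LowWeight.

(** * Forecasting emptiness over a window of steps *)

Section LateWindow.
Variables (R : realType) (d n : nat).
Hypothesis d2 : (2 <= d)%N.
Implicit Types h : seq (graph 'I_n).

Let d0 : (0 < d)%N. Proof. by apply: leq_trans d2. Qed.

Definition slack_at i : R := (d * n)%:R - 2 * i%:R.

Lemma slack_atS i : slack_at i.+1 = slack_at i - 2.
Proof. by rewrite /slack_at -addn1 natrD; ring. Qed.

Lemma slack_at_le i j : (i <= j)%N -> slack_at j <= slack_at i.
Proof. by rewrite -(ler_nat R) /slack_at; lra. Qed.

Lemma reachable_slack_at h : reachable d h ->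
  (slack d (cur h))%:R = slack_at (size h).-1.
Proof.
move=> rh; rewrite /slack_at; have := reachable_slack d0 rh; rewrite card_ord => <-.
by rewrite natrD natrM; ring.
Qed.

Variables (L : R) (J : {set 'I_d.-1}) (tl : 'I_d.-1 -> nat).
Hypothesis L1 : 1 <= L.

(** Estimate, given the history, of the probability that for each [l] in [J]
no vertex has degree at most [l] at step [tl l]: the factor of [l] is frozen
from that step on, when it is the indicator of the event. *)
Definition forecast h : R :=
  \prod_(l in J) (1 - slack_at (tl l) / slack_at (minn (size h).-1 (tl l)))
    ^+ count_le (graph_at h (minn (size h).-1 (tl l))) l.

(** The first term comes from hitting two relevant vertices at once and from the
inexact hit probabilities, the second from unsaturated vertices of degree below
[d - 1], the third from vertices whose degree stays at most [l] after a hit. *)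
Definition forecast_err h : R :=
  let S := slack_at (size h).-1 in
  (4 * d%:R ^+ 3 + 4 * d%:R ^+ 2 + 4) / S ^+ 2
  + 2 * d%:R ^+ 2 / S ^+ 2 * low_weight L d.-2 (cur h)
  + \sum_(l in J) 4 * slack_at (tl l) / (L * S ^+ 2) * low_weight L l (cur h).

Lemma dd_lt_slack h : reachable d h ->
  4 * d%:R ^+ 2 <= slack_at (size h).-1 -> (d * d < slack d (cur h))%N.
Proof.
move=> rh; rewrite -reachable_slack_at// -(ltr_nat R); apply: lt_le_trans.
have : 0 < d%:R ^+ 2 :> R by rewrite exprn_gt0// ltr0n.
by rewrite natrM expr2; lra.
Qed.

(** Frozen factors are constant and lie between zero and one; the others form an
[emptiness] product, whose survival probability from slack [S] to slack
[slack_at (tl l)] is the quotient of the two. *)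
Lemma forecast_step h : reachable d h ->
  4 * d%:R ^+ 2 <= slack_at (size h).-1 ->
  (forall l, l \in J -> 0 < slack_at (tl l)) ->
  `|cond_exp d forecast h - forecast h| <= forecast_err h.
Proof.
move=> rh hS tl0; have hdd := dd_lt_slack rh hS.
have F0 := free_pairs_neq0 d0 hdd.
set E := cur h in hdd F0 *; set i := (size h).-1 in hS *.
have sE := reachable_slack_at rh; rewrite -/E -/i in sE.
set S := slack_at i in hS sE *.
have sh : size h = i.+1 by rewrite /i; case: h rh {hdd F0 sE hS S E i}.
have hS' : 4 * d%:R ^+ 2 <= (slack d E)%:R :> R by rewrite sE.
have s2 := slack_large d2 hS'; rewrite sE in s2.
pose A := [set l in J | (i < tl l)%N].
pose q l := slack_at (tl l) / S.
pose q' l := slack_at (tl l) / (S - 2).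
pose c := \prod_(l in J | ~~ (i < tl l)%N)
   (1 - slack_at (tl l) / slack_at (tl l)) ^+ count_le (graph_at h (tl l)) l.
have c01 : 0 <= c <= 1.
  apply: prod_le1 => l /andP[lJ _]; rewrite divff ?subrr; last by rewrite gt_eqF// tl0.
  by case: (count_le _ _) => [|k]; rewrite ?expr0 ?exprS ?mul0r ?lexx ?ler01.
have fh : forecast h = emptiness A q E * c.
  rewrite /forecast (bigID (fun l => (i < tl l)%N)) /=; congr (_ * _).
    apply: eq_big => [l|l /andP[_ il]]; first by rewrite inE.
    by rewrite -/i (minn_idPl (ltnW il)) /i graph_at_last.
  by apply: eq_bigr => l /andP[_]; rewrite -leqNgt => il; rewrite -/i (minn_idPr il).
have fFh F : forecast (F :: h) = emptiness A q' F * c.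
  rewrite /forecast (bigID (fun l => (i < tl l)%N)) /= sh; congr (_ * _).
    apply: eq_big => [l|l /andP[_ il]]; first by rewrite inE.
    rewrite (minn_idPl il) slack_atS -/S.
    by have := graph_at_last (F :: h); rewrite /= sh => ->.
  apply: eq_bigr => l /andP[_]; rewrite -leqNgt => il.
  by rewrite (minn_idPr (leqW il)) graph_at_cons// sh ltnS.
have S0 : 0 < S by lra.
have q'01 l : l \in A -> 0 <= q' l <= 1.
  rewrite inE => /andP[lJ il]; have h1 := tl0 _ lJ.
  have := slack_at_le il; rewrite slack_atS -/S => h2.
  by rewrite /q' divr_ge0 ?ler_pdivrMr ?mul1r//=; lra.
have qq' l : l \in A -> q l = (1 - 2 / S) * q' l.
  by move=> _; rewrite /q /q'; field; rewrite !gt_eqF//; lra.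
have t01 : 0 <= 2 / S <= 1 by rewrite divr_ge0 ?ler_pdivrMr//=; lra.
have hn := hit_prob_near d2 hS'; rewrite sE in hn.
have hY := emptiness_step d0 F0 t01 q'01 qq' hn.
rewrite cond_exp_avg// fh.
rewrite (eq_avg (g := fun e => c * emptiness A q' (e |: E))); last first.
  by move=> e _; rewrite fFh mulrC.
rewrite avgZ [emptiness A q E * c]mulrC -mulrBr normrM.
rewrite (ger0_norm (_ : 0 <= c)); last by case/andP: c01.
move: hY; set Y := `|_ - _| => hY.
apply: (@le_trans _ _ Y); first by rewrite ler_piMl ?normr_ge0//; case/andP: c01.
apply: (le_trans hY); rewrite /forecast_err -/i -/S -/E.
have h1 := card_free_pairs_inv d2 hS'; rewrite sE in h1.
have h2 : 2 * d%:R ^+ 2 * (count_le E d.-2)%:R / S ^+ 2 <=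
   2 * d%:R ^+ 2 / S ^+ 2 * low_weight L d.-2 E.
  rewrite mulrAC ler_wpM2l ?count_le_low_weight// divr_ge0 ?mulr_ge0 ?exprn_ge0//; lra.
have h3 : 2 / S * \sum_(l in A) q' l * #|[set v | (degree E v < l)%N]|%:R <=
  \sum_(l in J) 4 * slack_at (tl l) / (L * S ^+ 2) * low_weight L l E.
  rewrite mulr_sumr [leRHS](bigID (fun l => (i < tl l)%N)) /=.
  rewrite -[leLHS]addr0; apply: lerD; last first.
    apply: sumr_ge0 => l /andP[lJ _]; rewrite mulr_ge0 ?low_weight_ge0//.
    by rewrite divr_ge0 ?mulr_ge0 ?exprn_ge0// ?ltW ?tl0//; move: L1; lra.
  rewrite [leRHS](eq_bigl (fun l => l \in A)); last by move=> l; rewrite inE.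
  apply: ler_sum => l lA; have lJ : l \in J by move: lA; rewrite inE => /andP[].
  have h4 := count_lt_low_weight L1 l E.
  have h5 := low_weight_ge0 L1 l E.
  have h6 := tl0 _ lJ.
  have q2 : q' l <= 2 * slack_at (tl l) / S.
    rewrite /q' ler_pdivrMr; last lra.
    rewrite mulrAC ler_pdivlMr//.
    have : 0 <= slack_at (tl l) * (S - 4) by apply: mulr_ge0; lra.
    lra.
  have q0 : 0 <= q' l by case/andP: (q'01 _ lA).
  have -> : 4 * slack_at (tl l) / (L * S ^+ 2) * low_weight L l E =
     2 / S * (2 * slack_at (tl l) / S * (low_weight L l E / L)).
    by field; rewrite !gt_eqF//; move: L1; lra.
  by apply: ler_wpM2l; [rewrite divr_ge0//; lra | exact: ler_pM].
have h4 : (4 * d%:R ^+ 3 + 4 * d%:R ^+ 2 + 4) / S ^+ 2 =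
  4 * d%:R ^+ 3 / S ^+ 2 + 4 * d%:R ^+ 2 / S ^+ 2 + (2 / S) ^+ 2.
  by field; rewrite gt_eqF.
by rewrite h4; lra.
Qed.

End LateWindow.

Lemma steps_le a b j k :
  (j <= k)%N -> (a + 2 * k < b + 2)%N -> (a + 2 * j < b + 2)%N.
Proof. lia. Qed.

Section ForecastWindow.
Variables (R : realType) (d n : nat).
Hypothesis d2 : (2 <= d)%N.
Implicit Types h : seq (graph 'I_n).

Let d0 : (0 < d)%N. Proof. by apply: leq_trans d2. Qed.

Local Notation slack_at := (slack_at R d n).

Lemma slack_atD i j : slack_at (i + j) = slack_at i - 2 * j%:R.
Proof. by rewrite /slack_at natrD; ring. Qed.

Lemma steps_below_slack h m : reachable d h ->
  4 * d%:R ^+ 2 <= slack_at ((size h).-1 + m) ->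
  (d * d + 2 * m < slack d (cur h) + 2)%N.
Proof.
move=> rh hS; rewrite -(ltr_nat R) !natrD (reachable_slack_at R d2 rh) !natrM.
move: hS; rewrite slack_atD; have : 0 <= d%:R ^+ 2 :> R by rewrite exprn_ge0.
by rewrite expr2; lra.
Qed.

Lemma sum_inv_sqr i m : 0 < slack_at (i + m) ->
  \sum_(j < m) (slack_at (i + j) ^+ 2)^-1 <= (slack_at (i + m))^-1.
Proof.
elim: m => [|m IH] h; first by rewrite big_ord0 invr_ge0 ltW.
rewrite big_ord_recr /=; move: h; rewrite addnS slack_atS => h.
have h0 : 0 < slack_at (i + m) by lra.
apply: (@le_trans _ _ ((slack_at (i + m))^-1 + (slack_at (i + m) ^+ 2)^-1)).
  by rewrite lerD2r; apply: IH.
set x := slack_at (i + m) in h h0 *.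
rewrite -subr_ge0.
have -> : (x - 2)^-1 - (x^-1 + (x ^+ 2)^-1) = (x + 2) / (x ^+ 2 * (x - 2)).
  by field; rewrite !gt_eqF.
by rewrite divr_ge0// ?mulr_ge0 ?exprn_ge0//; lra.
Qed.

(** The slack decreases by two at each step and [2 / S <= ln S - ln (S - 2)]. *)
Lemma sum_inv_le_ln i m : 1 <= slack_at (i + m) ->
  \sum_(j < m) (slack_at (i + j))^-1 <= ln (slack_at i).
Proof.
move=> hm.
suff : \sum_(j < m) (slack_at (i + j))^-1 <= ln (slack_at i) - ln (slack_at (i + m)).
  by have := ln_ge0 hm; lra.
have : 0 < slack_at (i + m) by lra.
elim: m {hm} => [|m IH] h; first by rewrite big_ord0 addn0 subrr.
rewrite big_ord_recr /=; move: h; rewrite addnS slack_atS => h.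
have h0 : 0 < slack_at (i + m) by lra.
have {}IH := IH h0.
set x := slack_at (i + m) in h h0 IH *.
have x2 : 2 / x < 1 by rewrite ltr_pdivrMr//; lra.
have e1 : x - 2 = x * (1 + - (2 / x)) by field; rewrite gt_eqF.
have -> : ln (x - 2) = ln x + ln (1 + - (2 / x)) by rewrite e1 lnM// posrE; lra.
have := @le_ln1Dx R (- (2 / x)).
have : 0 < x^-1 by rewrite invr_gt0.
by move=> h1 h2; have := h2 _; lra.
Qed.

Variables (L : R) (J : {set 'I_d.-1}) (tl : 'I_d.-1 -> nat).
Hypothesis L1 : 1 <= L.
Variables (h : seq (graph 'I_n)) (m : nat) (a : R).
Let i := (size h).-1.
Hypotheses (rh : reachable d h) (hS : 4 * d%:R ^+ 2 <= slack_at (i + m)).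
Hypotheses (a0 : 0 <= a).
Hypothesis ha : L^-1 + 2 * d%:R ^+ 2 / slack_at (i + m) <= a / 2.

Let hSj j : (j <= m)%N -> 4 * d%:R ^+ 2 <= slack_at (i + j).
Proof. by move=> jm; apply: (le_trans hS); apply: slack_at_le; rewrite leq_add2l. Qed.

Let dd1 : 1 <= d%:R ^+ 2 :> R.
Proof. by rewrite -natrX ler1n expn_gt0 d0. Qed.

Let S1 j : (j <= m)%N -> 4 <= slack_at (i + j).
Proof. by move=> /hSj; move: dd1; lra. Qed.

Lemma exp_low_weight l j : (l < d)%N -> (j <= m)%N ->
  exp_after d j (fun h' => low_weight L l (cur h')) h <=
  low_weight L l (cur h) / slack_at i * expR (a * ln (slack_at i)) * slack_at (i + j).
Proof.
move=> ld jm.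
pose f h' := low_weight L l (cur h') / decay a (slack_at (size h').-1).
have g0 x : 4 <= x -> 0 < decay a x.
  by move=> x0; rewrite mulr_gt0// ?expR_gt0//; lra.
have side : (d * d + 2 * j < slack d (cur h) + 2)%N.
  by apply: steps_below_slack => //; apply: hSj.
have hf : exp_after d j f h <= f h.
  have -> : f h = f h + \sum_(k < j) exp_after d k (fun=> 0) h.
    rewrite big1 ?addr0// => k _; apply: (exp_after_cst _ d0 rh).
    exact: (steps_le (ltnW (ltn_ord k)) side).
  apply: exp_after_drift => // h' rh' sh'; rewrite addr0.
  have [k kj ek] : exists2 k, (k < j)%N & (size h').-1 = (i + k)%N.
    exists (size h' - size h)%N; first lia.
    by rewrite /i; case: (h) rh sh' => //= ? ? _; lia.
  have kE : 4 * d%:R ^+ 2 <= slack_at (size h').-1 by rewrite ek; apply: hSj; lia.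
  have hdd := dd_lt_slack d2 rh' kE.
  have sE := reachable_slack_at R d2 rh'.
  rewrite cond_exp_avg; last exact: free_pairs_neq0.
  have sz : (size h') = (i + k).+1 by case: (h') rh' ek => //= ? ? _ ->.
  have hS' : 4 * d%:R ^+ 2 <= (slack d (cur h'))%:R :> R by rewrite sE.
  have ha' : L^-1 + 2 * d%:R ^+ 2 / (slack d (cur h'))%:R <= a / 2.
    apply: le_trans ha; rewrite lerD2l ler_wpM2l ?mulr_ge0 ?exprn_ge0//.
    have km : (k <= m)%N := leq_trans (ltnW kj) jm.
    have := S1 km; have := S1 (leqnn m); rewrite sE ek => h1 h2.
    by rewrite lef_pV2 ?posrE; [apply: slack_at_le; rewrite leq_add2l | lra | lra].
  have := low_weight_supermartingale L1 d2 ld hS' a0 ha'.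
  rewrite sE ek /f /= sz /= slack_atS; apply: le_trans.
  rewrite [leRHS]mulrC -avgZ le_eqVlt; apply/orP; left; apply/eqP.
  by apply: eq_avg => e _; rewrite mulrC.
have hW : exp_after d j (fun h' => low_weight L l (cur h')) h <=
    decay a (slack_at (i + j)) * exp_after d j f h.
  rewrite -exp_afterZ; apply: exp_after_le => // h' rh' sh'.
  have -> : (i + j)%N = (size h').-1 by rewrite sh' /i; case: (h) rh.
  rewrite /f mulrC mulfVK// gt_eqF// g0//.
  have -> : (size h').-1 = (i + j)%N by rewrite sh' /i; case: (h) rh.
  exact: S1.
apply: (le_trans hW).
have hd := g0 _ (S1 jm).
apply: (@le_trans _ _ (decay a (slack_at (i + j)) * f h)); first by rewrite ler_pM2l.
have Si : 4 <= slack_at i by have := S1 (leq0n m); rewrite addn0.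
have -> : decay a (slack_at (i + j)) * f h = low_weight L l (cur h) / slack_at i *
   expR (a * ln (slack_at i)) * (slack_at (i + j) * expR (- a * ln (slack_at (i + j)))).
  rewrite /f /decay -/i !mulNr [expR (- (a * ln (slack_at i)))]expRN.
  by field; rewrite (gt_eqF (expR_gt0 _)) gt_eqF//; lra.
have Sij := S1 jm.
apply: ler_wpM2l.
  by rewrite mulr_ge0 ?expR_ge0// divr_ge0 ?low_weight_ge0//; lra.
rewrite ler_piMr//; first lra.
rewrite -expR0 ler_expR mulNr oppr_le0 mulr_ge0// ln_ge0//; lra.
Qed.

Hypothesis tl0 : forall l, l \in J -> 0 < slack_at (tl l).

(** Only one logarithm of the initial slack is lost: the expected weights decay
like the slack, so that the terms of [forecast_err] sum like its inverse. *)
Lemma forecast_window :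
  `|exp_after d m (forecast R J tl) h - forecast R J tl h| <=
  (4 * d%:R ^+ 3 + 4 * d%:R ^+ 2 + 4) / slack_at (i + m) +
  (2 * d%:R ^+ 2 * (low_weight L d.-2 (cur h) / slack_at i) +
   \sum_(l in J) 4 * slack_at (tl l) / L * (low_weight L l (cur h) / slack_at i)) *
  expR (a * ln (slack_at i)) * ln (slack_at i).
Proof.
have side : (d * d + 2 * m < slack d (cur h) + 2)%N by exact: steps_below_slack.
have step h' : reachable d h' -> (size h <= size h' < size h + m)%N ->
    `|cond_exp d (forecast R J tl) h' - forecast R J tl h'| <= forecast_err L J tl h'.
  move=> rh' sh'; apply: forecast_step => //.
  have -> : (size h').-1 = (i + (size h' - size h))%N.
    by rewrite /i; case: (h) rh sh' => //= ? ? _; lia.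
  by apply: hSj; lia.
have up : exp_after d m (forecast R J tl) h <= forecast R J tl h +
    \sum_(j < m) exp_after d j (forecast_err L J tl) h.
  apply: exp_after_drift => // h' rh' sh'.
  by have := step _ rh' sh'; rewrite ler_norml => /andP[_]; lra.
have dn : exp_after d m (fun h => -1 * forecast R J tl h) h <= -1 * forecast R J tl h +
    \sum_(j < m) exp_after d j (forecast_err L J tl) h.
  apply: exp_after_drift => // h' rh' sh'; rewrite cond_expZ.
  by have := step _ rh' sh'; rewrite ler_norml => /andP[+ _]; lra.
rewrite exp_afterZ in dn.
apply: (@le_trans _ _ (\sum_(j < m) exp_after d j (forecast_err L J tl) h)).
  by rewrite ler_norml; apply/andP; split; lra.
set c1 := 4 * _ + _ + 4.
pose X := (2 * d%:R ^+ 2 * (low_weight L d.-2 (cur h) / slack_at i) +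
   \sum_(l in J) 4 * slack_at (tl l) / L * (low_weight L l (cur h) / slack_at i)) *
  expR (a * ln (slack_at i)).
rewrite -/X.
have L0 : 0 < L by move: L1; lra.
have Si : 4 <= slack_at i by have := S1 (leq0n m); rewrite addn0.
have X0 : 0 <= X.
  rewrite mulr_ge0 ?expR_ge0// addr_ge0//.
    by rewrite !mulr_ge0 ?exprn_ge0 ?invr_ge0 ?low_weight_ge0//; lra.
  apply: sumr_ge0 => l lJ; have := tl0 lJ => h1.
  by rewrite !mulr_ge0 ?invr_ge0 ?low_weight_ge0//; lra.
apply: (@le_trans _ _ (\sum_(j < m) (c1 * (slack_at (i + j) ^+ 2)^-1 +
    X * (slack_at (i + j))^-1))); last first.
  rewrite big_split /= -!mulr_sumr; apply: lerD.
    rewrite ler_wpM2l ?sum_inv_sqr//; last by apply: (lt_le_trans _ (S1 _)).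
    by rewrite /c1 !addr_ge0 ?mulr_ge0 ?exprn_ge0.
  by rewrite ler_wpM2l ?sum_inv_le_ln//; have := S1 (leqnn m); lra.
apply: ler_sum => -[j jm] _ /=.
have Sj : 4 <= slack_at (i + j) by apply: S1; exact: ltnW.
have Sj0 : slack_at (i + j) != 0 by rewrite gt_eqF//; lra.
set S := slack_at (i + j) in Sj Sj0 *.
pose c2 := 2 * d%:R ^+ 2 / S ^+ 2 : R.
pose c3 l := 4 * slack_at (tl l) / (L * S ^+ 2).
apply: (@le_trans _ _ (exp_after d j (fun h' => c1 / S ^+ 2 +
    (c2 * low_weight L d.-2 (cur h') +
    \sum_(l in J) c3 l * low_weight L l (cur h'))) h)).
  apply: (exp_after_le d0 rh (steps_le (ltnW jm) side)).
  move=> h' rh' sh'; rewrite /forecast_err.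
  have -> : (size h').-1 = (i + j)%N by rewrite sh' /i; case: (h) rh.
  by rewrite -/S -/c1 addrA lexx.
rewrite !exp_afterD (exp_after_cst _ d0 rh (steps_le (ltnW jm) side)).
rewrite lerD2l.
have -> : exp_after d j (fun h' => c2 * low_weight L d.-2 (cur h')) h =
    c2 * exp_after d j (fun h' => low_weight L d.-2 (cur h')) h.
  exact: exp_afterZ.
have -> : exp_after d j (fun h' => \sum_(l in J) c3 l * low_weight L l (cur h')) h =
    \sum_(l in J) c3 l * exp_after d j (fun h' => low_weight L l (cur h')) h.
  by rewrite exp_after_sum; apply: eq_bigr => l _; exact: exp_afterZ.
have eX : X / S = c2 * (low_weight L d.-2 (cur h) / slack_at i *
      expR (a * ln (slack_at i)) * S) +
   \sum_(l in J) c3 l * (low_weight L l (cur h) / slack_at i *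
      expR (a * ln (slack_at i)) * S).
  rewrite /X mulrDl mulrDl; congr (_ + _).
    by rewrite /c2; field; rewrite Sj0 gt_eqF//; lra.
  rewrite !mulr_suml; apply: eq_bigr => l _; rewrite /c3.
  by field; rewrite Sj0 !gt_eqF//; lra.
rewrite eX; apply: lerD.
  rewrite ler_wpM2l ?divr_ge0 ?mulr_ge0 ?exprn_ge0//; try lra.
  by rewrite /S; apply: exp_low_weight => //; [move: d2; clear; lia | exact: ltnW].
apply: ler_sum => l lJ; have h1 := tl0 lJ.
rewrite ler_wpM2l ?divr_ge0 ?mulr_ge0 ?exprn_ge0//; try lra.
rewrite /S; apply: exp_low_weight => //; last exact: ltnW.
by have := ltn_ord l; move: d2; clear; lia.
Qed.

End ForecastWindow.

(** * Deviations of degree counts from Poisson means *)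

Section DeviationInequality.
Variable R : realType.

(** In the application [A] and [B] are the deviations of the scaled counts [x] and
[x1 / l] of two consecutive degrees from the values [r] and [r1], [t] is the
tick of the clock, [g] is [expR t], [w] is the second-order part of the increase
of [r], and [b] comes from the inexact hit probabilities. Apart from terms of
order [t ^+ 2] the mean of the next deviation is [A + t * l * B]. *)
Lemma one_step_square (g t l A B r r1 w b x x1 D c : R) :
  0 <= t <= 1 / 2 -> 1 + t <= g -> g * (1 - t) <= 1 -> 0 <= l <= 1 ->
  x = A + r -> x1 = l * (B + r1) -> 0 <= x -> 0 <= x1 ->
  0 <= r <= 1 -> 0 <= r1 <= 1 -> 0 <= w <= c * t ^+ 2 ->
  `|b| <= D * t ^+ 2 * (x + x1) -> 0 <= D ->
  forall K, K = 2 + 2 * D + c ->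
  (g * (x + t * (x1 - x) + b) - (r + t * l * r1 + w)) ^+ 2 <=
  A ^+ 2 + t * l * (A ^+ 2 + B ^+ 2)
    + (6 * K + 2 + 54 * K ^+ 2) * t ^+ 2 * (1 + A ^+ 2 + B ^+ 2).
Proof.
move=> /andP[t0 t1] g1 g2 /andP[l0 l1] xE x1E x0 x10 /andP[r0 rr] /andP[r10 rr1].
move=> /andP[w0 w1] hb D0 K KE.
have tt0 : 0 <= t ^+ 2 by rewrite exprn_ge0.
have g3 : g - 1 <= 2 * t.
  have : 0 <= t * (1 - 2 * t) by apply: mulr_ge0; lra.
  have : (g - (1 + 2 * t)) * (1 - t) <= t * (2 * t - 1) by lra.
  move=> h1 h2; have : (g - (1 + 2 * t)) * (1 - t) <= 0 by lra.
  by rewrite pmulr_lle0; lra.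
pose m := x * (g * (1 - t) - 1) + t * x1 * (g - 1) + g * b - w.
have -> : g * (x + t * (x1 - x) + b) - (r + t * l * r1 + w) = A + t * l * B + m.
  by rewrite /m x1E xE; ring.
have c0 : 0 <= c * t ^+ 2 by lra.
have hx : x <= `|A| + 1 by rewrite xE; have := ler_norm A; lra.
have hx1 : x1 <= `|B| + 1.
  have h1 : B + r1 <= `|B| + 1 by have := ler_norm B; lra.
  have h2 : l * (B + r1) <= l * (`|B| + 1) by rewrite ler_wpM2l.
  have h3 : l * (`|B| + 1) <= `|B| + 1 by rewrite ler_piMl// addr_ge0.
  by rewrite x1E; lra.
have nA := normr_ge0 A; have nB := normr_ge0 B.
pose N := 3 + `|A| + `|B|.
have hm : `|m| <= K * t ^+ 2 * N.
  have m1 : `|x * (g * (1 - t) - 1)| <= x * t ^+ 2.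
    rewrite normrM (ger0_norm x0) ler_wpM2l// ler_norml; apply/andP; split; last lra.
    have : (1 + t) * (1 - t) <= g * (1 - t) by rewrite ler_wpM2r//; lra.
    by rewrite expr2; lra.
  have m2 : `|t * x1 * (g - 1)| <= 2 * t ^+ 2 * x1.
    rewrite ger0_norm; last by rewrite !mulr_ge0//; lra.
    have : t * x1 * (g - 1) <= t * x1 * (2 * t) by rewrite ler_wpM2l// mulr_ge0.
    by rewrite expr2; lra.
  have m3 : `|g * b| <= 2 * (D * t ^+ 2 * (x + x1)).
    by rewrite normrM ger0_norm; [apply: ler_pM => // | ]; lra.
  have m4 : `|m| <= x * t ^+ 2 + 2 * t ^+ 2 * x1 + 2 * (D * t ^+ 2 * (x + x1)) + c * t ^+ 2.
    apply: (le_trans (ler_normB _ _)); apply: lerD; last by rewrite ger0_norm.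
    apply: (le_trans (ler_normD _ _)); apply: lerD => //.
    by apply: (le_trans (ler_normD _ _)); apply: lerD.
  apply: (le_trans m4).
  have n1 : t ^+ 2 * (x + x1) <= t ^+ 2 * (N - 1) by rewrite ler_wpM2l// /N; lra.
  have n2 : D * t ^+ 2 * (x + x1) <= D * t ^+ 2 * (N - 1).
    by have := ler_wpM2l D0 n1; rewrite !mulrA.
  have n3 : c * t ^+ 2 * 1 <= c * t ^+ 2 * N by rewrite ler_wpM2l// /N; lra.
  have n4 : 0 <= t ^+ 2 * x by rewrite mulr_ge0.
  have n5 : 0 <= D * t ^+ 2 by rewrite mulr_ge0.
  by rewrite KE; lra.
have K0 : 0 <= K * t ^+ 2.
  have : 0 <= D * t ^+ 2 by rewrite mulr_ge0.
  by rewrite KE; lra.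
have A2 : A ^+ 2 = `|A| ^+ 2 by rewrite -normrX ger0_norm// sqr_ge0.
have B2 : B ^+ 2 = `|B| ^+ 2 by rewrite -normrX ger0_norm// sqr_ge0.
pose q := 1 + A ^+ 2 + B ^+ 2.
have hAN : `|A| * N <= 3 * q.
  rewrite /N /q A2 B2; have := sqr_ge0 (`|A| - 1); have := sqr_ge0 (`|A| - `|B|).
  by have := sqr_ge0 `|B|; rewrite !expr2; lra.
have hNN : N ^+ 2 <= 27 * q.
  rewrite /N /q A2 B2; have := sqr_ge0 (`|A| - 3); have := sqr_ge0 (`|A| - `|B|).
  have := sqr_ge0 (`|B| - 3); have := sqr_ge0 (`|B|); have := sqr_ge0 (`|A|).
  by rewrite !expr2; lra.
have q0 : 0 <= q by rewrite /q !addr_ge0 ?sqr_ge0.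
have h1 : 2 * (A * m) <= 6 * (K * t ^+ 2 * q).
  have : A * m <= `|A| * (K * t ^+ 2 * N).
    by apply: (le_trans (ler_norm _)); rewrite normrM ler_wpM2l.
  have : K * t ^+ 2 * (`|A| * N) <= K * t ^+ 2 * (3 * q) by rewrite ler_wpM2l.
  lra.
have t21 : t ^+ 2 <= 1.
  by rewrite expr_le1//; lra.
have h2 : m ^+ 2 <= 27 * (K ^+ 2 * t ^+ 2 * q).
  have -> : m ^+ 2 = `|m| ^+ 2 by rewrite -normrX ger0_norm// sqr_ge0.
  apply: (@le_trans _ _ ((K * t ^+ 2 * N) ^+ 2)).
    by rewrite ler_pXn2r ?nnegrE// mulr_ge0// /N; lra.
  have -> : (K * t ^+ 2 * N) ^+ 2 = K ^+ 2 * t ^+ 2 * t ^+ 2 * N ^+ 2 by ring.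
  have n1 : K ^+ 2 * t ^+ 2 * t ^+ 2 * N ^+ 2 <= K ^+ 2 * t ^+ 2 * t ^+ 2 * (27 * q).
    by apply: ler_wpM2l hNN; apply: mulr_ge0 => //; apply: mulr_ge0 => //; exact: sqr_ge0.
  have n2 : K ^+ 2 * t ^+ 2 * (27 * q) * t ^+ 2 <= K ^+ 2 * t ^+ 2 * (27 * q) * 1.
    apply: ler_wpM2l t21; apply: mulr_ge0; last lra.
    by apply: mulr_ge0 => //; exact: sqr_ge0.
  lra.
have h3 : (t * l * B) ^+ 2 <= t ^+ 2 * q.
  have -> : (t * l * B) ^+ 2 = t ^+ 2 * (l ^+ 2 * B ^+ 2) by ring.
  rewrite ler_wpM2l//; apply: (@le_trans _ _ (1 * B ^+ 2)).
    by rewrite ler_wpM2r ?sqr_ge0// expr_le1.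
  by rewrite /q; have := sqr_ge0 A; lra.
have h4 : 2 * (A * B) <= A ^+ 2 + B ^+ 2 by have := sqr_ge0 (A - B); rewrite !expr2; lra.
have h5 : t * l * (2 * (A * B)) <= t * l * (A ^+ 2 + B ^+ 2).
  by rewrite ler_wpM2l// mulr_ge0.
have h6 : 2 * (t * l * B * m) <= (t * l * B) ^+ 2 + m ^+ 2.
  by have := sqr_ge0 (t * l * B - m); rewrite !expr2; lra.
have -> : (A + t * l * B + m) ^+ 2 = A ^+ 2 + t * l * (2 * (A * B)) + 2 * (A * m)
   + ((t * l * B) ^+ 2 + 2 * (t * l * B * m) + m ^+ 2) by ring.
rewrite -/q; lra.
Qed.

Lemma pow_shift_bound (r t : R) k : 0 <= r <= 1 -> 0 <= t <= 1 ->
  0 <= (r + t) ^+ k.+1 - r ^+ k.+1 - k.+1%:R * t * r ^+ k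
    <= 4 ^+ k.+1 * t ^+ 2.
Proof.
move=> /andP[r0 r1] /andP[t0 t1] /=.
elim: k => [|k /andP[IH0 IH1]].
  by rewrite !expr1 expr0 mulr1 mul1r; have := sqr_ge0 t; lra.
have -> : (r + t) ^+ k.+2 - r ^+ k.+2 - k.+2%:R * t * r ^+ k.+1 =
  (r + t) * ((r + t) ^+ k.+1 - r ^+ k.+1 - k.+1%:R * t * r ^+ k)
  + k.+1%:R * t ^+ 2 * r ^+ k.
  by rewrite -[k.+2%:R]natr1 ![_ ^+ k.+2]exprS [r ^+ k.+1]exprS [(r + t) ^+ k.+1]exprS; ring.
set w := _ - _ - _ in IH0 IH1 *.
have rk0 : 0 <= r ^+ k by rewrite exprn_ge0.
have rk1 : r ^+ k <= 1 by rewrite exprn_ile1.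
have h2 : (r + t) * w <= 2 * (4 ^+ k.+1 * t ^+ 2) by apply: ler_pM => //; lra.
have h3 : k.+1%:R * t ^+ 2 * r ^+ k <= k.+1%:R * t ^+ 2 * 1.
  by rewrite ler_wpM2l// mulr_ge0 ?sqr_ge0.
have h4 : k.+1%:R * t ^+ 2 <= 4 ^+ k.+1 * t ^+ 2.
  rewrite ler_wpM2r ?sqr_ge0// -natrX ler_nat.
  by apply: ltnW; apply: ltn_expl.
have h5 : 0 <= 4 ^+ k.+1 * t ^+ 2 by rewrite mulr_ge0 ?exprn_ge0.
apply/andP; split.
  by rewrite addr_ge0// ?mulr_ge0 ?sqr_ge0//; lra.
rewrite [4 ^+ k.+2]exprS; lra.
Qed.

End DeviationInequality.

Section EarlyStep.
Variables (R : realType) (d : nat) (V : finType) (L : R).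
Hypotheses (d2 : (2 <= d)%N) (L1 : 1 <= L).
Implicit Types (E : graph V) (s : R) (k : nat).

Let d0 : (0 < d)%N. Proof. by apply: leq_trans d2. Qed.

Definition degree_count E k : nat := #|[set v | degree E v == k]|.

(** Up to relative error [O(1/#|unsat d E|)] this is the chance that one step
hits a given unsaturated vertex. *)
Definition clock_tick E : R := 2 / #|unsat d E|%:R.

Definition scaled_count s E k : R :=
  expR s * (degree_count E k)%:R / (#|V|%:R * L ^+ k).

(** When every unsaturated vertex is hit at rate one, degrees are Poisson
variables stopped at [d]; [deviation s E k] compares the number of vertices of
degree [k] with its mean at time [s]. *)
Definition deviation s E k : R := scaled_count s E k - (s / L) ^+ k / k`!%:R.

(** Dividing the count of degree [k] by [L ^+ k], its order of magnitude at time
[L], weakens the influence of each degree on the next one to [t / L] per tick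
[t]; this adds up to a constant while the clock runs up to [L]. *)
Definition discrepancy s E : R := \sum_(k < d) deviation s E k ^+ 2.

Definition early_const : R :=
  let K := 2 + 2 * d%:R + 4 ^+ d in 54 * K ^+ 2 + 6 * K + 110.

(** The second moment is the square of the mean plus the variance, and the
variance is at most [b ^+ 2 * v]. *)
Lemma avg_sqr_affine E (a b m v : R) (xi : {set V} -> R) :
  (0 < #|free_pairs d E|)%N -> avg d E xi = m -> avg d E (fun e => xi e ^+ 2) <= v ->
  avg d E (fun e => (a + b * xi e) ^+ 2) <= (a + b * m) ^+ 2 + b ^+ 2 * v.
Proof.
move=> F0 hm hv.
have -> : avg d E (fun e => (a + b * xi e) ^+ 2) =
    a ^+ 2 + 2 * a * b * m + b ^+ 2 * avg d E (fun e => xi e ^+ 2).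
  rewrite -hm -!avgZ -[X in _ = X + _ + _](avg_cst (d := d) (E := E))// -!avgD.
  by apply: eq_avg => e _; ring.
have : b ^+ 2 * avg d E (fun e => xi e ^+ 2) <= b ^+ 2 * v.
  by rewrite ler_wpM2l// sqr_ge0.
have : 0 <= (b * m) ^+ 2 by exact: sqr_ge0.
by rewrite !expr2; lra.
Qed.

Variable E : graph V.
Hypothesis U4 : (4 * d <= #|unsat d E|)%N.
Let t := clock_tick E.

Lemma clock_tick_bounds : 0 < t /\ d%:R * t <= 1 / 2.
Proof.
have D1 : 1 <= d%:R :> R by rewrite ler1n.
have h : 4 * d%:R <= #|unsat d E|%:R :> R by rewrite -natrM ler_nat.
have U0 : 0 < #|unsat d E|%:R :> R by lra.
split; first by rewrite divr_gt0.
by rewrite /t /clock_tick mulrA ler_pdivrMr//; lra.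
Qed.

Lemma clock_tick_le_half : t <= 1 / 2.
Proof.
have [t0 dt] := clock_tick_bounds; apply: le_trans dt.
by rewrite ler_peMl ?ler1n// ltW.
Qed.

Let F0 : (0 < #|free_pairs d E|)%N.
Proof.
have /andP[h _] := card_free_pairs_bounds E d0.
have : (0 < #|unsat d E| * (#|unsat d E| - d))%N by rewrite muln_gt0; lia.
by move: h; lia.
Qed.

Let hit_tick v : v \in unsat d E -> `|hit_prob R d E v - t| <= d%:R * t ^+ 2.
Proof.
move=> vU; have := hit_prob_approx R d0 U4 vU; rewrite -/t.
suff -> : 4 * d%:R / #|unsat d E|%:R ^+ 2 = d%:R * t ^+ 2 :> R by [].
rewrite /t /clock_tick; field.
by rewrite pnatr_eq0; move: U4 d2; lia.
Qed.

Section OneDegree.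
Variables (s : R) (k : nat).
Hypotheses (s0 : 0 <= s) (sL : s <= L) (kd : (k < d)%N).

Let chi v : R := (degree E v == k)%:R.
Let chi1 v : R := ((degree E v).+1 == k)%:R.
Let xi (e : {set V}) : R := \sum_(v in e) (chi1 v - chi v).
Let y : R := \sum_v chi v.
Let y1 : R := \sum_v chi1 v.

Let chi_ge0 v : 0 <= chi v. Proof. by rewrite /chi ler0n. Qed.
Let chi1_ge0 v : 0 <= chi1 v. Proof. by rewrite /chi1 ler0n. Qed.
Let y_ge0 : 0 <= y. Proof. by apply: sumr_ge0. Qed.
Let y1_ge0 : 0 <= y1. Proof. by apply: sumr_ge0. Qed.

Let degree_countE F j : (degree_count F j)%:R = \sum_v (degree F v == j)%:R :> R.
Proof.
rewrite /degree_count -sumr_const big_mkcond; apply: eq_bigr => v _.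
by rewrite inE; case: eqP.
Qed.

Let degree_count_step e : e \in free_pairs d E ->
  (degree_count (e |: E) k)%:R = y + xi e.
Proof.
move=> /(free_pairsP d0)[_ eE _]; rewrite degree_countE /y /xi.
rewrite [X in _ + X]big_mkcond -big_split; apply: eq_bigr => v _ /=.
rewrite degreeU//; case: ifP => _; last by rewrite addn0 addr0.
by rewrite addn1 /chi1; ring.
Qed.

Let chi_sat v : v \notin unsat d E -> chi v = 0 /\ chi1 v = 0.
Proof.
rewrite inE -leqNgt => h; rewrite /chi /chi1; split.
  by case: eqP => // h'; move: kd h; rewrite h'; lia.
by case: eqP => // h'; move: kd h; rewrite -h'; lia.
Qed.

Let mean_xi : `|avg d E xi - t * (y1 - y)| <= d%:R * t ^+ 2 * (y1 + y).
Proof.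
rewrite /xi avg_hits -sumrB mulr_sumr -sumrB.
apply: (le_trans (ler_norm_sum _ _ _)).
rewrite /y1 /y -big_split mulr_sumr; apply: ler_sum => v _ /=.
rewrite -mulrBl normrM.
have [vU|/chi_sat[-> ->]] := boolP (v \in unsat d E); last first.
  by rewrite subrr normr0 addr0 !mulr0.
apply: ler_pM => //; first exact: hit_tick.
apply: (le_trans (ler_normB _ _)).
by rewrite !ger0_norm.
Qed.

Let sqr_xi : avg d E (fun e => xi e ^+ 2) <= 4 * t * (y1 + y).
Proof.
have [t0 dt] := clock_tick_bounds.
apply: (@le_trans _ _ (avg d E (fun e => \sum_(v in e) 2 * (chi1 v + chi v)))).
  apply: avg_le => e /(free_pairsP d0)[/eqP/cards2P[u [v [uv ->]]] _ _].
  rewrite /xi !big_setU1 ?inE//= !big_set1.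
  have c2 w : (chi1 w - chi w) ^+ 2 <= chi1 w + chi w.
    by rewrite /chi1 /chi; case: eqP => _; case: eqP => _; rewrite expr2 /=; lra.
  have := c2 u; have := c2 v; have := sqr_ge0 (chi1 u - chi u - (chi1 v - chi v)).
  by rewrite !expr2; lra.
rewrite avg_hits /y1 /y -big_split mulr_sumr; apply: ler_sum => v _ /=.
have [vU|/chi_sat[-> ->]] := boolP (v \in unsat d E); last by rewrite !addr0 !mulr0.
have h : hit_prob R d E v <= 2 * t.
  have := hit_tick vU; rewrite ler_norml => /andP[_ h].
  have : d%:R * t * t <= 1 / 2 * t by rewrite ler_wpM2r// ltW.
  by rewrite expr2 in h; lra.
have := ler_wpM2r (addr_ge0 (chi1_ge0 v) (chi_ge0 v)) h; lra.
Qed.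

Let A := deviation s E k.
Let B := if k is k'.+1 then deviation s E k' else 0.

Lemma deviation_step :
  avg d E (fun e => deviation (s + t) (e |: E) k ^+ 2) <=
  A ^+ 2 + t / L * (A ^+ 2 + B ^+ 2) +
  early_const * (t ^+ 2 + t * (expR s / #|V|%:R)) * (1 + A ^+ 2 + B ^+ 2).
Proof.
have [t0 dt] := clock_tick_bounds.
have t12 := clock_tick_le_half.
have L0 : 0 < L by move: L1; lra.
have V0 : 0 < #|V|%:R :> R.
  rewrite ltr0n; apply: (@leq_trans #|unsat d E|); last exact: max_card.
  by apply: leq_trans U4; rewrite muln_gt0.
set eps := expR s / #|V|%:R.
have eps0 : 0 < eps by rewrite divr_gt0 ?expR_gt0.
pose u := eps / L ^+ k.
have Lk1 : 1 <= L ^+ k by rewrite exprn_ege1.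
have Lk0 : 0 < L ^+ k by lra.
have u0 : 0 < u by rewrite divr_gt0.
have ueps : u <= eps by rewrite ler_pdivrMr// ler_peMr// ltW.
pose l := L^-1.
have l01 : 0 <= l <= 1 by rewrite /l invr_ge0 ltW//= invf_le1.
pose r0 := s / L.
have r01 : 0 <= r0 <= 1 
  by apply/andP; split; [rewrite divr_ge0// ltW | rewrite ler_pdivrMr// mul1r].
have fact1 j : 0 < (j`!%:R^-1 : R) <= 1.
  by rewrite invr_gt0 ltr0n fact_gt0 invf_le1 ?ltr0n ?fact_gt0// ler1n fact_gt0.
pose r := r0 ^+ k / k`!%:R.
pose r1 := if k is k'.+1 then r0 ^+ k' / k'`!%:R else 0.
have rr01 j : 0 <= r0 ^+ j / j`!%:R <= 1.
  have /andP[f0 f1] := fact1 j; case/andP: r01 => h0 h1.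
  have x0 : 0 <= r0 ^+ j by rewrite exprn_ge0.
  have x1 : r0 ^+ j <= 1 by rewrite exprn_ile1.
  by apply/andP; split; [apply: mulr_ge0 | apply: mulr_ile1] => //; exact: ltW.
have r11 : 0 <= r1 <= 1 by rewrite /r1; case: (k) => [|k']; rewrite ?lexx ?ler01.
pose w := ((s + t) / L) ^+ k / k`!%:R - r - t * l * r1.
have tl01 : 0 <= t * l <= 1.
  case/andP: l01 => h0 h1.
  by apply/andP; split; [apply: mulr_ge0 | apply: mulr_ile1] => //; lra.
have w01 : 0 <= w <= 4 ^+ d * t ^+ 2.
  rewrite /w /r /r1 (_ : (s + t) / L = r0 + t * l); last by rewrite /r0 /l; field; rewrite gt_eqF.
  move: kd; case: (k) => [_|k' k'd].
    rewrite !expr0 fact0 mulr0 subr0 subrr lexx /=.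
    by rewrite mulr_ge0 ?sqr_ge0 ?exprn_ge0.
  have /andP[h0 h1] := pow_shift_bound k' r01 tl01.
  have -> : (r0 + t * l) ^+ k'.+1 / k'.+1`!%:R - r0 ^+ k'.+1 / k'.+1`!%:R -
      t * l * (r0 ^+ k' / k'`!%:R) =
      ((r0 + t * l) ^+ k'.+1 - r0 ^+ k'.+1 - k'.+1%:R * (t * l) * r0 ^+ k') / k'.+1`!%:R.
    rewrite factS natrM; field.
    by rewrite [1 + _]addrC natr1 !pnatr_eq0 -lt0n fact_gt0.
  have /andP[f0 f1] := fact1 k'.+1.
  apply/andP; split; first by apply: mulr_ge0 => //; exact: ltW.
  have hl2 : l ^+ 2 <= 1 by case/andP: l01 => l0 l1; rewrite expr_le1.
  apply: (@le_trans _ _ (4 ^+ k'.+1 * (t * l) ^+ 2)).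
    by apply: le_trans h1; rewrite ler_piMr//; apply: le_trans h0.
  apply: ler_pM; [exact: exprn_ge0 | exact: sqr_ge0 | |].
    by apply: ler_weXn2l; [lra | exact: ltnW].
  by rewrite exprMn ler_piMr ?sqr_ge0.
have Vn : #|V|%:R != 0 :> R by rewrite gt_eqF.
have Lkn : L ^+ k != 0 by rewrite gt_eqF.
have fn : k`!%:R != 0 :> R by rewrite pnatr_eq0 -lt0n fact_gt0.
pose m := avg d E xi.
pose b := u * (m - t * (y1 - y)).
have AE : u * y = A + r.
  rewrite /A /deviation /scaled_count -/r degree_countE -/y /u /eps /r /r0.
  by field; rewrite Lkn Vn fn.
have BE : u * y1 = l * (B + r1).
  rewrite /B /r1 /u /y1 /chi1; move: L0; case: (k) => [|k'] L0'.
    by rewrite big1 ?mulr0 ?addr0 ?mulr0.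
  rewrite /deviation /scaled_count degree_countE -/r0 subrK.
  under eq_bigr do rewrite eqSS.
  by rewrite /eps /l exprS; field; rewrite !gt_eqF// exprn_gt0.
pose D : R := d%:R.
have D0 : 0 <= D by [].
pose K : R := 2 + 2 * D + 4 ^+ d.
have hb : `|b| <= D * t ^+ 2 * (u * y + u * y1).
  rewrite /b normrM (gtr0_norm u0).
  have -> : D * t ^+ 2 * (u * y + u * y1) = u * (D * t ^+ 2 * (y1 + y)) by ring.
  by have h := ler_wpM2l (ltW u0) mean_xi; exact: h.
have g1 : 1 + t <= expR t by exact: expR_ge1Dx.
have g2 : expR t * (1 - t) <= 1.
  rewrite -[leRHS]expR0 -(subrr t) expRD ler_wpM2l ?expR_ge0//.
  by have := expR_ge1Dx (- t).
have t01 : 0 <= t <= 1 / 2 by rewrite ltW.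
have x0 : 0 <= u * y by rewrite mulr_ge0// ltW.
have x10 : 0 <= u * y1 by rewrite mulr_ge0// ltW.
have main := one_step_square t01 g1 g2 l01 AE BE x0 x10 (rr01 k) r11 w01 hb D0 (erefl K).
have hdev e : e \in free_pairs d E -> deviation (s + t) (e |: E) k ^+ 2 =
   (expR t * u * y - (r + t * l * r1 + w) + expR t * u * xi e) ^+ 2.
  move=> eF; rewrite /deviation /scaled_count degree_count_step// expRD /w /u /eps.
  by congr (_ ^+ 2); field; rewrite Lkn Vn ?fn.
rewrite (eq_avg hdev).
apply: (le_trans (avg_sqr_affine _ _ F0 (erefl m) sqr_xi)).
have -> : expR t * u * y - (r + t * l * r1 + w) + expR t * u * m =
  expR t * (u * y + t * (u * y1 - u * y) + b) - (r + t * l * r1 + w).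
  by rewrite /b; ring.
have g3 : expR t <= 2.
  have : expR t * (1 - 1 / 2) <= expR t * (1 - t) by rewrite ler_wpM2l ?expR_ge0//; lra.
  lra.
have hv : (expR t * u) ^+ 2 * (4 * t * (y1 + y)) <=
   110 * (t * eps) * (1 + A ^+ 2 + B ^+ 2).
  have le_sqr z : z <= (1 + z ^+ 2) / 2 :> R.
    by have := sqr_ge0 (z - 1); rewrite !expr2; lra.
  have xy : u * (y1 + y) <= 3 * (1 + A ^+ 2 + B ^+ 2).
    have h1 : u * y <= (1 + A ^+ 2) / 2 + 1.
      by rewrite AE; apply: lerD; [exact: le_sqr | case/andP: (rr01 k)].
    have h2 : u * y1 <= (1 + B ^+ 2) / 2 + 1.
      rewrite BE; apply: (@le_trans _ _ (l * ((1 + B ^+ 2) / 2 + 1))).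
        apply: ler_wpM2l; first by case/andP: l01.
        by apply: lerD; [exact: le_sqr | case/andP: r11].
      by rewrite ler_piMl; [ | have := sqr_ge0 B; lra | case/andP: l01].
    have := sqr_ge0 A; have := sqr_ge0 B; rewrite mulrDr; lra.
  have e2 : expR t ^+ 2 <= 4.
    have -> : 4 = 2 ^+ 2 :> R by rewrite expr2; lra.
    by rewrite ler_pXn2r ?nnegrE ?expR_ge0.
  have z0 : 0 <= u * (y1 + y) by rewrite mulr_ge0 ?addr_ge0// ltW.
  have -> : (expR t * u) ^+ 2 * (4 * t * (y1 + y)) =
     expR t ^+ 2 * (4 * t * (u * (u * (y1 + y)))) by ring.
  apply: (@le_trans _ _ (4 * (4 * t * (eps * (3 * (1 + A ^+ 2 + B ^+ 2)))))).
    have t4 : 0 <= 4 * t by lra.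
    apply: ler_pM; [exact: sqr_ge0 | | exact: e2 |].
      by apply: mulr_ge0 => //; apply: mulr_ge0 => //; exact: ltW.
    by apply: ler_wpM2l => //; apply: ler_pM => //; exact: ltW.
  have : 0 <= t * eps * (1 + A ^+ 2 + B ^+ 2).
    by rewrite mulr_ge0 ?mulr_ge0 ?addr_ge0 ?sqr_ge0// ltW.
  lra.
have q0 : 0 <= 1 + A ^+ 2 + B ^+ 2 by rewrite !addr_ge0 ?sqr_ge0.
have K0 : 0 <= K by rewrite /K !addr_ge0 ?exprn_ge0// mulr_ge0.
have CE : early_const = 54 * K ^+ 2 + 6 * K + 110 by [].
have hK2 := sqr_ge0 K.
have n1 : 0 <= t ^+ 2 * (1 + A ^+ 2 + B ^+ 2) by rewrite mulr_ge0 ?sqr_ge0.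
have n2 : 0 <= t * eps * (1 + A ^+ 2 + B ^+ 2) by rewrite !mulr_ge0// ltW.
have n3 := mulr_ge0 hK2 n2.
have n4 := mulr_ge0 K0 n2.
rewrite CE -/l.
have := le_trans (lerD main hv) (lexx _).
lra.
Qed.

End OneDegree.

(** The terms with [expR s] come from the variance: a step changes the count
of degree [k] by at most two, and one vertex weighs at most [expR s / #|V|] in
the scaled counts. *)
Lemma discrepancy_step s (al := t / L + t ^+ 2 + t * (expR s / #|V|%:R))
    (be := t ^+ 2 + t * (expR s / #|V|%:R)) (C := 2 * d%:R * early_const) :
  0 <= s -> s <= L ->
  avg d E (fun e => discrepancy (s + t) (e |: E)) <=
  discrepancy s E * (1 + C * al) + C * be.
Proof.
move=> s0 sL; have [t0 _] := clock_tick_bounds.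
have L0 : 0 < L by move: L1; lra.
pose B k := if k is k'.+1 then deviation s E k' else 0.
pose c := early_const.
have c1 : 1 <= c.
  rewrite /c /early_const; set K := 2 + _ + _.
  have K0 : 0 <= K by rewrite /K !addr_ge0 ?exprn_ge0// mulr_ge0.
  by have := sqr_ge0 K; lra.
have D1 : 1 <= d%:R :> R by rewrite ler1n.
have be0 : 0 <= be.
  by rewrite /be addr_ge0 ?sqr_ge0// mulr_ge0 ?divr_ge0 ?expR_ge0// ltW.
have -> : avg d E (fun e => discrepancy (s + t) (e |: E)) =
    \sum_(k < d) avg d E (fun e => deviation (s + t) (e |: E) k ^+ 2).
  rewrite /avg -mulr_suml; congr (_ / _); rewrite exchange_big /=.
  by apply: eq_bigr.
apply: (@le_trans _ _ (\sum_(k < d) ((1 + t / L + c * be) * deviation s E k ^+ 2 +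
    (t / L + c * be) * B k ^+ 2 + c * be))).
  apply: ler_sum => k _; apply: (le_trans (deviation_step s0 sL (ltn_ord k))).
  rewrite -/t -/be -/c -/(B k); lra.
have sB : \sum_(k < d) B k ^+ 2 <= discrepancy s E.
  rewrite /discrepancy; case: (d) => [|d']; first by rewrite !big_ord0.
  rewrite big_ord_recl [leRHS]big_ord_recr /= expr0n /= add0r lerDl.
  exact: sqr_ge0.
have Q0 : 0 <= discrepancy s E by apply: sumr_ge0 => k _; exact: sqr_ge0.
rewrite !big_split /= -!mulr_sumr -/(discrepancy s E) sumr_const card_ord -mulr_natr.
have tL0 : 0 <= t / L by rewrite divr_ge0 ?ltW.
have cb0 : 0 <= c * be by rewrite mulr_ge0//; lra.
have h1 := ler_wpM2l (addr_ge0 tL0 cb0) sB.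
have h2 : t / L * 1 <= t / L * (d%:R * c).
  by apply: ler_wpM2l => //; rewrite -[leLHS]mulr1 ler_pM.
have h3 : c * be * 1 <= c * be * d%:R by rewrite ler_wpM2l.
have h4 := ler_wpM2r Q0 h2; have h5 := ler_wpM2r Q0 h3.
have h6 : 0 <= c * be * d%:R by rewrite mulr_ge0//; lra.
rewrite /C -/c (_ : al = t / L + be); last by rewrite /al /be addrA.
lra.
Qed.

End EarlyStep.

(** * The clock stopped at a cap *)

Section StoppedClock.
Variables (R : realType) (d n : nat) (L cap : R).
Hypotheses (d2 : (2 <= d)%N) (L1 : 1 <= L) (cap0 : 0 <= cap) (capL : cap + 1 <= L).
Hypothesis n0 : (0 < n)%N.
Implicit Types h : seq (graph 'I_n).

Let d0 : (0 < d)%N. Proof. by apply: leq_trans d2. Qed.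
Let L0 : 0 < L. Proof. by move: L1; lra. Qed.
Let n0R : 0 < n%:R :> R. Proof. by rewrite ltr0n. Qed.

(** The clock depends on the history. Its advantage over the number of steps is
that the expected change of the degree counts per unit of it is linear in the
counts. *)
Fixpoint clock h : R :=
  if h is F :: h' then
    if h' is _ :: _ then clock h' + clock_tick R d (cur h') else 0
  else 0.

(** The history at the first step where the clock exceeds [cap], or the whole
history if there is none. *)
Fixpoint stopped h : seq (graph 'I_n) :=
  if h is F :: h' then
    if h' is _ :: _ then (if cap < clock h' then stopped h' else h) else h
  else [::].

Lemma clock_cons F h : reachable d h -> clock (F :: h) = clock h + clock_tick R d (cur h).
Proof. by case: h. Qed.

Lemma stopped_cons F h : reachable d h ->
  stopped (F :: h) = if cap < clock h then stopped h else F :: h.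
Proof. by case: h. Qed.

Lemma clock_tick_ge0 (E : graph 'I_n) : 0 <= clock_tick R d E.
Proof. by rewrite /clock_tick divr_ge0. Qed.

Lemma clock_ge0 h : 0 <= clock h.
Proof.
elim: h => //= F h IH; case: h IH => //= E h IH.
by rewrite addr_ge0// clock_tick_ge0.
Qed.

Lemma reachable_behead F h : reachable d (F :: h) -> h != [::] -> reachable d h.
Proof. by case: h => //= E h /andP[]. Qed.

Lemma stopped_id h : reachable d h -> clock h <= cap -> stopped h = h.
Proof.
case: h => [//|F [//|E h]] /reachable_behead/(_ isT) rh.
rewrite clock_cons// stopped_cons// => hc; rewrite ltNge (le_trans _ hc)//.
by rewrite lerDl clock_tick_ge0.
Qed.

Let large_slack h := 4 * d%:R ^+ 2 <= (slack d (cur h))%:R :> R.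

Lemma large_slack_unsat h : large_slack h -> (4 * d <= #|unsat d (cur h)|)%N.
Proof. by move=> hS; apply: (@unsat_large_nat R). Qed.

Lemma large_slack_behead F h : reachable d (F :: h) -> h != [::] ->
  large_slack (F :: h) -> large_slack h.
Proof.
move=> rh h0; rewrite /large_slack (slack_cons d0 rh h0) natrD /cur /=; lra.
Qed.

Lemma stopped_spec h : reachable d h -> large_slack h ->
  [/\ clock (stopped h) <= cap + 1,
      (slack d (cur h) <= slack d (cur (stopped h)))%N &
      stopped h = h \/ cap < clock (stopped h)].
Proof.
elim: h => [//|F h IH] rF hS.
have [h0|h0] := eqVneq h [::].
  by rewrite h0 /= in rF *; split => //; [move: cap0; lra | left].
have rh := reachable_behead rF h0; have hS' := large_slack_behead rF h0 hS.
have [IH2 IH3 IH4] := IH rh hS'; have sl := slack_cons d0 rF h0.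
rewrite stopped_cons//; case: ltP => hc.
  split=> //; first by apply: leq_trans IH3; rewrite sl leq_addr.
  by case: IH4 => [e|]; right => //; rewrite e.
split => //; last by left.
rewrite clock_cons//; have := clock_tick_le_half R d2 (large_slack_unsat hS').
by move: hc; lra.
Qed.

(** Along a history this quantity grows, at each step, by at least the error terms
of [discrepancy_step]: the squared tick is bounded by the increase of a multiple
of the inverse slack, and the variance term by that of [expR clock]. *)
Definition slack_clock_pot h : R :=
  2 * d%:R ^+ 2 / (slack d (cur h))%:R + expR (clock h) / n%:R.

Let C : R := 2 * d%:R * early_const R d.

(** Dividing by the growth factors and subtracting the accumulated errors turns
[discrepancy] into a supermartingale. *)
Definition early_pot h : R :=
  discrepancy d L (clock h) (cur h) * expR (- (C * (clock h / L + slack_clock_pot h)))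
  - C * slack_clock_pot h.

Lemma early_rate_ge0 : 0 <= C.
Proof.
rewrite /C /early_const; set K := 2 + _ + _.
have K0 : 0 <= K by rewrite /K !addr_ge0 ?exprn_ge0// mulr_ge0.
have := sqr_ge0 K => h; rewrite !mulr_ge0//; lra.
Qed.

Lemma slack_clock_pot_ge0 h : 0 <= slack_clock_pot h.
Proof.
by rewrite /slack_clock_pot addr_ge0 ?divr_ge0 ?expR_ge0 ?mulr_ge0 ?exprn_ge0.
Qed.

Lemma slack_clock_pot_step F h : reachable d (F :: h) -> reachable d h -> large_slack h ->
  slack_clock_pot h + clock_tick R d (cur h) ^+ 2
    + clock_tick R d (cur h) * (expR (clock h) / n%:R) <= slack_clock_pot (F :: h).
Proof.
move=> rF rh hS; have h0 : h != [::] by case: (h) rh.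
have sl := slack_cons d0 rF h0.
have S16 := slack_large d2 hS.
have SU := @slack_le_unsatR R d _ (cur h).
rewrite /slack_clock_pot clock_cons// expRD.
set t := clock_tick R d (cur h).
have -> : (slack d (cur (F :: h)))%:R = (slack d (cur h))%:R - 2 :> R.
  by rewrite sl natrD addrK.
set S : R := (slack d (cur h))%:R in hS S16 SU *.
have t0 : 0 <= t := clock_tick_ge0 _.
have tS : t <= 2 * d%:R / S.
  rewrite ler_pdivlMr; last lra.
  rewrite /t /clock_tick mulrAC ler_pdivrMr; last first.
    by rewrite ltr0n; apply: leq_trans (large_slack_unsat hS); rewrite muln_gt0.
  lra.
have t2S : t ^+ 2 <= (2 * d%:R / S) ^+ 2.
  by rewrite ler_pXn2r ?nnegrE// divr_ge0 ?mulr_ge0//; lra.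
have e1 : (2 * d%:R / S) ^+ 2 + 2 * d%:R ^+ 2 / S <= 2 * d%:R ^+ 2 / (S - 2).
  rewrite -subr_ge0.
  have -> : 2 * d%:R ^+ 2 / (S - 2) - ((2 * d%:R / S) ^+ 2 + 2 * d%:R ^+ 2 / S) =
     8 * d%:R ^+ 2 / (S ^+ 2 * (S - 2)).
    by field; rewrite !gt_eqF//; lra.
  by rewrite divr_ge0 ?mulr_ge0 ?exprn_ge0//; lra.
set eps := expR (clock h) / n%:R.
have eps0 : 0 <= eps by rewrite divr_ge0 ?expR_ge0.
have e2 : (1 + t) * eps <= expR (clock h) * expR t / n%:R.
  rewrite mulrAC -/eps mulrC ler_wpM2l//; exact: expR_ge1Dx.
lra.
Qed.

Lemma early_pot_step h : reachable d h -> large_slack h -> clock h <= L ->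
  cond_exp d early_pot h <= early_pot h.
Proof.
move=> rh hS hc; have S16 := slack_large d2 hS.
have hdd : (d * d < slack d (cur h))%N.
  rewrite -(ltr_nat R); apply: lt_le_trans hS.
  have : 0 < d%:R ^+ 2 :> R by rewrite exprn_gt0// ltr0n.
  by rewrite natrM expr2; lra.
have F0 := free_pairs_neq0 d0 hdd.
pose t := clock_tick R d (cur h).
pose be := t ^+ 2 + t * (expR (clock h) / n%:R).
pose b' := slack_clock_pot h + be.
pose a := clock h / L + slack_clock_pot h.
pose al := t / L + be.
have t0 : 0 <= t := clock_tick_ge0 _.
have be0 : 0 <= be.
  by rewrite /be addr_ge0 ?sqr_ge0// mulr_ge0// divr_ge0 ?expR_ge0.
have Cg0 := early_rate_ge0.
apply: (@le_trans _ _ (cond_exp d (fun h' => expR (- (C * (a + al))) *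
    discrepancy d L (clock h + t) (cur h') + -1 * (C * b')) h)).
  apply: cond_exp_le => // F rF; rewrite /early_pot.
  have hb := slack_clock_pot_step rF rh hS; rewrite -/t -addrA -/be -/b' in hb.
  rewrite clock_cons// -/t mulN1r; apply: lerB; last by rewrite ler_wpM2l.
  rewrite mulrC ler_wpM2r//; first by apply: sumr_ge0 => k _; exact: sqr_ge0.
  rewrite ler_expR lerN2 ler_wpM2l// /a /al mulrDl.
  by rewrite /b' in hb; lra.
rewrite cond_exp_avg// avgD avg_cst// avgZ /=.
have hD := discrepancy_step d2 L1 (large_slack_unsat hS) (clock_ge0 h) hc.
rewrite card_ord -/t -addrA -/be -/C in hD.
rewrite /early_pot -/a mulN1r.
set Q := discrepancy d L (clock h) (cur h) in hD *.
set Q' := avg _ _ _ in hD *.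
have Q0 : 0 <= Q by apply: sumr_ge0 => k _; exact: sqr_ge0.
have h1 : expR (- (C * (a + al))) * Q' <= expR (- (C * (a + al))) * (Q * (1 + C * al) + C * be).
  by rewrite ler_wpM2l// expR_ge0.
have al0 : 0 <= al by rewrite /al addr_ge0// divr_ge0// ltW.
have h2 : expR (- (C * (a + al))) * (Q * (1 + C * al)) <= Q * expR (- (C * a)).
  rewrite mulrCA ler_wpM2l//.
  have -> : - (C * (a + al)) = - (C * a) + - (C * al) by ring.
  rewrite expRD -mulrA ler_piMr ?expR_ge0//.
  rewrite -[leRHS](_ : expR (- (C * al)) * expR (C * al) = 1); last first.
    by rewrite -expRD addNr expR0.
  by rewrite ler_wpM2l ?expR_ge0// expR_ge1Dx.
have h3 : expR (- (C * (a + al))) * (C * be) <= C * be.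
  apply: ler_piMl; first exact: mulr_ge0.
  rewrite expR_le1 oppr_le0; apply: mulr_ge0 => //; apply: addr_ge0 => //.
  apply: addr_ge0; last exact: slack_clock_pot_ge0.
  by rewrite divr_ge0 ?clock_ge0// ltW.
rewrite /b'; lra.
Qed.

Lemma early_pot_init : early_pot [:: finset.set0] <= 0.
Proof.
have -> : early_pot [:: finset.set0] = - (C * slack_clock_pot [:: finset.set0]).
  rewrite /early_pot (_ : discrepancy _ _ _ _ = 0) ?mul0r ?sub0r//.
  rewrite /discrepancy big1// => k _; rewrite /deviation /scaled_count /=.
  have -> : degree_count (cur [:: finset.set0 : graph 'I_n]) k = (if k == 0%N :> nat then n else 0)%N.
    rewrite /degree_count; case: ifP => [/eqP ->|k0].
      rewrite -[RHS](card_ord n); apply: eq_card => v; rewrite inE /cur /= degree_set0//.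
    by apply: eq_card0 => v; rewrite inE /cur /= degree_set0 eq_sym k0.
  case: ifP => [/eqP ->|k0].
    by rewrite card_ord expR0 !expr0 fact0 mulr1 mul1r divff ?gt_eqF// divr1 subrr expr0n.
  by rewrite mul0r expr0n k0 !mul0r mulr0 mul0r subrr expr0n.
by rewrite oppr_le0 mulr_ge0 ?early_rate_ge0 ?slack_clock_pot_ge0.
Qed.

Variable m : nat.
Hypothesis mS : 4 * d%:R ^+ 2 <= slack_at R d n m.

Let side : (d * d + 2 * m < slack d (cur [:: finset.set0 : graph 'I_n]) + 2)%N.
Proof.
by apply: (@steps_below_slack R d n d2); [rewrite /= eqxx | exact: mS].
Qed.

Lemma exp_early_pot : exp_after d m (early_pot \o stopped) [:: finset.set0] <= 0.
Proof.
have r0 : reachable d [:: finset.set0 : graph 'I_n] by rewrite /= eqxx.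
apply: le_trans early_pot_init.
rewrite -[leRHS]addr0.
have <- : \sum_(k < m) exp_after d k (fun=> 0 : R) [:: finset.set0 : graph 'I_n] = 0.
  apply: big1 => k _; apply: (exp_after_cst _ d0 r0).
  exact: (steps_le (ltnW (ltn_ord k)) side).
apply: exp_after_drift => // h rh /= sh; rewrite addr0.
have hS : large_slack h.
  rewrite /large_slack (reachable_slack_at R d2 rh).
  apply: (le_trans mS); apply: slack_at_le.
  by case: (size h) sh => [|k] /andP[_]; rewrite add1n ltnS // => /ltnW.
have hdd : (d * d < slack d (cur h))%N.
  by apply: (dd_lt_slack (R := R) d2 rh); rewrite -reachable_slack_at.
have [hc|hc] := leP (clock h) cap.
  rewrite stopped_id//; apply: le_trans (_ : _ <= cond_exp d early_pot h) _; last first.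
    by apply: early_pot_step => //; move: capL; lra.
  apply: cond_exp_le => // F rF /=.
  by have := stopped_cons F rh; rewrite /= ltNge hc /= => ->.
rewrite -[leRHS](@cond_exp_cst R d 'I_n _ h)//.
apply: cond_exp_le => // F rF /=.
by have := stopped_cons F rh; rewrite /= hc => ->.
Qed.

(** Markov's inequality, since [early_pot] starts at a nonpositive value and its
expectation at the stopped history does not increase. *)
Lemma discrepancy_large_prob (e : R)
    (b := 2 * d%:R ^+ 2 / slack_at R d n m + expR (cap + 1) / n%:R) : 0 < e ->
  exp_after d m (fun h => (e < discrepancy d L (clock (stopped h)) (cur (stopped h)))%R%:R)
    [:: finset.set0] <= C * b * expR (C * (1 + b)) / e.
Proof.
move=> e0; have r0 : reachable d [:: finset.set0 : graph 'I_n] by rewrite /= eqxx.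
pose g := e * expR (- (C * (1 + b))).
have Cg0 := early_rate_ge0.
have g0 : 0 < g by rewrite mulr_gt0// expR_gt0.
have pt h : reachable d h -> size h = (1 + m)%N ->
  g * (e < discrepancy d L (clock (stopped h)) (cur (stopped h)))%R%:R - C * b
    <= early_pot (stopped h).
  move=> rh sh.
  have hS : large_slack h.
    by rewrite /large_slack (reachable_slack_at R d2 rh) sh.
  have [cs ss _] := stopped_spec rh hS.
  have hb : slack_clock_pot (stopped h) <= b.
    rewrite /slack_clock_pot /b; apply: lerD; last first.
      by rewrite ler_wpM2r ?invr_ge0// ler_expR.
    have S16 := slack_large d2 hS.
    rewrite ler_wpM2l ?mulr_ge0 ?exprn_ge0//.
    have hm : (slack d (cur h))%:R = slack_at R d n m.
      by rewrite (reachable_slack_at R d2 rh) sh.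
    have sR : (slack d (cur h))%:R <= (slack d (cur (stopped h)))%:R :> R by rewrite ler_nat.
    by rewrite lef_pV2 ?posrE -?hm//; lra.
  have b0 := slack_clock_pot_ge0 (stopped h).
  have ha : clock (stopped h) / L + slack_clock_pot (stopped h) <= 1 + b.
    by apply: lerD => //; rewrite ler_pdivrMr// mul1r; move: capL; lra.
  have he : expR (- (C * (1 + b))) <=
      expR (- (C * (clock (stopped h) / L + slack_clock_pot (stopped h)))).
    by rewrite ler_expR lerN2 ler_wpM2l.
  rewrite /early_pot; apply: lerB; last by rewrite ler_wpM2l.
  set Q := discrepancy _ _ _ _.
  have Q0 : 0 <= Q by apply: sumr_ge0 => k _; exact: sqr_ge0.
  case: ltP => hQ; last by rewrite mulr0 mulr_ge0// expR_ge0.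
  by rewrite mulr1 /g ler_pM ?expR_ge0// ltW.
have := exp_early_pot.
have h1 : exp_after d m (fun h =>
   g * (e < discrepancy d L (clock (stopped h)) (cur (stopped h)))%R%:R + - (C * b))
   [:: finset.set0] <= exp_after d m (early_pot \o stopped) [:: finset.set0].
  by apply: exp_after_le => // h rh sh; exact: pt.
move=> h2; have {h1 h2} := le_trans h1 h2.
rewrite exp_afterD exp_afterZ exp_after_cst// subr_le0 => h.
rewrite ler_pdivlMr//.
set p := exp_after _ _ _ _ in h *.
have e1 : expR (- (C * (1 + b))) * expR (C * (1 + b)) = 1.
  by rewrite -expRD addNr expR0.
have := ler_wpM2r (expR_ge0 (C * (1 + b))) h.
rewrite /g; have -> : e * expR (- (C * (1 + b))) * p * expR (C * (1 + b)) =
  p * e * (expR (- (C * (1 + b))) * expR (C * (1 + b))) by ring.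
by rewrite e1 mulr1.
Qed.

End StoppedClock.

(** * Degree profiles *)

Section DegreeProfile.
Variables (R : realType) (d : nat) (V : finType) (L : R).
Hypotheses (d2 : (2 <= d)%N) (L1 : 1 <= L).
Implicit Types E : graph V.

Let d0 : (0 < d)%N. Proof. by apply: leq_trans d2. Qed.
Let L0 : 0 < L. Proof. by move: L1; lra. Qed.

Lemma sum_over_degrees E (f : nat -> R) : (forall k, (d <= k)%N -> f k = 0) ->
  \sum_v f (degree E v) = \sum_(k < d) f k * (degree_count E k)%:R.
Proof.
move=> f0.
transitivity (\sum_v \sum_(k < d) f k * (degree E v == k)%:R).
  apply: eq_bigr => v _; have [dv|dv] := ltnP (degree E v) d.
    rewrite (bigD1 (Ordinal dv))//= eqxx mulr1 big1 ?addr0// => k.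
    by rewrite -val_eqE /= eq_sym => /negbTE ->; rewrite mulr0.
  rewrite f0// big1// => k _; case: eqP => [e|_]; last by rewrite mulr0.
  by have := ltn_ord k; rewrite -e ltnNge dv.
rewrite exchange_big /=; apply: eq_bigr => k _; rewrite -mulr_sumr; congr (_ * _).
rewrite /degree_count -sumr_const [RHS]big_mkcond; apply: eq_bigr => v _.
by rewrite inE; case: eqP.
Qed.

(** Up to the relative error [eps], the count of degree [k] is proportional to the
probability that a Poisson variable of mean [L] equals [k]. *)
Definition profile (eps A : R) E : Prop :=
  forall k, (k < d)%N ->
    `|(degree_count E k)%:R - A * L ^+ k / k`!%:R| <= eps * (A * L ^+ k).

Variables (eps A : R) (E : graph V).
Hypotheses (eps1 : eps <= 1) (A0 : 0 < A) (hE : profile eps A E).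

Lemma profile_le k : (k < d)%N -> (degree_count E k)%:R <= 2 * (A * L ^+ k).
Proof.
move=> kd; have := hE kd; rewrite ler_norml => /andP[_ h].
have Lk : 0 < A * L ^+ k by rewrite mulr_gt0 ?exprn_gt0.
have f1 : (k`!%:R^-1 : R) <= 1 by rewrite invf_le1 ?ler1n ?ltr0n ?fact_gt0.
have := ler_wpM2l (ltW Lk) f1.
have := ler_wpM2r (ltW Lk) eps1.
lra.
Qed.

(** The numbers of vertices of successive degrees grow by factors of order
[L], so a combination of them is governed by its highest degree. *)
Lemma profile_leading (f : nat -> R) j (B : R) : (j < d)%N -> f j = 1 ->
  (forall k, (j < k)%N -> f k = 0) -> (forall k, (k < j)%N -> 0 <= f k <= B) ->
  0 <= B ->
  `|\sum_(k < d) f k * (degree_count E k)%:R - A * L ^+ j / j`!%:R|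
  <= (eps + 2 * d%:R * B / L) * (A * L ^+ j).
Proof.
move=> jd fj fhigh flow B0.
have AL k : 0 < A * L ^+ k by rewrite mulr_gt0 ?exprn_gt0.
rewrite (bigD1 (Ordinal jd))//= fj mul1r.
set Z := \sum_(_ | _) _.
have Z0 : 0 <= Z <= 2 * d%:R * B / L * (A * L ^+ j).
  apply/andP; split.
    apply: sumr_ge0 => k kj; rewrite mulr_ge0//.
    have [h|h] := ltnP j k; first by rewrite fhigh.
    have kj' : (k < j)%N by rewrite ltn_neqAle h andbT -val_eqE in kj *.
    by case/andP: (flow _ kj').
  apply: (@le_trans _ _ (\sum_(k < d | k != Ordinal jd) 2 * B / L * (A * L ^+ j))).
    apply: ler_sum => k kj.
    have c0 : 0 <= 2 * B / L * (A * L ^+ j).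
      by rewrite mulr_ge0 ?divr_ge0 ?mulr_ge0// ltW// exprn_gt0.
    have [h|h] := ltnP j k; first by rewrite fhigh// mul0r.
    have kj' : (k < j)%N by rewrite ltn_neqAle h andbT -val_eqE in kj *.
    have /andP[f0 f1] := flow _ kj'.
    apply: (@le_trans _ _ (B * (2 * (A * L ^+ k)))).
      by apply: ler_pM => //; exact: profile_le.
    have -> : 2 * B / L * (A * L ^+ j) = B * (2 * (A * L ^+ j.-1)).
      by rewrite -(prednK (leq_ltn_trans (leq0n k) kj')) exprS; field; rewrite gt_eqF.
    rewrite ler_wpM2l// ler_pM2l// ler_pM2l// ler_weXn2l//.
    by rewrite -ltnS prednK// (leq_ltn_trans (leq0n k) kj').
  rewrite sumr_const -[leLHS]mulr_natr.
  have -> : 2 * d%:R * B / L * (A * L ^+ j) = 2 * B / L * (A * L ^+ j) * d%:R by ring.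
  rewrite ler_wpM2l//; first by rewrite mulr_ge0 ?divr_ge0 ?mulr_ge0// ltW// exprn_gt0.
  by rewrite ler_nat -[leqRHS](card_ord d) max_card.
have := hE jd; rewrite !ler_norml => /andP[h1 h2]; case/andP: Z0 => z1 z2.
by rewrite mulrDl; apply/andP; split; lra.
Qed.

Let Y k : R := (degree_count E k)%:R.

Lemma profile_count_le l : (l < d)%N ->
  `|(count_le E l)%:R - A * L ^+ l / l`!%:R| <= (eps + 2 * d%:R / L) * (A * L ^+ l).
Proof.
move=> ld; have -> : (count_le E l)%:R = \sum_(k < d) (k <= l)%N%:R * Y k.
  rewrite -(sum_over_degrees E (f := fun k => (k <= l)%N%:R)); last first.
    by move=> k dk; rewrite leqNgt (leq_trans ld dk).
  rewrite /count_le -sumr_const big_mkcond; apply: eq_bigr => v _.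
  by rewrite inE; case: leqP.
rewrite -[2 * d%:R]mulr1.
apply: (profile_leading (f := fun k => (k <= l)%N%:R)) => //.
- by rewrite leqnn.
- by move=> k lk; rewrite leqNgt lk.
- by move=> k kl; rewrite (ltnW kl) ler01 lexx.
Qed.

Lemma profile_slack :
  `|(slack d E)%:R - A * L ^+ d.-1 / d.-1`!%:R|
  <= (eps + 2 * d%:R * d%:R / L) * (A * L ^+ d.-1).
Proof.
have -> : (slack d E)%:R = \sum_(k < d) (d - k)%:R * Y k.
  rewrite -(sum_over_degrees E (f := fun k => (d - k)%:R)); last first.
    by move=> k; rewrite -subn_eq0 => /eqP ->.
  by rewrite /slack natr_sum.
apply: (profile_leading (f := fun k => (d - k)%:R)) => //.
- by rewrite prednK.
- by rewrite -[X in (X - _)%N](prednK d0) subSnn.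
- by move=> k; rewrite prednK// -subn_eq0 => /eqP ->.
- by move=> k _; rewrite ler0n ler_nat leq_subr.
Qed.

Lemma profile_low_weight l : (l < d)%N ->
  low_weight L l E <= 2 * d%:R * (A * L ^+ l).
Proof.
move=> ld; rewrite /low_weight sum_over_degrees; last first.
  by move=> k dk; rewrite /low_term leqNgt (leq_trans ld dk).
apply: (@le_trans _ _ (\sum_(k < d) 2 * (A * L ^+ l))); last first.
  by rewrite sumr_const card_ord -[leLHS]mulr_natr; lra.
apply: ler_sum => k _; rewrite /low_term.
have AL j : 0 < A * L ^+ j by rewrite mulr_gt0 ?exprn_gt0.
case: leqP => kl; last by rewrite mul0r mulr_ge0// ltW.
apply: (@le_trans _ _ (L ^+ (l - k) * (2 * (A * L ^+ k)))).
  by apply: ler_wpM2l; [rewrite exprn_ge0// ltW | exact: profile_le].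
by rewrite -[X in _ <= _ * (_ * L ^+ X)](subnK kl) exprD; lra.
Qed.

End DegreeProfile.

Section ForecastLimit.
Variable R : realType.

(** Both [1 - q <= expR (- q)] and [expR (- (q / (1 - q))) <= 1 - q] hold, and the
exponential is Lipschitz on the negative half-line. *)
Lemma pow_near_expR (q x D : R) (M : nat) : 0 <= q -> q <= D -> D <= 1 / 10 -> 0 <= x ->
  (1 - D) / (1 + D) * x <= q * M%:R -> q * M%:R <= (1 + D) * (1 + D) / (1 - D) * x ->
  `|(1 - q) ^+ M - expR (- x)| <= 6 * D * x.
Proof.
move=> q0 qD D1 x0 h1 h2.
have D0 : 0 <= D := le_trans q0 qD.
have lo : expR (- (q * M%:R / (1 - q))) <= (1 - q) ^+ M.
  have -> : - (q * M%:R / (1 - q)) = M%:R * - (q / (1 - q)) by ring.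
  rewrite expRM_natl lerXn2r ?nnegrE ?expR_ge0//; first lra.
  rewrite expRN -[leRHS]invrK lef_pV2 ?posrE ?expR_gt0 ?invr_gt0//; last lra.
  apply: le_trans (expR_ge1Dx _).
  rewrite le_eqVlt; apply/orP; left; apply/eqP; field.
  by rewrite gt_eqF//; lra.
have hi : (1 - q) ^+ M <= expR (- (q * M%:R)).
  rewrite (_ : - (q * M%:R) = M%:R * - q); last by ring.
  rewrite expRM_natl; apply: lerXn2r; rewrite ?nnegrE ?expR_ge0//; first lra.
  exact: expR_ge1Dx.
have expR_lip (a b : R) : 0 <= a -> a <= b -> expR (- a) - expR (- b) <= b - a.
  move=> a0 ab.
  have -> : expR (- b) = expR (- a) * expR (- (b - a)) by rewrite -expRD; congr expR; ring.
  have e1 : expR (- a) <= 1 by rewrite expR_le1 oppr_le0.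
  have e2 := expR_ge1Dx (- (b - a)).
  have := expR_ge0 (- a).
  have : expR (- a) * (1 - expR (- (b - a))) <= 1 * (b - a).
    apply: ler_pM; rewrite ?expR_ge0//.
      by rewrite subr_ge0 expR_le1 oppr_le0 subr_ge0.
    lra.
  lra.
have qM0 : 0 <= q * M%:R by rewrite mulr_ge0.
have up : q * M%:R / (1 - q) <= x + 6 * D * x.
  rewrite ler_pdivrMr; last lra.
  apply: (le_trans h2).
  have -> : (1 + D) * (1 + D) / (1 - D) * x = ((1 + D) * (1 + D) * x) / (1 - D) by ring.
  rewrite ler_pdivrMr; last lra.
  have : (x + 6 * D * x) * (1 - D) * (1 - D) <= (x + 6 * D * x) * (1 - q) * (1 - D).
    rewrite ler_wpM2r//; first lra.
    by rewrite ler_wpM2l ?addr_ge0 ?mulr_ge0//; lra.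
  apply: le_trans.
  have : 0 <= (D * x) * (2 - 12 * D + 6 * D * D).
    apply: mulr_ge0; first exact: mulr_ge0.
    have : 0 <= D * D by exact: mulr_ge0.
    lra.
  lra.
have dn : x - 2 * D * x <= q * M%:R.
  apply: le_trans h1; rewrite [leRHS]mulrAC ler_pdivlMr; last lra.
  have : 0 <= D * D * x by rewrite !mulr_ge0.
  lra.
have Dx : 0 <= D * x by exact: mulr_ge0.
have x2 : 0 <= x - 2 * D * x.
  have : D * x <= 1 / 10 * x by rewrite ler_wpM2r.
  lra.
rewrite ler_norml; apply/andP; split.
  have := expR_lip x (x + 6 * D * x) x0.
  have : expR (- (x + 6 * D * x)) <= expR (- (q * M%:R / (1 - q))).
    by rewrite ler_expR lerN2.
  by move=> g1 g2; have := g2 _; lra.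
have := expR_lip (x - 2 * D * x) x x2.
have : expR (- (q * M%:R)) <= expR (- (x - 2 * D * x)) by rewrite ler_expR lerN2.
by move=> g1 g2; have := g2 _; lra.
Qed.

End ForecastLimit.

(** * The profile when few free places remain *)

Lemma leq_fact m n : (m <= n)%N -> (m`! <= n`!)%N.
Proof.
move=> /subnK <-; elim: (n - m)%N => // k IH.
by rewrite addSn factS; apply: (leq_trans IH); rewrite leq_pmull.
Qed.

Section ProfileAtWindow.
Variables (R : realType) (d n : nat) (L : R).
Hypotheses (d2 : (2 <= d)%N) (nL : expR L = n%:R) (L2 : 2 * d%:R ^+ 2 <= L).
Hypothesis lnL1 : 1 <= ln L.
Let cap := L - ln L.
Implicit Types h : seq (graph 'I_n).

Let d0 : (0 < d)%N. Proof. by apply: leq_trans d2. Qed.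
Let D2 : 2 <= d%:R :> R. Proof. by rewrite ler_nat. Qed.
Let DD : 4 <= d%:R ^+ 2 :> R.
Proof. by have := ler_pM (ler0n _ _) (ler0n _ _) D2 D2; rewrite expr2; lra. Qed.
Let L8 : 8 <= L. Proof. by move: L2 DD; lra. Qed.
Let n0 : (0 < n)%N.
Proof. by rewrite -(ltr_nat R) -nL expR_gt0. Qed.
Let n0R : 0 < n%:R :> R. Proof. by rewrite ltr0n. Qed.

Lemma large_power k : (0 < k)%N -> 4 * d%:R ^+ 2 <= L ^+ k.+1.
Proof.
move=> k0; apply: (@le_trans _ _ (L ^+ 2)).
  have : 2 * d%:R ^+ 2 * L <= L * L by rewrite ler_wpM2r//; move: L8; lra.
  have : d%:R ^+ 2 * 8 <= d%:R ^+ 2 * L by rewrite ler_wpM2l//; move: DD; lra.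
  by move: DD; rewrite (expr2 L); lra.
by apply: ler_weXn2l => //; move: L8; lra.
Qed.

Lemma degree_count0_slack (E : graph 'I_n) : (degree_count E 0 <= slack d E)%N.
Proof.
rewrite /slack /degree_count -sum1_card big_mkcond; apply: leq_sum => v _.
by rewrite inE; case: eqP => // ->; lia.
Qed.

(** With a small discrepancy the slack is about
[n%:R * expR (- s) * L ^+ d.-1 / d.-1`!] at clock time [s]. At time [cap] this is
less than [L ^+ d.+1], so the clock has not been stopped; and since the slack is
of order [L ^+ d.+1] only, [s] must be [L] up to a multiple of [ln L], which
makes [(s / L) ^+ k] nearly one. *)
Lemma stopped_profile m h (e : R) :
  reachable d h -> size h = m.+1 ->
  L ^+ d.+1 < slack_at R d n m -> slack_at R d n m <= L ^+ d.+1 + 2 ->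
  0 <= e <= 1 / 2 ->
  discrepancy d L (clock R d (stopped d cap h)) (cur (stopped d cap h)) <= e ^+ 2 ->
  exists2 A, 0 < A & profile d L (e + d%:R * (ln (4 * L ^+ d.+1) / L)) A (cur h).
Proof.
move=> rh sh S1 S2 /andP[e0 e1] hQ.
have L0 : 0 < L by move: L8; lra.
have hL1 : 1 <= L by move: L8; lra.
have lnLL : ln L < L by apply: ln_sublinear.
have cap0 : 0 <= cap by rewrite /cap; lra.
have capL : cap + 1 <= L by rewrite /cap; move: lnL1; lra.
have sE : (slack d (cur h))%:R = slack_at R d n m.
  by rewrite (reachable_slack_at R d2 rh) sh.
have hS : 4 * d%:R ^+ 2 <= (slack d (cur h))%:R :> R.
  by rewrite sE; apply: le_trans (ltW S1); apply: large_power.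
have [cs ss alt] := stopped_spec d2 cap0 rh hS.
set h0 := stopped d cap h in hQ cs ss alt.
set s := clock R d h0 in hQ cs alt.
have s0 : 0 <= s := clock_ge0 _ _ _.
set r := s / L.
have r01 : 0 <= r <= 1.
  by apply/andP; split; [rewrite divr_ge0// ltW | rewrite ler_pdivrMr// mul1r; lra].
have fact1 j : 0 < (j`!%:R^-1 : R) <= 1.
  by rewrite invr_gt0 ltr0n fact_gt0 invf_le1 ?ltr0n ?fact_gt0// ler1n fact_gt0.
pose x k := scaled_count L s (cur h0) k.
have hx k : (k < d)%N -> `|x k - r ^+ k / k`!%:R| <= e.
  move=> kd; rewrite -(@ler_pXn2r _ 2)// ?nnegrE//.
  rewrite -normrX ger0_norm ?sqr_ge0//; apply: le_trans hQ.
  rewrite /discrepancy (bigD1 (Ordinal kd))//= lerDl.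
  by apply: sumr_ge0 => j _; exact: sqr_ge0.
have r1 k : 0 <= r ^+ k <= 1.
  by case/andP: r01 => a b; rewrite exprn_ge0// exprn_ile1.
have x2 k : (k < d)%N -> x k <= 2.
  move=> /hx; rewrite ler_norml => /andP[_ hk].
  have /andP[f0 f1] := fact1 k; have /andP[a b] := r1 k.
  have : r ^+ k / k`!%:R <= 1 * 1 by apply: ler_pM => //; exact: ltW.
  lra.
pose A := n%:R * expR (- s).
have A0 : 0 < A by rewrite mulr_gt0// expR_gt0.
have es : expR s * expR (- s) = 1 by rewrite -expRD subrr expR0.
have Lk k : 0 < L ^+ k by rewrite exprn_gt0.
have Yx k : (degree_count (cur h0) k)%:R = x k * (A * L ^+ k).
  rewrite /x /scaled_count /A card_ord; set Y := _%:R.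
  have -> : expR s * Y / (n%:R * L ^+ k) * (n%:R * expR (- s) * L ^+ k) =
     (expR s * expR (- s)) * Y.
    by field; rewrite !gt_eqF.
  by rewrite es mul1r.
(* a stopped clock would force a slack below [L ^+ d.+1] *)
have h0h : h0 = h.
  case: alt => // hc; exfalso.
  have : (slack d (cur h0))%:R <= 2 * d%:R ^+ 2 * L ^+ d.
    rewrite /slack natr_sum (@sum_over_degrees R d 'I_n (cur h0) (fun k => (d - k)%:R)).
      2: by move=> k; rewrite -subn_eq0 => /eqP ->.
    have AL : A <= L.
      have -> : L = n%:R * expR (- cap).
        rewrite -nL -expRD /cap -[LHS]lnK ?posrE//; congr expR; ring.
      by rewrite /A ler_pM2l// ler_expR lerN2 ltW.
    apply: (@le_trans _ _ (\sum_(k < d) d%:R * (2 * L ^+ d))).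
      apply: ler_sum => k _; apply: ler_pM => //; first by rewrite ler_nat leq_subr.
      rewrite Yx; apply: ler_pM; rewrite ?x2//.
      - by rewrite /x /scaled_count divr_ge0 ?mulr_ge0 ?expR_ge0 ?exprn_ge0// ltW.
      - by rewrite mulr_ge0// ltW.
      rewrite -[in leRHS](prednK d0) exprS; apply: ler_pM => //; first exact: ltW.
        exact: ltW.
      by apply: ler_weXn2l => //; rewrite -ltnS prednK.
    by rewrite sumr_const card_ord -[leLHS]mulr_natr expr2; lra.
  have hh : (slack d (cur h))%:R <= (slack d (cur h0))%:R :> R by rewrite ler_nat.
  have : 2 * d%:R ^+ 2 * L ^+ d <= L * L ^+ d by rewrite ler_wpM2r// ltW.
  by rewrite sE in hh; move: S1; rewrite exprS; lra.
exists A => // k kd; rewrite -h0h Yx.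
have lam0 : 0 <= ln (4 * L ^+ d.+1).
  by rewrite ln_ge0//; have := exprn_ege1 d.+1 hL1; lra.
have Lr : 1 - r <= ln (4 * L ^+ d.+1) / L.
  rewrite ler_pdivlMr// mulrBl mul1r /r divfK ?gt_eqF//.
  rewrite -(ler_expR (L - s)) lnK ?posrE ?mulr_gt0//.
  have y0 : A / 2 <= (slack d (cur h))%:R.
    apply: (@le_trans _ _ (degree_count (cur h) 0)%:R); last first.
      by rewrite ler_nat degree_count0_slack.
    rewrite -h0h Yx expr0 mulr1 mulrC ler_wpM2r//; first exact: ltW.
    by have := hx 0%N d0; rewrite expr0 fact0 divr1 ler_norml => /andP[]; lra.
  have e2 : expR (L - s) = A by rewrite /A -nL -expRD.
  rewrite e2; have := large_power d0; move: DD y0 S2; rewrite sE.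
  by have := exprn_ege1 d.+1 hL1; lra.
have dr : 1 - r ^+ k <= d%:R * (1 - r).
  apply: (@le_trans _ _ (k%:R * (1 - r))); last first.
    by rewrite ler_wpM2r ?ler_nat 1?ltnW//; case/andP: r01; lra.
  elim: (k) => [|j IH]; first by rewrite expr0 mul0r subrr.
  rewrite exprS -natr1; case/andP: r01 => a b; have /andP[c f] := r1 j.
  have : r * (1 - r ^+ j) <= 1 * (1 - r ^+ j) by rewrite ler_wpM2r//; lra.
  lra.
have -> : x k * (A * L ^+ k) - A * L ^+ k / k`!%:R =
  (A * L ^+ k) * ((x k - r ^+ k / k`!%:R) - (1 - r ^+ k) / k`!%:R) by ring.
have ALk : 0 < A * L ^+ k by rewrite mulr_gt0.
rewrite normrM (gtr0_norm ALk) mulrC ler_wpM2r ?(ltW ALk)//.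
apply: (le_trans (ler_normB _ _)); apply: lerD; first exact: hx.
have /andP[f0 f1] := fact1 k; have /andP[a b] := r1 k.
rewrite ger0_norm; last by rewrite mulr_ge0 ?subr_ge0// ltW.
apply: (@le_trans _ _ (1 - r ^+ k)); first by rewrite ler_piMr// subr_ge0.
by apply: (le_trans dr); rewrite ler_wpM2l.
Qed.

End ProfileAtWindow.

Section ForecastAtProfile.
Variables (R : realType) (d n : nat) (L : R).
Hypotheses (d2 : (2 <= d)%N) (L1 : 1 <= L).
Variables (x : 'I_d.-1 -> R) (x0 : forall l, 0 < x l).

Let d0 : (0 < d)%N. Proof. by apply: leq_trans d2. Qed.
Let L0 : 0 < L. Proof. by move: L1; lra. Qed.

(** For a profile, the vertices of degree at most [l] are a proportion
[d.-1`! / (l`! * L ^+ (d.-1 - l))] of the slack; so if they survive in proportion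
to the slack, [x l] of them are left on average at this slack. *)
Definition target_slack (l : 'I_d.-1) : R :=
  x l * l`!%:R * L ^+ (d.-1 - l) / d.-1`!%:R.

Variables (h : seq (graph 'I_n)) (eps A D : R) (tl : 'I_d.-1 -> nat).
Let S := slack_at R d n (size h).-1.
Hypotheses (rh : reachable d h) (A0 : 0 < A) (eps1 : eps <= 1).
Hypothesis hE : profile d L eps A (cur h).
Hypothesis hD : d.-1`!%:R * (eps + 2 * d%:R * d%:R / L) <= D.
Hypothesis D1 : D <= 1 / 10.
Let s0 := A * L ^+ d.-1 / d.-1`!%:R.

Let f0 k : 0 < k`!%:R :> R. Proof. by rewrite ltr0n fact_gt0. Qed.

Lemma slack_near : (1 - D) * s0 <= S /\ S <= (1 + D) * s0 /\ 0 < s0.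
Proof.
have s00 : 0 < s0 by rewrite divr_gt0 ?mulr_gt0 ?exprn_gt0.
have := profile_slack d2 L1 eps1 A0 hE.
rewrite (reachable_slack_at R d2 rh) -/S -/s0.
have -> : A * L ^+ d.-1 = d.-1`!%:R * s0 by rewrite /s0; field; rewrite gt_eqF.
rewrite mulrA ler_norml => /andP[h1 h2].
have : (eps + 2 * d%:R * d%:R / L) * d.-1`!%:R * s0 <= D * s0.
  by rewrite ler_wpM2r ?(ltW s00)// mulrC.
by split; [lra | split; [lra|]].
Qed.

Lemma count_near (l : 'I_d.-1) (m0 := A * L ^+ l / l`!%:R) :
  (1 - D) * m0 <= (count_le (cur h) l)%:R <= (1 + D) * m0.
Proof.
have ld : (l < d)%N by apply: leq_trans (ltn_ord l) (leq_pred d).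
have m00 : 0 < m0 by rewrite divr_gt0 ?mulr_gt0 ?exprn_gt0.
have h0 := profile_count_le L1 eps1 A0 hE ld; move: h0; rewrite -/m0.
have -> : A * L ^+ l = l`!%:R * m0 by rewrite /m0; field; rewrite gt_eqF.
rewrite mulrA ler_norml => /andP[h1 h2].
have e0 : 0 <= eps.
  have := hE ld => /(le_trans (normr_ge0 _)).
  by rewrite pmulr_lge0// mulr_gt0 ?exprn_gt0.
have : (eps + 2 * d%:R / L) * l`!%:R * m0 <= D * m0.
  rewrite ler_wpM2r ?(ltW m00)//; apply: le_trans hD; rewrite mulrC.
  apply: ler_pM => //.
  - by rewrite addr_ge0// divr_ge0 ?mulr_ge0// ltW.
  - by rewrite ler_nat leq_fact// ltnW.
  - by rewrite lerD2l ler_wpM2r ?invr_ge0 ?(ltW L0)// ler_peMr ?mulr_ge0// ler1n.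
by move=> h3; apply/andP; split; lra.
Qed.

(** All the terms of the weight are of the same order [A * L ^+ l], whereas the
slack is of order [A * L ^+ d.-1]. *)
Lemma low_weight_ratio l : (l < d)%N ->
  low_weight L l (cur h) / S <= 4 * d%:R * d.-1`!%:R / L ^+ (d.-1 - l).
Proof.
move=> ld; have [h1 [h2 s00]] := slack_near.
have hw := profile_low_weight L1 eps1 A0 hE ld.
have S0 : s0 / 2 <= S by have := ler_wpM2r (ltW s00) D1; lra.
have S00 : 0 < S by lra.
rewrite ler_pdivrMr//; apply: (le_trans hw).
apply: (@le_trans _ _ (4 * d%:R * d.-1`!%:R / L ^+ (d.-1 - l) * (s0 / 2))).
  have -> : 4 * d%:R * d.-1`!%:R / L ^+ (d.-1 - l) * (s0 / 2) =
     2 * d%:R * (A * L ^+ l).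
    have ll : (l <= d.-1)%N by rewrite -ltnS prednK.
    rewrite /s0 -[X in A * L ^+ X / _](subnK ll) exprD.
    by field; rewrite !gt_eqF ?exprn_gt0.
  by [].
by rewrite ler_wpM2l// divr_ge0 ?exprn_ge0 ?mulr_ge0// ltW.
Qed.

Hypothesis tl1 : forall l, target_slack l < slack_at R d n (tl l).
Hypothesis tl2 : forall l, slack_at R d n (tl l) <= target_slack l + 2.
Hypothesis htl : forall l, ((size h).-1 <= tl l)%N.
Hypothesis hy : forall l, 2 <= D * target_slack l.
Hypothesis hyS : forall l, target_slack l + 2 <= D * S.

(** The factor of [l] is [(1 - q) ^+ M] with [q] small and [q * M] close to
[x l]. *)
Lemma forecast_near (J : {set 'I_d.-1}) :
  `|forecast R J tl h - \prod_(l in J) expR (- x l)| <= \sum_(l in J) 6 * D * x l.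
Proof.
have [h1 [h2 s00]] := slack_near.
have S0 : s0 / 2 <= S by have := ler_wpM2r (ltW s00) D1; lra.
have S00 : 0 < S by lra.
have y0 l : 0 < target_slack l.
  by rewrite divr_gt0 ?mulr_gt0 ?exprn_gt0// x0.
have q01 l : 0 <= slack_at R d n (tl l) / S <= D.
  have := tl1 l; have := tl2 l; have := y0 l; have := hyS l.
  by move=> *; rewrite ler_pdivrMr// divr_ge0//=; lra.
rewrite /forecast.
have fE l : (1 - slack_at R d n (tl l) / slack_at R d n (minn (size h).-1 (tl l)))
    ^+ count_le (graph_at h (minn (size h).-1 (tl l))) l =
    (1 - slack_at R d n (tl l) / S) ^+ count_le (cur h) l.
  by rewrite (minn_idPl (htl l)) graph_at_last.
rewrite (eq_bigr _ (fun l _ => fE l)).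
apply: (le_trans (normr_prodB _ _)).
- move=> l _; case/andP: (q01 l) => a b.
  have p0 : 0 <= 1 - slack_at R d n (tl l) / S by move: D1; lra.
  have p1 : 1 - slack_at R d n (tl l) / S <= 1 by lra.
  by rewrite exprn_ge0//= exprn_ile1.
- by move=> l _; rewrite expR_ge0 expR_le1 oppr_le0 ltW.
apply: ler_sum => l _; case/andP: (q01 l) => a b.
pose m0 := A * L ^+ l / l`!%:R.
have m00 : 0 < m0 by rewrite divr_gt0 ?mulr_gt0 ?exprn_gt0.
have ym : target_slack l * m0 = x l * s0.
  have ll : (l <= d.-1)%N by rewrite ltnW.
  rewrite /target_slack /m0 /s0 -[X in A * L ^+ X / d.-1`!%:R](subnK ll) exprD.
  by field; rewrite !gt_eqF.
have /andP[c1 c2] := count_near l.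
rewrite -/m0 in c1 c2.
have D0 : 0 <= D by lra.
have t1 := tl1 l; have t2 := tl2 l; have yl := y0 l.
apply: pow_near_expR => //; first by rewrite ltW.
  set tS := slack_at R d n (tl l) in t1 t2 *; set M := (count_le _ _)%:R in c1 c2 *.
  have -> : (1 - D) / (1 + D) * x l = (1 - D) * x l / (1 + D) by ring.
  have p0 : 0 < 1 + D by lra.
  rewrite ler_pdivrMr//.
  have -> : tS / S * M * (1 + D) = tS * M * (1 + D) / S by ring.
  rewrite ler_pdivlMr//.
  apply: (@le_trans _ _ ((1 - D) * x l * ((1 + D) * s0))).
    by apply: ler_wpM2l => //; apply: mulr_ge0; [move: D1; lra | exact: ltW].
  have g : target_slack l * ((1 - D) * m0) <= tS * M.
    by apply: ler_pM; [exact: ltW | apply: mulr_ge0; move: D1; lra | exact: ltW | ].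
  have ge : target_slack l * ((1 - D) * m0) = (1 - D) * (x l * s0) by rewrite -ym; ring.
  by rewrite ge in g; have := ler_wpM2r (ltW p0) g; lra.
rewrite [leLHS]mulrAC ler_pdivrMr//.
have : slack_at R d n (tl l) * (count_le (cur h) l)%:R <=
    ((1 + D) * target_slack l) * ((1 + D) * m0).
  have T0 : 0 <= slack_at R d n (tl l) by lra.
  have T1 : slack_at R d n (tl l) <= (1 + D) * target_slack l by have := hy l; lra.
  exact: ler_pM.
have -> : (1 + D) * target_slack l * ((1 + D) * m0) = (1 + D) * (1 + D) * (x l * s0).
  by rewrite -ym; ring.
move=> g; apply: (le_trans g).
have p1 : 1 - D != 0 by rewrite gt_eqF//; move: D1; lra.
have -> : (1 + D) * (1 + D) * (x l * s0) =
  (1 + D) * (1 + D) / (1 - D) * x l * ((1 - D) * s0).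
  by move: s0 => s; field.
apply: ler_wpM2l => //; apply: mulr_ge0; last exact: ltW.
by apply: divr_ge0; [apply: mulr_ge0 | ]; move: D1; lra.
Qed.

End ForecastAtProfile.

(** * Asymptotics in the logarithm of the number of vertices *)

Section LogRatio.
Variables (R : realType) (d : nat).

(** Every error term of the argument is a constant multiple of this quantity. *)
Definition log_ratio (L : R) : R := ln (4 * L ^+ d.+1) / L.

Lemma inv_le_log_ratio (L : R) : 1 <= L -> L^-1 <= log_ratio L.
Proof.
move=> L1; have L0 : 0 < L by lra.
rewrite -[leLHS]mul1r ler_wpM2r ?invr_ge0 ?(ltW L0)//.
rewrite -ler_expR lnK ?posrE ?mulr_gt0 ?exprn_gt0//.
apply: (@le_trans _ _ 4); last by have := exprn_ege1 d.+1 L1; lra.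
have e2 : expR (1 / 2) <= 2 :> R.
  have h : expR (1 / 2) * (1 - 1 / 2) <= (1 : R).
    apply: (@le_trans _ _ (expR (1 / 2) * expR (- (1 / 2)))).
      by rewrite ler_wpM2l ?expR_ge0// expR_ge1Dx.
    by rewrite -expRD subrr expR0.
  lra.
have -> : expR 1 = expR (1 / 2) * expR (1 / 2) :> R by rewrite -expRD; congr expR; lra.
have -> : 4 = 2 * 2 :> R by lra.
by apply: ler_pM; rewrite ?expR_ge0.
Qed.

Lemma log_ratio_large (K v : R) : 0 < v ->
  exists M, forall L, M <= L -> K * log_ratio L <= v.
Proof.
move=> v0; pose c := ln (4 : R) + d.+1%:R.
have ln40 : 0 <= ln (4 : R) by rewrite ln_ge0//; lra.
have c0 : 0 <= c by rewrite addr_ge0.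
pose M := 1 + `|K| * (2 * c) / v.
have M1 : 1 <= M by rewrite lerDl divr_ge0 ?mulr_ge0// ltW.
exists (expR M) => L hL.
have L0 : 0 < L by apply: lt_le_trans hL; rewrite expR_gt0.
pose u := ln L.
have uM : M <= u by rewrite -ler_expR lnK.
have Lu : L = expR u by rewrite lnK.
have u0 : 0 < u by lra.
have Lsq : u ^+ 2 / 2 <= L.
  have := @expR_ge1Dxn R u 1%N (ltW u0); rewrite -Lu.
  have -> : (2`!)%:R = 2 :> R by [].
  lra.
have lam : log_ratio L <= 2 * c / u.
  rewrite /log_ratio lnM ?posrE ?exprn_gt0// lnXn// -/u.
  rewrite ler_pdivrMr// mulrAC ler_pdivlMr//.
  apply: (@le_trans _ _ (c * u * u)).
    have hu := ler_wpM2l ln40 (le_trans M1 uM).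
    apply: ler_wpM2r; first exact: ltW.
    rewrite /c -[u *+ d.+1]mulr_natl [leRHS]mulrDl; lra.
  have := ler_wpM2l c0 Lsq; rewrite expr2; lra.
have lam0 : 0 <= log_ratio L.
  apply: le_trans (inv_le_log_ratio _); first by rewrite invr_ge0 ltW.
  by have := @expR_ge1Dx R u; rewrite -Lu; lra.
apply: (@le_trans _ _ (`|K| * (2 * c / u))).
  apply: (@le_trans _ _ (`|K| * log_ratio L)).
    by rewrite ler_wpM2r// ler_norm.
  by rewrite ler_wpM2l.
rewrite mulrA ler_pdivrMr// -ler_pdivrMl// mulrC.
by move: uM; rewrite /M; lra.
Qed.

Lemma log_ratio_large_all (s : seq (R * R)) : all (fun p => 0 < p.2) s ->
  exists M, forall L, M <= L ->
    expR 1 <= L /\ all (fun p => p.1 * log_ratio L <= p.2) s.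
Proof.
elim: s => [_|p s IH /= /andP[p0 /IH[M hM]]]; first by exists (expR 1).
have [M' hM'] := log_ratio_large p.1 p0.
exists (Num.max M M') => L; rewrite ge_max => /andP[/hM[-> ->] /hM' ->].
by [].
Qed.

End LogRatio.

Section StepOfSlack.
Variables (R : realType) (d n : nat).

(** The slack decreases by two at each step, so a half-open interval of length two
contains exactly one of its values. *)
Lemma exists_step (y : R) : y < (d * n)%:R -> 0 <= y ->
  exists i, y < slack_at R d n i <= y + 2.
Proof.
move=> y1 y0.
pose p i := slack_at R d n i.+1 <= y.
have ex : exists i, p i.
  exists (d * n)%N; rewrite /p /slack_at; apply: le_trans y0.
  have : (0 : R) <= (d * n)%:R by [].
  by rewrite -addn1 natrD; lra.
have := ex_minnP ex => -[i pi imin]; exists i; apply/andP; split.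
  rewrite ltNge; apply/negP => h.
  case: i pi imin h => [_ _|j _ imin h]; first by rewrite /slack_at mulr0 subr0; lra.
  by have := imin j h; rewrite ltnn.
by move: pi; rewrite /p slack_atS; lra.
Qed.

Lemma slack_at_lt_index i j : slack_at R d n i < slack_at R d n j -> (j <= i)%N.
Proof.
move=> h; rewrite leqNgt; apply/negP => ij.
by have := @slack_at_le R d n i j (ltnW ij); lra.
Qed.

End StepOfSlack.

Section WindowError.
Variables (R : realType) (d n : nat) (L : R).
Hypotheses (d2 : (2 <= d)%N) (L1 : 1 <= L).
Variables (x : 'I_d.-1 -> R) (x0 : forall l, 0 < x l).
Variables (h : seq (graph 'I_n)) (eps A D c B : R) (tl : 'I_d.-1 -> nat) (k : nat).
Variable J : {set 'I_d.-1}.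
Let i := (size h).-1.
Hypotheses (rh : reachable d h) (A0 : 0 < A) (eps1 : eps <= 1).
Hypothesis hE : profile d L eps A (cur h).
Hypothesis hD : d.-1`!%:R * (eps + 2 * d%:R * d%:R / L) <= D.
Hypothesis D1 : D <= 1 / 10.
Hypotheses (c0 : 0 < c) (hc : c * L <= slack_at R d n (i + k)).
Hypothesis hcL : 4 * d%:R ^+ 2 <= c * L.
Hypotheses (B0 : 0 <= B) (hB : forall l : 'I_d.-1, x l * l`!%:R / d.-1`!%:R <= B).
Hypothesis tl0 : forall l, 0 < slack_at R d n (tl l).
Hypothesis tl2 : forall l, slack_at R d n (tl l) <= target_slack L x l + 2.
Hypotheses (S1 : 1 <= slack_at R d n i) (S4 : slack_at R d n i <= 4 * L ^+ d.+1).
Hypothesis lam1 : log_ratio d L <= 1.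

Definition window_const1 : R := 4 * d%:R ^+ 3 + 4 * d%:R ^+ 2 + 4.
Definition window_const2 : R :=
  (8 * d%:R ^+ 3 * d.-1`!%:R + 16 * d%:R ^+ 2 * ((B + 2) * d.-1`!%:R))
  * expR (2 * (1 + 2 * d%:R ^+ 2 / c)).

(** Each weight is bounded by the slack times [L ^+ l / L ^+ d.-1], and
[slack_at (tl l)] by a multiple of [L ^+ (d.-1 - l)]; one factor [L^-1] is left,
against a logarithm of the initial slack. *)
Lemma window_error :
  `|exp_after d k (forecast R J tl) h - forecast R J tl h|
  <= window_const1 / (c * L) + window_const2 * log_ratio d L.
Proof.
have L0 : 0 < L by move: L1; lra.
have d0 : (0 < d)%N by apply: leq_trans d2.
have cL0 : 0 < c * L by rewrite mulr_gt0.
have lam0 : 0 <= log_ratio d L.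
  by apply: le_trans (inv_le_log_ratio d L1); rewrite invr_ge0 ltW.
pose a := 2 * (1 + 2 * d%:R ^+ 2 / c) / L.
have k0 : 0 <= 2 * d%:R ^+ 2 / c by rewrite divr_ge0 ?mulr_ge0 ?exprn_ge0// ltW.
have a0 : 0 <= a by apply: divr_ge0; [apply: mulr_ge0; lra | exact: ltW].
have hS : 4 * d%:R ^+ 2 <= slack_at R d n (i + k) := le_trans hcL hc.
have ha : L^-1 + 2 * d%:R ^+ 2 / slack_at R d n (i + k) <= a / 2.
  have -> : a / 2 = L^-1 + 2 * d%:R ^+ 2 / (c * L) by rewrite /a; field; rewrite !gt_eqF.
  rewrite lerD2l; apply: ler_wpM2l; first by rewrite mulr_ge0 ?exprn_ge0.
  by rewrite lef_pV2 ?posrE//; apply: lt_le_trans hc.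
have := forecast_window d2 L1 rh hS a0 ha (fun l (_ : l \in J) => tl0 l).
move=> main; apply: (le_trans main).
rewrite -/i -/window_const1.
apply: lerD.
  apply: ler_wpM2l.
    by rewrite /window_const1 !addr_ge0 ?mulr_ge0 ?exprn_ge0.
  by rewrite lef_pV2 ?posrE//; apply: lt_le_trans hc.
pose f : R := d.-1`!%:R.
have f0 : 0 < f by rewrite ltr0n fact_gt0.
pose K := 8 * d%:R ^+ 3 * f + 16 * d%:R ^+ 2 * ((B + 2) * f).
have K0 : 0 <= K.
  rewrite /K addr_ge0 ?mulr_ge0 ?exprn_ge0 ?(ltW f0)// addr_ge0//.
have lnS : ln (slack_at R d n i) <= log_ratio d L * L.
  rewrite /log_ratio divfK ?gt_eqF//.
  by rewrite ler_ln ?posrE ?mulr_gt0 ?exprn_gt0//; apply: lt_le_trans S1.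
have lnS0 : 0 <= ln (slack_at R d n i) by apply: ln_ge0.
have eb : expR (a * ln (slack_at R d n i)) <= expR (2 * (1 + 2 * d%:R ^+ 2 / c)).
  rewrite ler_expR; apply: (@le_trans _ _ (a * (1 * L))).
    apply: ler_wpM2l => //; apply: (le_trans lnS); apply: ler_wpM2r => //; exact: ltW.
  by rewrite mul1r /a divfK ?gt_eqF.
have Si : 0 < slack_at R d n i by apply: lt_le_trans S1.
have ratio l : (l < d)%N -> low_weight L l (cur h) / slack_at R d n i <=
    4 * d%:R * f / L ^+ (d.-1 - l).
  exact: (low_weight_ratio d2 L1 rh A0 eps1 hE hD D1).
have ratio0 l : 0 <= low_weight L l (cur h) / slack_at R d n i.
  by rewrite divr_ge0 ?low_weight_ge0// ltW.
set X := _ + \sum_(l in J) _.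
have XK : X <= K / L.
  rewrite /X /K [leRHS]mulrDl; apply: lerD.
    have dd : (d.-2 < d)%N by rewrite -subn2 ltn_subrL d0.
    have := ratio _ dd.
    have -> : (d.-1 - d.-2 = 1)%N.
      by case: (d) d2 => [//|[//|d']] _ /=; rewrite subSnn.
    rewrite expr1 => r2.
    have -> : 8 * d%:R ^+ 3 * f / L = 2 * d%:R ^+ 2 * (4 * d%:R * f / L) by ring.
    by apply: ler_wpM2l; rewrite ?mulr_ge0 ?exprn_ge0.
  have Bf0 : 0 <= (B + 2) * f by apply: mulr_ge0; [move: B0; lra | exact: ltW].
  apply: (@le_trans _ _ (\sum_(l in J) 16 * d%:R * ((B + 2) * f) / L)).
    apply: ler_sum => l _.
    have ld : (l < d)%N by apply: leq_trans (ltn_ord l) (leq_pred d).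
    have p1 : 1 <= L ^+ (d.-1 - l) by rewrite exprn_ege1.
    have p0 : 0 < L ^+ (d.-1 - l) by lra.
    have r1 := ratio _ ld.
    have t1 : slack_at R d n (tl l) <= (B + 2) * L ^+ (d.-1 - l).
      apply: (le_trans (tl2 l)); rewrite mulrDl; apply: lerD; last first.
        by rewrite ler_peMr.
      have -> : target_slack L x l = x l * l`!%:R / f * L ^+ (d.-1 - l).
        by rewrite /target_slack -/f; ring.
      by apply: ler_wpM2r; [exact: ltW | exact: hB].
    have := ler_pM (ltW (tl0 l)) (ratio0 l) t1 r1.
    have -> : (B + 2) * L ^+ (d.-1 - l) * (4 * d%:R * f / L ^+ (d.-1 - l)) =
       4 * d%:R * ((B + 2) * f) by field; rewrite gt_eqF.
    move=> g.
    have -> : 4 * slack_at R d n (tl l) / L * (low_weight L l (cur h) / slack_at R d n i)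
      = 4 / L * (slack_at R d n (tl l) * (low_weight L l (cur h) / slack_at R d n i)) by ring.
    have -> : 16 * d%:R * ((B + 2) * f) / L = 4 / L * (4 * d%:R * ((B + 2) * f)) by ring.
    by apply: ler_wpM2l => //; rewrite divr_ge0// ltW.
  rewrite sumr_const -[leLHS]mulr_natl.
  have -> : 16 * d%:R ^+ 2 * ((B + 2) * f) / L = d%:R * (16 * d%:R * ((B + 2) * f) / L) by ring.
  apply: ler_wpM2r; first by rewrite divr_ge0 ?(ltW L0)// mulr_ge0// mulr_ge0.
  rewrite ler_nat; apply: leq_trans (leq_pred d).
  by rewrite -[leqRHS](card_ord d.-1) max_card.
have X0 : 0 <= X.
  apply: addr_ge0; first by apply: mulr_ge0 => //; rewrite mulr_ge0 ?exprn_ge0.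
  apply: sumr_ge0 => l _; apply: mulr_ge0 => //.
  by apply: divr_ge0; [apply: mulr_ge0 => // |]; exact: ltW.
apply: (@le_trans _ _ (K / L * expR (2 * (1 + 2 * d%:R ^+ 2 / c)) * (log_ratio d L * L))).
  apply: ler_pM => //; first by rewrite mulr_ge0// expR_ge0.
  by apply: ler_pM => //; rewrite expR_ge0.
rewrite /window_const2 -/f -/K le_eqVlt; apply/orP; left; apply/eqP.
by field; rewrite gt_eqF.
Qed.

End WindowError.

Lemma forecast01 (R : realType) (d n : nat) (J : {set 'I_d.-1})
    (tl : 'I_d.-1 -> nat) (h : seq (graph 'I_n)) :
  (forall l, 0 < slack_at R d n (tl l)) -> 0 <= forecast R J tl h <= 1.
Proof.
move=> t0; apply: prod_le1 => l _.
have m0 : 0 < slack_at R d n (minn (size h).-1 (tl l)).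
  by apply: lt_le_trans (t0 l) _; apply: slack_at_le; rewrite geq_minr.
have q1 : slack_at R d n (tl l) / slack_at R d n (minn (size h).-1 (tl l)) <= 1.
  by rewrite ler_pdivrMr// mul1r; apply: slack_at_le; rewrite geq_minr.
have q0 : 0 <= slack_at R d n (tl l) / slack_at R d n (minn (size h).-1 (tl l)).
  by rewrite divr_ge0// ltW.
by rewrite exprn_ge0 ?exprn_ile1//; lra.
Qed.

(** The run is cut at the step [i] where the slack passes [L ^+ d.+1]. Up to [i]
the discrepancy is small with high probability, and then the graph at [i] has
the right profile, so that the forecast there is close to the limit; the
expectation of the forecast hardly changes from [i] to [m]. *)
Lemma emptiness_limit (R : realType) (d : nat) (x : 'I_d.-1 -> R)
    (J : {set 'I_d.-1}) (eta : R) :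
  (2 <= d)%N -> (forall l, 0 < x l) -> 0 < eta ->
  exists M : R, forall (L : R), M <= L -> forall n (tl : 'I_d.-1 -> nat) (m : nat),
    expR L = n%:R ->
    (forall l, target_slack L x l < slack_at R d n (tl l)) ->
    (forall l, slack_at R d n (tl l) <= target_slack L x l + 2) ->
    (forall l, (tl l <= m)%N) -> (exists l, m = tl l) ->
    `|exp_after d m (forecast R J tl) [:: finset.set0 : graph 'I_n]
      - \prod_(l in J) expR (- x l)| <= eta.
Proof.
move=> d2 x0 eta0.
have d0 : (0 < d)%N by apply: leq_trans d2.
pose ratio (l : 'I_d.-1) : R := x l * l`!%:R / d.-1`!%:R.
have ratio_gt0 l : 0 < ratio l.
  by rewrite divr_gt0 ?mulr_gt0 ?ltr0n ?fact_gt0.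
pose f : R := d.-1`!%:R.
have f0 : 0 < f by rewrite ltr0n fact_gt0.
pose sx := \sum_(l in J) x l.
have sx0 : 0 <= sx by apply: sumr_ge0 => l _; exact: ltW.
pose D := Num.min (1 / 10) (eta / (24 * (sx + 1))).
have sx1 : 0 < 24 * (sx + 1) by lra.
have D0 : 0 < D by rewrite lt_min; apply/andP; split; [lra | exact: divr_gt0].
have D1 : D <= 1 / 10 by rewrite ge_min lexx.
have Dsx : 6 * D * sx <= eta / 4.
  have : D <= eta / (24 * (sx + 1)) by rewrite ge_min lexx orbT.
  rewrite ler_pdivlMr// => h; lra.
pose e : R := D / (4 * f).
have e0 : 0 < e by rewrite divr_gt0// mulr_gt0.
have f1 : 1 <= f by rewrite ler1n fact_gt0.
have e1 : e <= 1 / 4.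
  by rewrite ler_pdivrMr; [lra | rewrite mulr_gt0].
have fe : f * (e + e + e) <= D.
  have -> : f * (e + e + e) = 3 / 4 * D by rewrite /e; field; rewrite gt_eqF.
  lra.
pose B := \sum_l ratio l.
have hB l : ratio l <= B.
  rewrite /B (bigD1 l)//= lerDl; apply: sumr_ge0 => j _; exact: ltW.
have B0 : 0 <= B by apply: sumr_ge0 => l _; exact: ltW.
have dm : (0 < d.-1)%N by rewrite -subn1 subn_gt0.
pose c := (\sum_l (ratio l)^-1)^-1.
have hc l : 0 < c /\ c <= ratio l.
  have r0 := ratio_gt0 l.
  have s0 : (ratio l)^-1 <= \sum_l (ratio l)^-1.
    rewrite (bigD1 l)//= lerDl; apply: sumr_ge0 => j _.
    by rewrite invr_ge0 ltW.
  have s1 : 0 < \sum_l (ratio l)^-1 by apply: lt_le_trans s0; rewrite invr_gt0.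
  by split; [rewrite invr_gt0 | rewrite -[leRHS]invrK lef_pV2 ?posrE// invr_gt0].
have c0 : 0 < c by have [] := hc (Ordinal dm).
pose Cw := window_const1 R d / c + window_const2 d c B.
pose Ce := 2 * d%:R * early_const R d.
have Ce0 : 0 <= Ce by exact: early_rate_ge0.
pose Kb : R := 2 * d%:R ^+ 2 + expR 1.
have Kb0 : 0 <= Kb by rewrite addr_ge0 ?mulr_ge0 ?exprn_ge0 ?expR_ge0.
have eta4 : 0 < eta / 4 by lra.
have eta2 : 0 < eta / 2 by lra.
have [M hM] := @log_ratio_large_all R d
  [:: (1, 1); (2 * d%:R ^+ 2, 1); (d%:R, e); (2 * d%:R * d%:R, e); (2 / (D * c), 1);
      (B + 2, D); (Cw, eta / 4); (Kb, 1);
      (Ce * Kb * expR (2 * Ce) / e ^+ 2, eta / 2); (4 * d%:R ^+ 2 / c, 1)]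
  ltac:(by rewrite /= !ltr01 e0 D0 eta4 eta2).
exists M => L /hM[hL] /= /and5P[l1 k1 k2 k3] /and5P[k4 k5 k7 k8] /and3P[k9 k10 _].
rewrite mul1r in l1.
move=> n tl m nL t1 t2 tm [lm mE].
have L1 : 1 <= L by have := @expR_ge1Dx R 1; lra.
have L0 : 0 < L by lra.
have lnL1 : 1 <= ln L by rewrite -ler_expR lnK.
have Lk k : 0 < L ^+ k by rewrite exprn_gt0.
have Lk1 k : 1 <= L ^+ k by rewrite exprn_ege1.
have lamL := inv_le_log_ratio d L1.
have lam0 : 0 <= log_ratio d L by apply: le_trans lamL; rewrite invr_ge0 ltW.
(* since [L^-1 <= log_ratio d L], the conditions on [log_ratio] also compare
   constants with [L] *)
have absorb (K v : R) : 0 <= K -> K * log_ratio d L <= v -> K <= v * L.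
  move=> K0 Kv; rewrite -ler_pdivrMr//; apply: le_trans Kv.
  by apply: ler_wpM2l.
have L2 : 2 * d%:R ^+ 2 <= L.
  have K0 : 0 <= 2 * d%:R ^+ 2 :> R by rewrite mulr_ge0 ?exprn_ge0.
  by have h := absorb _ _ K0 k1; rewrite mul1r in h.
have cL : 4 * d%:R ^+ 2 <= c * L.
  have K0 : 0 <= 4 * d%:R ^+ 2 / c by rewrite divr_ge0 ?(ltW c0)// mulr_ge0 ?exprn_ge0.
  have h := absorb _ _ K0 k10; rewrite mul1r ler_pdivrMr// in h.
  by rewrite [leRHS]mulrC.
have DcL : 2 <= D * (c * L).
  have Dc0 : 0 < D * c by exact: mulr_gt0.
  have K0 : 0 <= 2 / (D * c) by rewrite divr_ge0// ltW.
  have h := absorb _ _ K0 k4; rewrite mul1r ler_pdivrMr// in h.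
  by rewrite mulrA [leRHS]mulrC.
have BL : B + 2 <= D * L by apply: absorb => //; exact: addr_ge0.
have n0R : 0 < n%:R :> R by rewrite -nL expR_gt0.
have n0 : (0 < n)%N by rewrite -(ltr0n R).
have Ln : 4 * L ^+ d.+1 <= n%:R.
  have : ln (4 * L ^+ d.+1) <= L.
    by move: l1; rewrite /log_ratio ler_pdivrMr// mul1r.
  by rewrite -ler_expR lnK ?posrE ?mulr_gt0// nL.
have [i /andP[S1 S2]] : exists i, L ^+ d.+1 < slack_at R d n i <= L ^+ d.+1 + 2.
  apply: exists_step; last exact: ltW.
  have : n%:R <= (d * n)%:R :> R by rewrite ler_nat leq_pmull.
  by move: (Lk d.+1) Ln; clear; lra.
have targetE l : target_slack L x l = ratio l * L ^+ (d.-1 - l).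
  by rewrite /target_slack /ratio; ring.
have target_low l : c * L <= target_slack L x l.
  rewrite targetE; apply: ler_pM; [exact: ltW | exact: ltW | by have [] := hc l |].
  by rewrite -[leLHS]expr1; apply: ler_weXn2l => //; rewrite subn_gt0.
have target_high l : target_slack L x l + 2 <= D * L ^+ d.+1.
  apply: (@le_trans _ _ (B * L ^+ d + 2 * L ^+ d)).
    apply: lerD; last by rewrite ler_peMr.
    rewrite targetE; apply: ler_pM => //; first exact: ltW.
      exact: ltW.
    by apply: ler_weXn2l => //; apply: leq_trans (leq_subr _ _) (leq_pred d).
  by rewrite -mulrDl exprS mulrA; apply: ler_wpM2r => //; exact: ltW.
have tl0 l : 0 < slack_at R d n (tl l).
  by apply: lt_trans (t1 l); apply: lt_le_trans (target_low l); rewrite mulr_gt0.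
have itl l : (i <= tl l)%N.
  apply: (@slack_at_lt_index R d n); apply: le_lt_trans S1.
  apply: (le_trans (t2 l)); apply: (le_trans (target_high l)).
  by rewrite ler_piMl ?(ltW (Lk _))//; move: D1; clear; lra.
have im : (i <= m)%N by rewrite mE.
have cm : c * L <= slack_at R d n m.
  by rewrite mE; apply: (le_trans (target_low lm)); exact: ltW.
pose cap := L - ln L.
have lnLL : ln L < L by apply: ln_sublinear.
have cap0 : 0 <= cap by rewrite subr_ge0 ltW.
have capL : cap + 1 <= L by rewrite /cap; move: lnL1; clear; lra.
pose bad (h : seq (graph 'I_n)) := e ^+ 2 <
  discrepancy d L (clock R d (stopped d cap h)) (cur (stopped d cap h)).
pose Pi := \prod_(l in J) expR (- x l).
have Pi01 : 0 <= Pi <= 1.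
  by apply: prod_le1 => l _; rewrite expR_ge0 expR_le1 oppr_le0 ltW.
have side0 : (d * d + 2 * m < slack d (cur [:: finset.set0 : graph 'I_n]) + 2)%N.
  apply: (@steps_below_slack R d n d2); first by rewrite /= eqxx.
  exact: le_trans cL cm.
have r0 : reachable d [:: finset.set0 : graph 'I_n] by rewrite /= eqxx.
have sidei := steps_le im side0.
have pt h : reachable d h -> size h = (1 + i)%N ->
    `|exp_after d (m - i) (forecast R J tl) h - Pi| <= eta / 2 + (bad h)%:R.
  move=> rh sh.
  have sh1 : (size h).-1 = i by rewrite sh.
  have hS : 4 * d%:R ^+ 2 <= slack_at R d n ((size h).-1 + (m - i)).
    by rewrite sh1 subnKC//; exact: le_trans cL cm.
  have sideh := steps_below_slack d2 rh hS.
  have [hb|hb] := boolP (bad h).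
    have ex01 : 0 <= exp_after d (m - i) (forecast R J tl) h <= 1.
      apply/andP; split.
        rewrite -[leLHS](exp_after_cst (0 : R) d0 rh sideh).
        by apply: exp_after_le => // h' _ _; case/andP: (forecast01 J h' tl0).
      rewrite -[leRHS](exp_after_cst (1 : R) d0 rh sideh).
      by apply: exp_after_le => // h' _ _; case/andP: (forecast01 J h' tl0).
    move: ex01 Pi01 eta2; clear => /andP[a1 a2] /andP[b1 b2] eta2.
    by rewrite /= ler_norml; apply/andP; split; lra.
  rewrite addr0.
  have hb' : discrepancy d L (clock R d (stopped d cap h)) (cur (stopped d cap h)) <= e ^+ 2.
    by rewrite leNgt.
  have e12 : 0 <= e <= 1 / 2 by move: e0 e1; clear => e0 e1; apply/andP; split; lra.
  have [A A0 hE] := stopped_profile d2 nL L2 lnL1 rh sh S1 S2 e12 hb'.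
  pose eps := e + d%:R * (ln (4 * L ^+ d.+1) / L).
  have eps1 : eps <= 1 by move: k2 e1; rewrite /log_ratio /eps; clear; lra.
  have hD : f * (eps + 2 * d%:R * d%:R / L) <= D.
    apply: le_trans fe; apply: ler_wpM2l; first exact: ltW.
    apply: lerD; first by rewrite /eps lerD2l.
    by apply: le_trans k3; apply: ler_wpM2l => //; rewrite !mulr_ge0.
  have S1' : 1 <= slack_at R d n (size h).-1.
    by rewrite sh1; move: (Lk1 d.+1) S1 S2; clear; lra.
  have S4' : slack_at R d n (size h).-1 <= 4 * L ^+ d.+1.
    by rewrite sh1; move: (Lk1 d.+1) S1 S2; clear; lra.
  have cm' : c * L <= slack_at R d n ((size h).-1 + (m - i)) by rewrite sh1 subnKC.
  have w := window_error d2 L1 J rh A0 eps1 hE hD D1 c0 cm' cL B0 hB tl0 t2 S1' S4' l1.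
  have itl' l : ((size h).-1 <= tl l)%N by rewrite sh1.
  have hy l : 2 <= D * target_slack L x l.
    by apply: (le_trans DcL); apply: ler_wpM2l; [exact: ltW | exact: target_low].
  have hyS l : target_slack L x l + 2 <= D * slack_at R d n (size h).-1.
    rewrite sh1; apply: (le_trans (target_high l)).
    by apply: ler_wpM2l; exact: ltW.
  have v := forecast_near d2 L1 x0 rh A0 eps1 hE hD D1 t1 t2 itl' hy hyS J.
  have w2 : window_const1 R d / (c * L) + window_const2 d c B * log_ratio d L <= eta / 4.
    apply: le_trans k7; rewrite [leRHS]mulrDl lerD2r invfM mulrA.
    apply: ler_wpM2l => //; rewrite divr_ge0 ?(ltW c0)//.
    by rewrite /window_const1 !addr_ge0 ?mulr_ge0 ?exprn_ge0.
  have v2 : \sum_(l in J) 6 * D * x l <= eta / 4 by rewrite -mulr_sumr.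
  rewrite -/Pi in v.
  have -> : exp_after d (m - i) (forecast R J tl) h - Pi =
    (exp_after d (m - i) (forecast R J tl) h - forecast R J tl h)
    + (forecast R J tl h - Pi) by ring.
  apply: (le_trans (ler_normD _ _)); move: w w2 v v2; clear; lra.
have badP : exp_after d i (fun h => (bad h)%:R) [:: finset.set0 : graph 'I_n] <= eta / 2.
  have hS : 4 * d%:R ^+ 2 <= slack_at R d n i.
    by apply: le_trans (ltW S1); exact: (large_power d2 L2 d0).
  have := discrepancy_large_prob d2 L1 cap0 capL n0 hS (exprn_gt0 2 e0).
  set b := _ + _ => hP.
  have bK : 0 <= b <= Kb / L.
    have Li : L <= slack_at R d n i.
      apply: le_trans (ltW S1); rewrite exprS -[leLHS]mulr1.
      by apply: ler_wpM2l; [exact: ltW | exact: Lk1].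
    have Si : 0 < slack_at R d n i := lt_le_trans L0 Li.
    apply/andP; split.
      apply: addr_ge0; last by rewrite divr_ge0 ?expR_ge0.
      by apply: divr_ge0; [rewrite mulr_ge0 ?exprn_ge0 | exact: ltW].
    rewrite /b /Kb [leRHS]mulrDl; apply: lerD.
      by apply: ler_wpM2l; [rewrite mulr_ge0// exprn_ge0 | rewrite lef_pV2 ?posrE].
    have -> : cap + 1 = 1 + L + - ln L by rewrite /cap; ring.
    rewrite expRD expRD nL expRN lnK ?posrE//.
    by rewrite le_eqVlt; apply/orP; left; apply/eqP; field; rewrite !gt_eqF.
  case/andP: bK => b0 bK.
  have bl : b <= Kb * log_ratio d L.
    by apply: (le_trans bK); apply: ler_wpM2l.
  apply: (le_trans hP); apply: le_trans k9; rewrite -/Ce.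
  have -> : Ce * Kb * expR (2 * Ce) / e ^+ 2 * log_ratio d L =
    Ce * (Kb * log_ratio d L) * expR (2 * Ce) / e ^+ 2 by ring.
  apply: ler_wpM2r; first by rewrite invr_ge0 exprn_ge0// ltW.
  apply: ler_pM; [exact: mulr_ge0 | exact: expR_ge0 | exact: ler_wpM2l |].
  rewrite ler_expR [leRHS]mulrC; apply: ler_wpM2l => //; move: bl k8; clear; lra.
have -> : m = (i + (m - i))%N by rewrite subnKC.
rewrite exp_after_addn -/Pi.
set g := exp_after d (m - i) _ in pt *.
have up : exp_after d i g [:: finset.set0] <= Pi + eta / 2 +
    exp_after d i (fun h => (bad h)%:R) [:: finset.set0 : graph 'I_n].
  rewrite -[X in X + _](exp_after_cst _ d0 r0 sidei) -exp_afterD.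
  apply: exp_after_le => // h rh sh.
  by have := pt h rh sh; rewrite ler_norml => /andP[_]; clear; lra.
have dn : Pi - eta / 2 - exp_after d i (fun h => (bad h)%:R) [:: finset.set0 : graph 'I_n]
    <= exp_after d i g [:: finset.set0].
  rewrite -[X in _ + X]mulN1r -exp_afterZ.
  rewrite -[X in X + _](exp_after_cst _ d0 r0 sidei) -exp_afterD.
  apply: exp_after_le => // h rh sh.
  by have := pt h rh sh; rewrite ler_norml => /andP[+ _]; clear; lra.
by rewrite ler_norml; apply/andP; split; move: up dn badP; clear; lra.
Qed.

(** * Joint distribution functions *)

Section ExponentialCdf.
Local Open Scope classical_set_scope.
Variables (R : realType) (disp : measure_display) (T : measurableType disp).
Variable P : probability T R.

Lemma exponential_cdf (Z : {RV P >-> R}) (x : R) : exponential_mean1 Z -> 0 < x ->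
  P (Z @^-1` `]-oo, x]) = (1 - expR (- x))%:E.
Proof.
move=> hZ x0.
have split_itv : `]-oo, x] = `]-oo, (0 : R)[ `|` `[0, x].
  apply/seteqP; split => y /=; rewrite !in_itv /=.
    by move=> yx; case: (ltP y 0) => y0; [left | right; rewrite yx].
  by case=> [y0|/andP[//]]; rewrite ltW// (lt_trans y0).
have -> : P (Z @^-1` `]-oo, x]) = distribution P Z `]-oo, x] by [].
rewrite split_itv measureU//; last first.
  apply/seteqP; split => y //=; rewrite !in_itv /= => -[y0 /andP[y1 _]].
  by move: y0; rewrite ltNge y1.
rewrite [X in (X + _)%E]hZ// [X in (_ + X)%E]hZ// exponential_prob_itv0c//.
rewrite {1}/exponential_prob integral0_eq ?add0e; first by rewrite mulN1r.
by move=> y /=; rewrite in_itv /= => y0; rewrite lt0_exponential_pdf.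
Qed.

Variables (k : nat) (Z : 'I_k -> {RV P >-> R}).
Hypotheses (hi : mutually_independent Z) (he : forall l, exponential_mean1 (Z l)).

Lemma exponential_joint_cdf (x : 'rV[R]_k) : (forall l, 0 < x ord0 l) ->
  joint_cdf P (fun l w => Z l w) x = \prod_l (1 - expR (- x ord0 l)).
Proof.
move=> x0; rewrite /joint_cdf.
have -> : [set w | forall l : 'I_k, Z l w <= x ord0 l] =
   [set w | forall l, l \in [set: 'I_k]%SET -> `]-oo, x ord0 l] (Z l w)].
  apply/seteqP; split => w /= hw l; first by move=> _; rewrite in_itv /= hw.
  by have := hw l; rewrite inE => /(_ isT); rewrite in_itv.
rewrite (hi _ (A := fun l => `]-oo, x ord0 l])); last by move=> l; exact: measurable_itv.
transitivity (fine (\prod_(l in [set: 'I_k]%SET) (1 - expR (- x ord0 l))%:E)%E).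
  by congr fine; apply: eq_bigr => l _; apply: exponential_cdf.
rewrite prodEFin /=; apply: eq_bigl => l; rewrite inE//.
Qed.

Lemma joint_cdf_le (x y : 'rV[R]_k) : (forall l, x ord0 l <= y ord0 l) ->
  joint_cdf P (fun l w => Z l w) x <= joint_cdf P (fun l w => Z l w) y.
Proof.
move=> xy.
have mA (z : 'rV[R]_k) : measurable [set w | forall l : 'I_k, Z l w <= z ord0 l].
  have -> : [set w | forall l : 'I_k, Z l w <= z ord0 l] =
      \bigcap_(l in [set: 'I_k]) (Z l @^-1` `]-oo, z ord0 l]).
    apply/seteqP; split => w /= hw l; first by move=> _ /=; rewrite in_itv /= hw.
    by have := hw l I; rewrite /= in_itv.
  apply: fin_bigcap_measurable => // l _.
  by rewrite -[X in measurable X]setTI; apply: measurable_funP.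
rewrite /joint_cdf fine_le ?fin_num_measure//.
apply: le_measure; [exact/mem_set/mA | exact/mem_set/mA |].
by move=> w /= hw l; apply: le_trans (hw l) (xy l).
Qed.

End ExponentialCdf.

Section HittingEvent.
Variables (R : realType) (d n : nat).
Hypothesis d2 : (2 <= d)%N.
Let d0 : (0 < d)%N. Proof. by apply: leq_trans d2. Qed.

Definition avoids l (t : nat) (g : nat -> graph 'I_n) : bool :=
  all (fun i => ~~ no_vertex_deg_le l (g i)) (iota 0 t.+1).

Lemma hitting_step_gt l t (g : nat -> graph 'I_n) : (t < last_step d n)%N ->
  (t < hitting_step d l g)%N = avoids l t g.
Proof.
move=> tl; rewrite /hitting_step leq_min tl /= /avoids all_predC.
set s := iota 0 (last_step d n).+1.
have -> : iota 0 t.+1 = take t.+1 s by rewrite take_iota (minn_idPl _)// ltnW.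
rewrite has_take_leq ?size_iota; last by rewrite ltnW.
by rewrite -leqNgt.
Qed.

(** The statistic is at most [x] exactly if the hitting step comes after the last
step at which the slack exceeds the target. *)
Lemma Vstat_le (x L : R) l t (g : nat -> graph 'I_n) :
  L = ln n%:R -> 0 < L -> (t < last_step d n)%N ->
  x * l`!%:R * L ^+ (d.-1 - l) / d.-1`!%:R < slack_at R d n t ->
  slack_at R d n t <= x * l`!%:R * L ^+ (d.-1 - l) / d.-1`!%:R + 2 ->
  (Vstat R d l g <= x) = avoids l t g.
Proof.
move=> LE L0 tl t1 t2; rewrite -hitting_step_gt// /Vstat -LE.
have f0 k : 0 < k`!%:R :> R by rewrite ltr0n fact_gt0.
rewrite ler_pdivrMr ?mulr_gt0 ?exprn_gt0// -ler_pdivlMl//.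
rewrite [X in _ <= X](_ : _ = x * l`!%:R * L ^+ (d.-1 - l) / d.-1`!%:R); last by ring.
rewrite -/(slack_at R d n (hitting_step d l g)).
set T := hitting_step d l g; case: (ltnP t T) => tT.
  by have := @slack_at_le R d n _ _ tT; rewrite slack_atS; lra.
by apply/negbTE; rewrite -ltNge; apply: lt_le_trans t1 _; exact: slack_at_le.
Qed.

Lemma eq_hitting_step l (g g' : nat -> graph 'I_n) :
  (forall i, (i <= last_step d n)%N -> g i = g' i) ->
  hitting_step d l g = hitting_step d l g'.
Proof.
move=> gg; rewrite /hitting_step; congr minn; apply: eq_in_find => i.
by rewrite mem_iota => /andP[_ il]; rewrite gg.
Qed.

Lemma no_vertex_deg_leE l (E : graph 'I_n) : no_vertex_deg_le l E = (count_le E l == 0%N).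
Proof.
rewrite /no_vertex_deg_le /count_le cards_eq0; apply/forallP/eqP => [h|h v].
  by apply/setP => v; rewrite !inE; apply/negbTE/h.
by apply/negP => hv; have : v \in finset.set0 by [rewrite -h inE]; rewrite inE.
Qed.

(** Degrees never decrease along a history. *)
Lemma reachable_graph_at_mono (h : seq (graph 'I_n)) i j l :
  reachable d h -> (i <= j)%N -> (j < size h)%N ->
  no_vertex_deg_le l (graph_at h i) -> no_vertex_deg_le l (graph_at h j).
Proof.
move=> rh; elim/reachable_ind : rh i j => [|h' e rh eF IH] i j ij jh.
  by move: ij jh; rewrite ltnS leqn0 => + /eqP jj; rewrite jj leqn0 => /eqP ->.
rewrite /= ltnS leq_eqVlt in jh.
have [js|js] := ltnP j (size h').
  rewrite !graph_at_cons//; last exact: leq_ltn_trans js.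
  exact: IH.
have jE : j = size h' by apply/eqP; move: jh; rewrite ltnNge js orbF.
have [->//|ilt] := eqVneq i j.
have {}ij : (i < size h')%N by rewrite -jE ltn_neqAle ilt.
have s0 : (size h' > 0)%N by apply: leq_ltn_trans ij.
rewrite graph_at_cons// => hi.
have ip : (i <= (size h').-1)%N by rewrite -ltnS prednK.
have pp : ((size h').-1 < size h')%N by rewrite prednK.
have := IH i (size h').-1 ip pp hi.
rewrite graph_at_last jE; have := graph_at_last ((e |: cur h') :: h') => /= ->.
rewrite /no_vertex_deg_le => /forallP hv; apply/forallP => v; apply/negP => hd.
have /negP := hv v; apply; apply: leq_trans hd.
have [_ eE _] := free_pairsP d0 eF.
by rewrite /cur /= degreeU// leq_addr.
Qed.

Lemma avoids_reachable (h : seq (graph 'I_n)) l t : reachable d h -> (t < size h)%N ->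
  avoids l t (graph_at h) = (count_le (graph_at h t) l != 0%N).
Proof.
move=> rh th; rewrite -no_vertex_deg_leE /avoids; apply/allP/idP => [h1|h1 i].
  by apply: h1; rewrite mem_iota /= add0n ltnS.
rewrite mem_iota add0n ltnS => /andP[_ it]; apply: contra h1.
exact: reachable_graph_at_mono.
Qed.

End HittingEvent.

Lemma inclusion_exclusion (R : comNzRingType) (I : finType) (b : I -> R) :
  \prod_i (1 - b i) = \sum_(J : {set I}) (-1) ^+ #|J| * \prod_(i in J) b i.
Proof.
transitivity (\prod_i (- b i + 1)); first by apply: eq_bigr => i _; rewrite addrC.
rewrite bigA_distr; apply: eq_bigr => J _.
by rewrite -prodrN [RHS]big_mkcond.
Qed.

Lemma target_slack_bounds (R : realType) (d : nat) (x : 'I_d.-1 -> R) (K : R) :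
  (2 <= d)%N -> (forall l, 0 < x l) -> 0 <= K ->
  exists M : R, forall L : R, M <= L -> 1 <= L /\
    forall n l, expR L = n%:R ->
      K <= target_slack L x l /\ target_slack L x l < (d * n)%:R.
Proof.
move=> d2 x0 K0; pose r (l : 'I_d.-1) : R := x l * l`!%:R / d.-1`!%:R.
have r0 l : 0 < r l by rewrite divr_gt0 ?mulr_gt0 ?ltr0n ?fact_gt0.
have [M hM] := @log_ratio_large R d 1 1 ltr01.
exists (Num.max M (1 + \sum_l (r l + K / r l))) => L.
rewrite ge_max => /andP[/hM]; rewrite mul1r => lam hL.
have s0 l : 0 <= r l + K / r l 
  by apply: addr_ge0; [exact: ltW | apply: divr_ge0 => //; exact: ltW].
have S0 : 0 <= \sum_l (r l + K / r l) by apply: sumr_ge0 => i _.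
have L1 : 1 <= L by apply: le_trans hL; rewrite lerDl.
have L0 : 0 < L by apply: lt_le_trans L1.
split=> // n l nL.
have rL : r l + K / r l <= L.
  apply: le_trans hL; rewrite (bigD1 l)//=.
  have : 0 <= \sum_(i | i != l) (r i + K / r i) by apply: sumr_ge0 => i _.
  lra.
have r2 : 0 <= K / r l by apply: divr_ge0 => //; exact: ltW.
have tE : target_slack L x l = r l * L ^+ (d.-1 - l).
  by rewrite /target_slack /r; ring.
rewrite tE; split.
  apply: (@le_trans _ _ (r l * L)).
    rewrite mulrC -ler_pdivrMr//; have := r0 l; lra.
  by rewrite ler_pM2l// -[leLHS]expr1 ler_weXn2l// subn_gt0.
have n0 : 0 < n%:R :> R by rewrite -nL expR_gt0.
have Ln : 4 * L ^+ d.+1 <= n%:R.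
  rewrite -nL -ler_ln ?posrE ?expR_gt0 ?mulr_gt0 ?exprn_gt0// expRK.
  by move: lam; rewrite /log_ratio ler_pdivrMr// mul1r.
have nd : n%:R <= (d * n)%:R :> R by rewrite ler_nat leq_pmull// ltnW.
apply: lt_le_trans nd; apply: lt_le_trans Ln.
have Ld : 0 < L ^+ d.+1 by rewrite exprn_gt0.
have : r l * L ^+ (d.-1 - l) <= L * L ^+ d.
  apply: ler_pM; rewrite ?(ltW (r0 l)) ?exprn_ge0 ?(ltW L0)//; first lra.
  by rewrite ler_weXn2l//; apply: leq_trans (leq_subr _ _) (leq_pred d).
by rewrite -exprS; lra.
Qed.

Section ProcessLimit.
Local Open Scope classical_set_scope.
Variables (R : realType) (d : nat).
Hypothesis d2 : (2 <= d)%N.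
Let d0 : (0 < d)%N. Proof. by apply: leq_trans d2. Qed.

Section FixedOrder.
Variables (n : nat) (disp : measure_display) (T : measurableType disp).
Variables (P : probability T R) (G : nat -> T -> graph 'I_n).
Hypothesis hG : is_d_process d P G.

Let stat (l : 'I_d.-1) (w : T) : R := Vstat R d l (fun i => G i w).

Lemma joint_cdf_history (x : 'rV[R]_d.-1) :
  joint_cdf P stat x = exp_after d (last_step d n)
    (fun h : seq (graph 'I_n) => [forall l : 'I_d.-1, Vstat R d l (graph_at h) <= x ord0 l]%:R)
    [:: finset.set0].
Proof.
rewrite -(prob_of_history hG _ (leqnn _)) /joint_cdf; congr (fine (P _)).
have statE (l : 'I_d.-1) w : Vstat R d l (graph_at (history G (last_step d n) w)) = stat l w.
  rewrite /stat /Vstat (@eq_hitting_step d n l _ (fun i => G i w))// => i il.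
  exact: graph_at_history.
apply/seteqP; split => w /= hw.
  by apply/forallP => l; rewrite statE.
by move=> l; rewrite -statE; exact: (forallP hw).
Qed.

Lemma exp_after_mono m (f g : seq (graph 'I_n) -> R) h :
  (forall h', f h' <= g h') -> exp_after d m f h <= exp_after d m g h.
Proof.
move=> fg; elim: m h => //= m IH h.
apply: ler_sum => F _; rewrite ler_wpM2l ?IH//.
rewrite /step_prob; case: ifP => _ //; apply: sumr_ge0 => e _.
by rewrite divr_ge0.
Qed.

Lemma joint_cdf_stat_le (x y : 'rV[R]_d.-1) : (forall l, x ord0 l <= y ord0 l) ->
  joint_cdf P stat x <= joint_cdf P stat y.
Proof.
move=> xy; rewrite !joint_cdf_history; apply: exp_after_mono => h.
rewrite ler_nat; case: forallP => //= hx.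
by rewrite lt0b; apply/forallP => l; apply: le_trans (hx l) (xy l).
Qed.

Lemma joint_cdf_stat_ge0 (x : 'rV[R]_d.-1) : 0 <= joint_cdf P stat x.
Proof. by rewrite /joint_cdf fine_ge0. Qed.

Variables (x : 'rV[R]_d.-1) (L : R) (tl : 'I_d.-1 -> nat) (m : nat).
Hypotheses (LE : L = ln n%:R) (L0 : 0 < L).
Let y l := target_slack L (fun l => x ord0 l) l.
Hypotheses (t1 : forall l, y l < slack_at R d n (tl l))
  (t2 : forall l, slack_at R d n (tl l) <= y l + 2).
Hypotheses (tlast : forall l, (tl l < last_step d n)%N).
Hypotheses (tm : forall l, (tl l <= m)%N) (mlast : (m <= last_step d n)%N).
Hypothesis mS : 4 * d%:R ^+ 2 <= slack_at R d n m.

Lemma forecast_final (J : {set 'I_d.-1}) (h : seq (graph 'I_n)) : size h = m.+1 ->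
  (forall l, 0 < slack_at R d n (tl l)) ->
  forecast R J tl h = \prod_(l in J) (count_le (graph_at h (tl l)) l == 0%N)%:R.
Proof.
move=> sh t0; apply: eq_bigr => l _; rewrite sh /= (minn_idPr (tm l)).
have s0 : slack_at R d n (tl l) != 0 by rewrite gt_eqF.
by rewrite divff// subrr expr0n.
Qed.

(** At time [m] all factors of the forecast are frozen, so it is the indicator that
no vertex of degree at most [l] is left at step [tl l], for all [l] in [J]; the
event that such vertices are left for every [l] follows by inclusion and
exclusion. *)
Lemma joint_cdf_forecast : (forall l, 0 < slack_at R d n (tl l)) ->
  joint_cdf P stat x = \sum_(J : {set 'I_d.-1}) (-1) ^+ #|J| *
    exp_after d m (forecast R J tl) [:: finset.set0 : graph 'I_n].
Proof.
move=> t0.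
pose Q (h : seq (graph 'I_n)) := [forall l : 'I_d.-1, avoids l (tl l) (graph_at h)].
have -> : joint_cdf P stat x = exp_after d m (fun h => (Q h)%:R) [:: finset.set0].
  rewrite -(prob_of_history hG _ mlast) /joint_cdf; congr (fine (P _)).
  have av (l : 'I_d.-1) w : (stat l w <= x ord0 l) = avoids l (tl l) (graph_at (history G m w)).
    rewrite /stat (Vstat_le _ LE L0 (tlast l) (t1 l) (t2 l)).
    apply: eq_in_all => i; rewrite mem_iota add0n ltnS => /andP[_ it].
    by rewrite graph_at_history// (leq_trans it).
  apply/seteqP; split => w /= hw.
    by apply/forallP => l; rewrite -av.
  by move=> l; rewrite av; exact: (forallP hw).
have r0 : reachable d [:: finset.set0 : graph 'I_n] by rewrite /= eqxx.
have side : (d * d + 2 * m < slack d (cur [:: finset.set0 : graph 'I_n]) + 2)%N.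
  by apply: (@steps_below_slack R d n d2) => //; exact: mS.
have QE h : reachable d h -> size h = (1 + m)%N ->
    (Q h)%:R = \sum_(J : {set 'I_d.-1}) (-1) ^+ #|J| * forecast R J tl h.
  move=> rh sh; transitivity
    (\prod_(l < d.-1) (1 - (count_le (graph_at h (tl l)) l == 0%N)%:R) : R).
    have av (l : 'I_d.-1) : avoids l (tl l) (graph_at h) = (count_le (graph_at h (tl l)) l != 0%N).
      by apply: (avoids_reachable d2) => //; rewrite sh ltnS.
    have [/forallP hQ|] := boolP (Q h).
      rewrite big1// => l _; have := hQ l; rewrite av => /negbTE ->.
      by rewrite subr0.
    rewrite negb_forall => /existsP[l]; rewrite av negbK => /eqP hl.
    by rewrite (bigD1 l)//= hl eqxx subrr mul0r.
  rewrite inclusion_exclusion; apply: eq_bigr => J _.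
  by rewrite forecast_final.
transitivity (exp_after d m (fun h => \sum_(J : {set 'I_d.-1}) (-1) ^+ #|J| *
    forecast R J tl h) [:: finset.set0 : graph 'I_n]).
  apply/eqP; rewrite eq_le; apply/andP; split.
    by apply: exp_after_le => // h rh sh; rewrite QE.
  by apply: exp_after_le => // h rh sh; rewrite QE.
by rewrite exp_after_sum; apply: eq_bigr => J _; exact: exp_afterZ.
Qed.

End FixedOrder.

Variables (disp : nat -> measure_display) (T : forall n, measurableType (disp n)).
Variables (P : forall n, probability (T n) R) (G : forall n, nat -> T n -> graph 'I_n).
Hypothesis hG : forall n, is_d_process d (P n) (@G n).

Let cdf (x : 'rV[R]_d.-1) n : R :=
  joint_cdf (P n) (fun (l : 'I_d.-1) w => Vstat R d l (fun i => @G n i w)) x.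

Lemma ln_nat_large (M : R) : exists N, forall n, (N <= n)%N -> M <= ln n%:R /\ (0 < n)%N.
Proof.
exists (Num.bound (expR M)) => n hn.
have h : expR M < n%:R.
  apply: lt_le_trans (_ : (Num.bound (expR M))%:R <= _); last by rewrite ler_nat.
  by apply: archi_boundP; exact: expR_ge0.
have n0 : 0 < n%:R :> R by apply: lt_trans h; exact: expR_gt0.
by split; [rewrite -ler_expR lnK ?posrE// ltW | rewrite -(ltr0n R)].
Qed.

Lemma cdf_positive_cvg (x : 'rV[R]_d.-1) : (forall l, 0 < x ord0 l) ->
  cdf x @ \oo --> \prod_l (1 - expR (- x ord0 l)).
Proof.
move=> x0; apply/cvgrPdist_le => eps eps0.
pose N := #|{set 'I_d.-1}|.
have N0 : 0 < N%:R :> R by rewrite ltr0n; apply/card_gt0P; exists finset.set0.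
pose eta := eps / N%:R.
have eta0 : 0 < eta by rewrite divr_gt0.
pose K : R := 4 * d%:R ^+ 2 + 2.
have K0 : 0 <= K by rewrite addr_ge0 ?mulr_ge0 ?exprn_ge0.
have [M1 hM1] := target_slack_bounds d2 x0 K0.
have /choice[M2 hM2] := fun J : {set 'I_d.-1} => emptiness_limit J d2 x0 eta0.
have dm : (0 < d.-1)%N by rewrite -subn1 subn_gt0.
have [N1 hN1] := ln_nat_large (Num.max M1 (\sum_J `|M2 J|)).
exists N1 => // n /= /hN1 [+ n0]; rewrite ge_max.
set L := ln n%:R => /andP[LM1 LM2].
have nL : expR L = n%:R by rewrite lnK// posrE ltr0n.
have [L1 tb] := hM1 L LM1.
have L0 : 0 < L by apply: lt_le_trans L1.
have {}LM2 J : M2 J <= L.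
  apply: le_trans (ler_norm _) _; apply: le_trans LM2.
  by rewrite (bigD1 J)//= lerDl; apply: sumr_ge0 => i _.
pose y l := target_slack L (fun l => x ord0 l) l.
have yK l : K <= y l by have [] := tb n l nL.
have /choice[tl ht] : forall l, exists t, y l < slack_at R d n t <= y l + 2.
  move=> l; have [_ h2] := tb n l nL; apply: exists_step => //.
  exact: le_trans K0 (yK l).
have t1 l : y l < slack_at R d n (tl l) by case/andP: (ht l).
have t2 l : slack_at R d n (tl l) <= y l + 2 by case/andP: (ht l).
have D0 : 0 <= d%:R ^+ 2 :> R by rewrite exprn_ge0.
have t0 l : 0 < slack_at R d n (tl l).
  by apply: lt_trans (t1 l); apply: lt_le_trans (yK l); rewrite /K; lra.
have tlast l : (tl l < last_step d n)%N.
  have h : 2 < slack_at R d n (tl l).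
    by apply: le_lt_trans (t1 l); apply: le_trans (yK l); rewrite /K; lra.
  have h2 : ((tl l).+1 * 2 <= d * n)%N.
    rewrite -(ler_nat R) natrM -natr1; move: h; rewrite /slack_at; lra.
  by rewrite /last_step -[(tl l).+1]doubleK half_leq// -muln2.
pose m := \max_l tl l.
have tm l : (tl l <= m)%N by exact: leq_bigmax.
have [lm mE] : {l | m = tl l} by apply: bigop.eq_bigmax; rewrite card_ord.
have mlast : (m <= last_step d n)%N by rewrite mE ltnW.
have mS : 4 * d%:R ^+ 2 <= slack_at R d n m.
  by rewrite mE; apply: le_trans (ltW (t1 lm)); apply: le_trans (yK lm); rewrite /K; lra.
rewrite /cdf (joint_cdf_forecast (hG n) (erefl L) L0 t1 t2 tlast tm mlast mS t0).
rewrite inclusion_exclusion -sumrB.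
apply: (le_trans (ler_norm_sum _ _ _)).
apply: (@le_trans _ _ (\sum_(J : {set 'I_d.-1}) eta)); last first.
  by rewrite sumr_const -[leLHS]mulr_natr /eta -/N divfK// gt_eqF.
apply: ler_sum => J _; rewrite -mulrBr normrM normrX normrN1 expr1n mul1r distrC.
apply: (hM2 J L (LM2 J) n tl m nL t1 t2 tm).
by exists lm.
Qed.

(** If some coordinate of [x] is not positive, both distribution functions are
small at [x], because they are bounded by their values at a point whose
coordinates are positive and one of which is tiny. *)
Lemma cdf_cvg (disp' : measure_display) (T' : measurableType disp')
    (P' : probability T' R) (Z : 'I_d.-1 -> {RV P' >-> R}) :
  mutually_independent Z -> (forall l, exponential_mean1 (Z l)) ->
  forall x : 'rV[R]_d.-1, cdf x @ \oo --> joint_cdf P' (fun l w => Z l w) x.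
Proof.
move=> hi he x.
have [/forallP x0|] := boolP [forall l, 0 < x ord0 l].
  by rewrite exponential_joint_cdf//; exact: cdf_positive_cvg.
rewrite negb_forall => /existsP[l0]; rewrite -leNgt => xl0.
apply/cvgrPdist_le => eps eps0.
pose delta := eps / 2.
have delta0 : 0 < delta by rewrite divr_gt0.
pose x' : 'rV[R]_d.-1 := \row_l Num.max (x ord0 l) delta.
have xx' l : x ord0 l <= x' ord0 l by rewrite mxE le_max lexx.
have x'0 l : 0 < x' ord0 l by rewrite mxE lt_max delta0 orbT.
pose p := \prod_l (1 - expR (- x' ord0 l)).
have p01 l : 0 <= 1 - expR (- x' ord0 l) <= 1.
  rewrite subr_ge0 expR_le1 oppr_le0 ltW//= gerBl; exact: expR_ge0.
have pd : p <= delta.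
  rewrite /p (bigD1 l0)//=.
  have /andP[q0 q1] : 0 <= \prod_(i | i != l0) (1 - expR (- x' ord0 i)) <= 1.
    by apply: prod_le1.
  have /andP[r0 r1] := p01 l0.
  apply: (@le_trans _ _ (1 - expR (- x' ord0 l0))); first by rewrite ler_piMr.
  have -> : x' ord0 l0 = delta.
    by rewrite mxE; apply/max_idPr; apply: le_trans xl0 _; exact: ltW.
  by have := expR_ge1Dx (- delta); lra.
have lim0 : 0 <= joint_cdf P' (fun l w => Z l w) x by rewrite /joint_cdf fine_ge0.
have limd : joint_cdf P' (fun l w => Z l w) x <= delta.
  apply: le_trans pd; rewrite /p -(exponential_joint_cdf hi he x'0).
  exact: joint_cdf_le.
have /cvgrPdist_le/(_ _ delta0) := cdf_positive_cvg x'0.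
apply: filterS => n /= hn.
have c0 : 0 <= cdf x n by exact: joint_cdf_stat_ge0.
have c1 : cdf x n <= cdf x' n by exact: (joint_cdf_stat_le (hG n)).
have : cdf x' n <= p + delta by move: hn; rewrite -/p ler_norml => /andP[]; lra.
have e2 : delta + delta = eps by rewrite /delta; lra.
by move=> h; rewrite ler_norml; apply/andP; split; lra.
Qed.

End ProcessLimit.

Theorem theorem1 (R : realType) (d : nat) (hd : (2 <= d)%N)
    (disp : nat -> measure_display)
    (T : forall n : nat, measurableType (disp n))
    (P : forall n : nat, probability (T n) R)
    (G : forall n : nat, nat -> T n -> graph 'I_n)
    (hG : forall n : nat, is_d_process d (P n) (G n))
    (disp' : measure_display) (T' : measurableType disp')
    (P' : probability T' R) (Z : 'I_d.-1 -> {RV P' >-> R})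
    (hZind : mutually_independent Z)
    (hZexp : forall l : 'I_d.-1, exponential_mean1 (Z l)) :
  cvg_in_distribution P
    (fun n (l : 'I_d.-1) (w : T n) => Vstat R d l (fun i => G n i w))
    P' (fun (l : 'I_d.-1) (w : T') => Z l w).
Proof. by move=> x _; exact: (cdf_cvg hd hG hZind hZexp). Qed.
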